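(* Let $\mathbb{F}$ be a non-zero locally finite measure concentrated on $(0,\infty)$ with distribution function $F(z)=\mathbb{F}((0,z])$, $z\ge 0$, let $\eta$ be a Poisson process on $\mathbb{R}^2\times(0,\infty)$ with intensity measure $\nu_2\times\mathbb{F}$, and let $(W_n)_{n\ge1}$ be a convex averaging sequence in $\mathbb{R}^2$. Let $\hat{F}_n$ be the unique function in $\mathcal{F}_+$ which satisfies, for all $z\ge 0$, $$\hat{F}_n^V(z)=1-\exp\left(-\pi\int_0^z\hat{F}_n(t)\,\mathrm{d}t\right)+\pi\hat{F}_n(z)\left(\hat{m}_n-\int_0^z\exp\left(-\pi\int_0^u\hat{F}_n(t)\,\mathrm{d}t\right)\mathrm{d}u\right).$$ Then, with probability one, $\lim_{n\to\infty}\hat{F}_n(z)=F(z)$ for all $z\ge 0$.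
   Context: $\nu_2$ is Lebesgue measure on $\mathbb{R}^2$. Locally finite means finite on bounded Borel sets; in particular $\mathbb{F}((0,z])<\infty$ for all $z$. $\mathcal{F}_+$ is the space of all (not necessarily bounded) distribution functions on $(0,\infty)$, i.e. functions $F:[0,\infty)\to[0,\infty)$ of the form $F(z)=\mu((0,z])$ with $\mu$ a locally finite measure on $(0,\infty)$; $\int_0^z\cdot\,\mathrm{d}F$ is the Lebesgue–Stieltjes integral over $(0,z]$. A convex averaging sequence $(W_n)_{n\ge1}$ is an increasing sequence ($W_n\subset W_{n+1}$) of compact convex subsets of $\mathbb{R}^2$ with $\sup\{r\ge 0: B(x,r)\subset W_n\text{ for some }x\in W_n\}\to\infty$, where $B(x,r)$ is the open ball. The point process $\eta$ is identified with its random set of points $(x,h)$, $x\in\mathbb{R}^2$, $h>0$. The Laguerre cell of $(x,h)\in\eta$ is $$C((x,h),\eta)=\{y\in\mathbb{R}^2:\|y-x\|^2+h\le\|y-x'\|^2+h'\ \text{for all }(x',h')\in\eta\}.$$ Definition of $\hat{F}_n^V$ (estimator of the volume-biased weight distribution): $$\hat{F}_n^V(z)=\frac{\sum_{(x,h)\in\eta}\mathbf{1}_{W_n}(x)\mathbf{1}_{(0,z]}(h)\,\nu_2(C((x,h),\eta))}{\sum_{(x,h)\in\eta}\mathbf{1}_{W_n}(x)\,\nu_2(C((x,h),\eta))}.$$ Definition of $\hat{m}_n$: for $F\in\mathcal{F}_+$ let $G_F(z)=\int_0^z\exp\left(-\pi\int_0^h(h-t)\,\mathrm{d}F(t)\right)\mathrm{d}F(h)$,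 and let $$\hat{G}_n(z)=\frac{1}{\nu_2(W_n)}\sum_{(x,h)\in\eta}\mathbf{1}_{W_n}(x)\mathbf{1}_{(0,z]}(h)\mathbf{1}\{x\in C((x,h),\eta)\}.$$ Let $\hat{F}_n^0$ be the unique function in $\mathcal{F}_+$ with $G_{\hat{F}_n^0}(z)=\hat{G}_n(z)$ for all $z\ge 0$. Then $$\hat{m}_n=\int_0^\infty\exp\left(-\pi\int_0^u\hat{F}_n^0(t)\,\mathrm{d}t\right)\mathrm{d}u.$$ (All of these quantities are well-defined with finite values for all sufficiently large $n$, almost surely.) The function $\hat{F}_n\in\mathcal{F}_+$ is by definition the solution in $\mathcal{F}_+$ of the displayed equation in the claim; that it is the unique such function is part of its definition. *)

(* Defs.v *)
From HB Require Import structures.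
From mathcomp Require Import all_boot all_order all_algebra.
From mathcomp Require Import all_classical all_reals all_analysis.
From mathcomp Require Import measurable_realfun.

Set Implicit Arguments.
Unset Strict Implicit.
Unset Printing Implicit Defensive.

Import Order.TTheory GRing.Theory Num.Theory.
Import numFieldNormedType.Exports.

Local Open Scope classical_set_scope.
Local Open Scope ring_scope.

(* The plane is [R * R]; the norm that the library puts on it is the sup norm,
   so the Euclidean one is defined here.  Topology, bounded sets and Borel sets
   are the same for both norms.  A weighted point
   [(x, h)] has type [R * R * R]. *)

Definition enorm (R : realType) (v : R * R) : R :=
  Num.sqrt (v.1 ^+ 2 + v.2 ^+ 2).

Definition eball (R : realType) (x : R * R) (r : R) : set (R * R) :=
  [set y | enorm (y - x) < r].

Definition nu2 (R : realType) :
    set (measurableTypeR R * measurableTypeR R) -> \bar R :=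
  (@lebesgue_measure R \x @lebesgue_measure R)%E.

(* [mu] is a locally finite measure on [R] concentrated on the positive
   half-line; the bounded sets include those touching 0. *)
Definition locally_finite_pos (R : realType)
    (mu : {measure set (measurableTypeR R) -> \bar R}) : Prop :=
  mu `]-oo, 0%R]%classic = 0%E /\
  forall B : set (measurableTypeR R),
    measurable B -> bounded_set (B : set R) -> (mu B < +oo)%E.

(* On the negative half-line this is 0, so that the functions [0,oo) -> [0,oo)
   of [Fplus] are represented by their extensions by 0. *)
Definition distr_fun (R : realType)
    (mu : {measure set (measurableTypeR R) -> \bar R}) (z : R) : R :=
  fine (mu `]0, z]%classic).

Definition Fplus (R : realType) : set (R -> R) :=
  [set F | exists mu : {measure set (measurableTypeR R) -> \bar R},
    locally_finite_pos mu /\ F = distr_fun mu].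

Definition inradius (R : realType) (A : set (R * R)) : R :=
  sup [set r | 0 <= r /\ exists2 x, A x & eball x r `<=` A].

Definition convex_averaging (R : realType) (W : nat -> set (R * R)) : Prop :=
  [/\ forall n, W n `<=` W n.+1,
      forall n, compact (W n),
      forall n, convex_set (W n) &
      inradius (W n) @[n --> \oo] --> +oo].

Definition npoints (R : realType) d d' (Omega : measurableType d)
    (T : measurableType d') (eta : Omega -> set T) (B : set T)
    (w : Omega) : \bar R :=
  counting (eta w `&` B).

(* [eta] is a Poisson process on [T] with intensity measure [Lam].
   [poisson_prob r k] does not depend on its dummy argument [k], and is the
   Dirac mass at 0 for [r = 0].  In the last clause the [A i] may be the full
   space, so independence of subfamilies is included. *)
Definition poisson_process (R : realType) d d' (Omega : measurableType d)
    (T : measurableType d') (P : probability Omega R)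
    (Lam : set T -> \bar R) (eta : Omega -> set T) : Prop :=
  [/\ forall B, measurable B -> measurable_fun setT (npoints R eta B),
      forall B, measurable B -> (Lam B < +oo)%E ->
        forall k : nat, P (npoints R eta B @^-1` [set k%:R%:E]) =
          poisson_prob (fine (Lam B)) 0 [set k],
      forall B, measurable B -> Lam B = +oo%E ->
        P (npoints R eta B @^-1` [set +oo%E]) = 1%E &
      forall (m : nat) (B : 'I_m -> set T),
        (forall i, measurable (B i)) -> trivIset setT B ->
        forall A : 'I_m -> set (\bar R), (forall i, measurable (A i)) ->
          P (\bigcap_i (npoints R eta (B i) @^-1` A i)) =
          (\prod_(i < m) P (npoints R eta (B i) @^-1` A i))%E].

(* The configurations of a point process of weighted points: locally finite
   sets of points [(x, h)] with [h > 0]. *)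
Definition configuration (R : realType) (e : set (R * R * R)) : Prop :=
  (forall p, e p -> 0 < p.2) /\
  forall B : set (R * R * R), bounded_set B -> finite_set (e `&` B).

Definition laguerre_cell (R : realType) (p : R * R * R)
    (e : set (R * R * R)) : set (R * R) :=
  [set y | forall q, e q ->
    enorm (y - p.1) ^+ 2 + p.2 <= enorm (y - q.1) ^+ 2 + q.2].

Definition FhatV (R : realType) (W : set (R * R)) (e : set (R * R * R))
    (z : R) : R :=
  fine (\esum_(p in e)
    ((\1_W p.1 * \1_(`]0%R, z]%classic) p.2)%:E * nu2 (laguerre_cell p e)))%E /
  fine (\esum_(p in e) ((\1_W p.1)%:E * nu2 (laguerre_cell p e)))%E.

Definition Ghat (R : realType) (W : set (R * R)) (e : set (R * R * R))
    (z : R) : R :=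
  (fine (nu2 W))^-1 *
  fine (\esum_(p in e)
    (\1_W p.1 * \1_(`]0%R, z]%classic) p.2 * \1_(laguerre_cell p e) p.1)%:E)%E.

(* [cumulative R R] bundles a function with the proofs that it is
   nondecreasing and right-continuous, which hold for every element of
   [Fplus]; this gives access to the Lebesgue-Stieltjes measure dF. *)
Definition GF (R : realType) (F : cumulative R R) (z : R) : R :=
  \int[lebesgue_stieltjes_measure F]_(h in `]0, z])
    expR (- pi * \int[lebesgue_stieltjes_measure F]_(t in `]0, h]) (h - t)).

Definition is_Fhat0 (R : realType) (W : set (R * R)) (e : set (R * R * R))
    (f : R -> R) : Prop :=
  Fplus f /\ exists F : cumulative R R,
    f = F /\ forall z, 0 <= z -> GF F z = Ghat W e z.

(* [xget] chooses an element of the given set, here the unique function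
   satisfying the specification, and returns 0 if there is none. *)
Definition Fhat0 (R : realType) (W : set (R * R)) (e : set (R * R * R)) :
    R -> R :=
  xget (cst 0) (is_Fhat0 W e).

Definition exp_primitive (R : realType) (f : R -> R) (u : R) : R :=
  expR (- pi * \int[lebesgue_measure]_(t in `[0, u]) f t).

Definition mhat (R : realType) (W : set (R * R)) (e : set (R * R * R)) : R :=
  \int[lebesgue_measure]_(u in `[0, +oo[) exp_primitive (Fhat0 W e) u.

Definition is_Fhat (R : realType) (W : set (R * R)) (e : set (R * R * R))
    (f : R -> R) : Prop :=
  Fplus f /\ forall z, 0 <= z ->
    FhatV W e z = 1 - exp_primitive f z +
      pi * f z * (mhat W e -
        \int[lebesgue_measure]_(u in `[0, z]) exp_primitive f u).

(* For a given window and configuration there may be no solution in [Fplus];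
   the limit of [Fhat] is taken along the windows for which there is one.  When
   this holds for all large [n], [within [set n | Fhat_defined (W n) e] \oo]
   has the same limits as [\oo]. *)
Definition Fhat_defined (R : realType) (W : set (R * R))
    (e : set (R * R * R)) : Prop :=
  exists f, is_Fhat W e f.

Definition Fhat (R : realType) (W : set (R * R)) (e : set (R * R * R)) :
    R -> R :=
  xget (cst 0) (is_Fhat W e).

(* Main.v *)
(* Put e(s) = exp(- pi int_0^s F).  From a fixed location y, the number of
   points (x, h) of eta with |y - x|^2 + h <= s is Poisson with mean
   pi int_0^s F.  Hence y lies in the cell of a point of D with probability
   int_D e(|y - x|^2 + h) d(x, h), and the points of W x (0,z] lying in their
   own cell have mean number |W| G(z), with G(z) = int_(0,z] e dF; integrating
   the former over y, the cells of the points of W x (0,z] have mean total area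
   |W| H(z), with H(z) = pi int_(0,z] (m - int_0^h e) dF(h), m = int_0^oo e, and
   H(z) increases to 1.  Both sums have variance O(|W|): distant locations see
   disjoint parts of eta except on events whose probability decays
   exponentially.  As the sums are monotone in the window and in z, this gives
   almost sure convergence of the estimators of H and G, for all z at once.

   The rest is deterministic.  Integration by parts gives
   H = 1 - e + pi F (m - int_0^. e), and the equations defining F from G, and F
   from H and m, are integral equations for int_0^. F whose solutions depend
   continuously on the data, by Gronwall's lemma. *)
Require Import Defs.
From HB Require Import structures.
From mathcomp Require Import all_boot all_order all_algebra.
From mathcomp Require Import all_classical all_reals all_analysis.
From mathcomp Require Import measurable_realfun.
From mathcomp Require Import ring lra.

Set Implicit Arguments.
Unset Strict Implicit.
Unset Printing Implicit Defensive.

Import Order.TTheory GRing.Theory Num.Theory.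
Import numFieldNormedType.Exports.

Local Open Scope classical_set_scope.
Local Open Scope ring_scope.

(** The distribution function [F] may jump, so e has no derivative at the jumps and its identities
    cannot be obtained by differentiation; [additive_const], which only compares increments, takes
    its place. Gronwall's lemma is needed in a local form: the estimating equations are Lipschitz
    only while the two solutions stay close (a divisor must stay away from 0, an exponential must
    stay bounded), so the bound is propagated along short steps below a threshold.

    Of the Poisson process, the estimates use only the events that a set is hit or empty, and their
    independence on disjoint sets. What the Mecke formula would give is recovered by limits: thin
    shells of nearly constant cost for the areas, small cubes for the counts. Areas are integrals
    over locations, so Fubini reduces their moments to one or two locations; the number of points in
    their own cell has no such form, whence the separate grid argument.

    A window for which [Fhat] exists might a priori admit no [Fhat0]; then [mhat] is computed from a
    default and equals 0. Such windows are ruled out for large n by the sign of the estimating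
    equation. *)

HB.lock Definition prim {R : realType} (f : R -> R) (z : R) : R :=
  \int[@lebesgue_measure R]_(t in `[0, z]) f t.

(* Sealed, since conversion otherwise tries to unfold the integrals. *)
HB.lock Definition exprim {R : realType} (f : R -> R) (z : R) : R :=
  exp_primitive f z.

(** * Primitives on the half-line *)

Section quadrature.
Variable R : realType.
Implicit Types (f g A Q : R -> R) (a b x z : R).

(** On n equal pieces of [0, Z] the increments of [Q] add up to at most C Z (A Z - A 0) / n, which
    tends to 0. This replaces the argument that a function of zero derivative is constant when the
    integrands jump: two quantities with the same upper and lower Riemann bounds on every interval
    differ by a constant. *)
Lemma additive_const Q A (C Z : R) : 0 <= Z ->
  (forall a b, 0 <= a -> a <= b -> b <= Z ->
    `|Q b - Q a| <= C * (b - a) * (A b - A a)) ->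
  Q Z = Q 0.
Proof.
move=> Z0 QA; apply/eqP; rewrite -subr_eq0 -normr_eq0; apply/eqP.
set K := C * Z * (A Z - A 0).
have bnd n : `|Q Z - Q 0| * n.+1%:R <= K.
  pose t i : R := Z * i%:R / n.+1%:R.
  have n0 : (0 : R) < n.+1%:R by rewrite ltr0n.
  have tS i : t i.+1 - t i = Z / n.+1%:R.
    by rewrite /t -addn1 natrD; field; rewrite gt_eqF// ltr0n.
  have t0 : t 0%N = 0 by rewrite /t mulr0 mul0r.
  have tn : t n.+1 = Z by rewrite /t mulfK// gt_eqF.
  have tge i : 0 <= t i by rewrite /t divr_ge0 ?mulr_ge0.
  have tle i : (i <= n.+1)%N -> t i <= Z.
    by move=> ni; rewrite /t ler_pdivrMr// ler_wpM2l// ler_nat.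
  have -> : K = \sum_(0 <= i < n.+1) (C * Z * (A (t i.+1) - A (t i))).
    by rewrite -mulr_sumr telescope_sumr// t0 tn.
  have -> : Q Z - Q 0 = \sum_(0 <= i < n.+1) (Q (t i.+1) - Q (t i)).
    by rewrite telescope_sumr// t0 tn.
  rewrite -ler_pdivlMr// mulr_suml.
  apply: (le_trans (ler_norm_sum _ _ _)).
  rewrite big_seq [leRHS]big_seq.
  apply: ler_sum => i; rewrite mem_index_iota => /andP[_ iN].
  have := QA (t i) (t i.+1) (tge i); rewrite tS; move/(_ _ (tle _ iN)).
  have tt : t i <= t i.+1 by rewrite -subr_ge0 tS divr_ge0.
  move=> /(_ tt) /le_trans; apply.
  by rewrite le_eqVlt; apply/orP; left; apply/eqP; ring.
have [//|d0] := eqVneq `|Q Z - Q 0| 0.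
have d1 : 0 < `|Q Z - Q 0| by rewrite lt_neqAle eq_sym d0/=.
have [n Kn] : exists n : nat, K / `|Q Z - Q 0| < n%:R.
  by exists (Num.truncn (K / `|Q Z - Q 0|)).+1; exact: truncnS_gt.
exfalso; have := bnd n; rewrite leNgt => /negP; apply.
rewrite mulrC -ltr_pdivrMr//; apply: (lt_le_trans Kn).
by rewrite ler_nat.
Qed.

(** A class stable under sums and products, containing all monotone functions, and integrable on
    bounded intervals of the half-line both for Lebesgue measure and for a locally finite
    measure. *)
Definition regular f := measurable_fun [set: R] f /\
  forall Z, exists M, forall x, 0 <= x <= Z -> `|f x| <= M.

Lemma regular_cst c : regular (cst c).
Proof. by split => [|Z]; [exact: measurable_cst|exists `|c|]. Qed.

Lemma regularN f : regular f -> regular (\- f).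
Proof.
move=> [mf bf]; split; first exact: measurableT_comp.
by move=> Z; have [M fM] := bf Z; exists M => x /fM; rewrite normrN.
Qed.

Lemma regularD f g : regular f -> regular g -> regular (f \+ g).
Proof.
move=> [mf bf] [mg bg]; split; first exact: measurable_funD.
move=> Z; have [M fM] := bf Z; have [N gN] := bg Z; exists (M + N) => x xZ.
by rewrite (le_trans (ler_normD _ _))// lerD ?fM ?gN.
Qed.

Lemma regularB f g : regular f -> regular g -> regular (f \- g).
Proof. by move=> rf rg; apply: regularD => //; exact: regularN. Qed.

Lemma regularM f g : regular f -> regular g -> regular (f \* g).
Proof.
move=> [mf bf] [mg bg]; split; first exact: measurable_funM.
move=> Z; have [M fM] := bf Z; have [N gN] := bg Z; exists (M * N) => x xZ.
by rewrite normrM ler_pM ?fM ?gN.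
Qed.

Lemma regular_norm f : regular f -> regular (fun x => `|f x|).
Proof.
move=> [mf bf]; split; first exact: measurableT_comp.
by move=> Z; have [M fM] := bf Z; exists M => x /fM; rewrite normr_id.
Qed.

Lemma regular_nondecreasing f : {homo f : x y / x <= y} -> regular f.
Proof.
move=> ndf; split; first exact: nondecreasing_measurable.
move=> Z; exists (`|f 0| + `|f Z|) => x /andP[x0 xZ].
have := ndf _ _ x0; have := ndf _ _ xZ.
by case: (ger0P (f 0)); case: (ger0P (f Z)); case: (ger0P (f x)); lra.
Qed.

Lemma regular_nonincreasing f : {homo f : x y /~ x <= y} -> regular f.
Proof.
move=> nif; have -> : f = \- (\- f) by apply/funext => x /=; rewrite opprK.
by apply/regularN/regular_nondecreasing => x y xy; rewrite lerN2 nif.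
Qed.

Notation mu := (@lebesgue_measure R).

Lemma regular_integrable f a b : regular f -> 0 <= a ->
  mu.-integrable `[a, b] (EFin \o f).
Proof.
move=> [mf bf] a0; apply: measurable_bounded_integrable => //.
- by rewrite /= lebesgue_measure_itv/=; case: ifP; rewrite ?ltry// -EFinD ltry.
- exact: measurable_funTS.
- have [M fM] := bf b; exists M; split; first exact: num_real.
  move=> y My x /=; rewrite in_itv/= => /andP[ax xb].
  by apply: le_trans (ltW My); apply: fM; rewrite (le_trans a0).
Qed.


Lemma prim0 f : prim f 0 = 0.
Proof. by rewrite prim.unlock set_itv1 Rintegral_set1. Qed.

Lemma prim_neg f z : z < 0 -> prim f z = 0.
Proof.
by move=> z0; rewrite prim.unlock set_itv_ge ?Rintegral_set0// bnd_simp -ltNge.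
Qed.

Lemma primB f a b : regular f -> 0 <= a -> a <= b ->
  prim f b - prim f a = \int[mu]_(t in `]a, b]) f t.
Proof.
by move=> rf a0 ab; rewrite !prim.unlock; apply: Rintegral_itvB;
  [exact: regular_integrable|rewrite bnd_simp..].
Qed.

Lemma prim_le f g a b : regular f -> regular g -> 0 <= a -> a <= b ->
  (forall x, a < x -> x <= b -> f x <= g x) ->
  prim f b - prim f a <= prim g b - prim g a.
Proof.
move=> rf rg a0 ab fg; rewrite !primB//; apply: le_Rintegral => //.
- apply: integrableS (regular_integrable b rf a0) => //.
  by apply: subset_itvr; rewrite bnd_simp.
- apply: integrableS (regular_integrable b rg a0) => //.
  by apply: subset_itvr; rewrite bnd_simp.
- by move=> x; rewrite /= in_itv/= => /andP[]; exact: fg.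
Qed.

Lemma prim_cst c z : 0 <= z -> prim (cst c) z = c * z.
Proof.
move=> z0; rewrite prim.unlock Rintegral_cst//= lebesgue_measure_itv/= lte_fin.
by case: ltgtP z0 => // [z0 _|<-]; rewrite -?EFinD/= ?subr0.
Qed.

Lemma prim_ub f a b (M : R) : regular f -> 0 <= a -> a <= b ->
  (forall x, a < x -> x <= b -> f x <= M) -> prim f b - prim f a <= M * (b - a).
Proof.
move=> rf a0 ab fM; apply: le_trans (prim_le rf (regular_cst M) a0 ab fM) _.
by rewrite !prim_cst// ?mulrBr// (le_trans a0).
Qed.

Lemma prim_lb f a b (M : R) : regular f -> 0 <= a -> a <= b ->
  (forall x, a < x -> x <= b -> M <= f x) -> M * (b - a) <= prim f b - prim f a.
Proof.
move=> rf a0 ab fM; apply: le_trans (prim_le (regular_cst M) rf a0 ab fM).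
by rewrite !prim_cst// ?mulrBr// (le_trans a0).
Qed.

Lemma prim_ge0 f z : (forall x, 0 <= x -> 0 <= f x) -> 0 <= prim f z.
Proof.
by move=> f0; rewrite prim.unlock; apply: Rintegral_ge0 => x /=; rewrite in_itv/= => /andP[/f0].
Qed.

Lemma primD f g z : regular f -> regular g ->
  prim (f \+ g) z = prim f z + prim g z.
Proof. by move=> rf rg; rewrite prim.unlock RintegralD//; exact: regular_integrable. Qed.

Lemma primZ c f z : regular f -> prim (fun x => c * f x) z = c * prim f z.
Proof. by move=> rf; rewrite prim.unlock RintegralZl//; exact: regular_integrable. Qed.

Lemma prim_subl f g z : regular f -> regular g ->
  prim (f \- g) z = prim f z - prim g z.
Proof. by move=> rf rg; rewrite prim.unlock RintegralB//; exact: regular_integrable. Qed.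

Lemma le_prim f a b : regular f -> (forall x, 0 <= x -> 0 <= f x) -> a <= b ->
  prim f a <= prim f b.
Proof.
move=> rf f0 ab; have [a0|a0] := ltP a 0.
  by rewrite prim_neg// prim_ge0.
rewrite -subr_ge0 -[leLHS](mul0r (b - a)); apply: prim_lb => // x ax _.
by apply: f0; rewrite (le_trans a0)// ltW.
Qed.

Lemma prim_norm f a b (M : R) : regular f -> 0 <= a -> a <= b ->
  (forall x, a < x -> x <= b -> `|f x| <= M) ->
  `|prim f b - prim f a| <= M * (b - a).
Proof.
move=> rf a0 ab fM; rewrite ler_norml -mulNr prim_ub ?prim_lb// => x ax xb.
  by have := fM x ax xb; rewrite ler_norml => /andP[].
by have := fM x ax xb; rewrite ler_norml => /andP[].
Qed.

Lemma exprimE f u : exprim f u = expR (- pi * prim f u).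
Proof. by rewrite exprim.unlock prim.unlock. Qed.

Lemma exp_primitiveE f u : exp_primitive f u = exprim f u.
Proof. by rewrite exprim.unlock. Qed.

Lemma prim_exp_primitive f z :
  \int[mu]_(u in `[0, z]) exp_primitive f u = prim (exprim f) z.
Proof. by rewrite exprim.unlock prim.unlock. Qed.

Lemma exprim_ge0 f u : 0 <= exprim f u.
Proof. by rewrite exprimE expR_ge0. Qed.

Lemma exprim_gt0 f u : 0 < exprim f u.
Proof. by rewrite exprimE expR_gt0. Qed.

Lemma exprim_le1 f u : (forall x, 0 <= x -> 0 <= f x) ->
  exprim f u <= 1.
Proof.
by move=> f0; rewrite exprimE -expR0 ler_expR mulNr oppr_le0 mulr_ge0 ?pi_ge0 ?prim_ge0.
Qed.

Lemma exprim0 f : exprim f 0 = 1.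
Proof. by rewrite exprimE prim0 mulr0 expR0. Qed.

Lemma exprim_ni f : regular f -> (forall x, 0 <= x -> 0 <= f x) ->
  {homo exprim f : x y /~ x <= y}.
Proof.
move=> rf f0 x y xy; rewrite !exprimE ler_expR !mulNr lerN2 ler_wpM2l ?pi_ge0//.
exact: le_prim.
Qed.

Lemma regular_exprim f : regular f -> (forall x, 0 <= x -> 0 <= f x) ->
  regular (exprim f).
Proof. by move=> rf f0; apply/regular_nonincreasing/exprim_ni. Qed.

End quadrature.

(** * Stieltjes integrals and integration by parts *)

HB.lock Definition stieltjes {R : realType}
    (mu : {measure set (measurableTypeR R) -> \bar R}) (g : R -> R) (z : R) : R :=
  \int[mu]_(h in `]0, z]) g h.

Section stieltjes.
Variable R : realType.
Variable mu : {measure set (measurableTypeR R) -> \bar R}.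
Hypothesis lfmu : locally_finite_pos mu.
Notation F := (distr_fun mu).
Implicit Types (a b z : R) (g : R -> R).

Lemma locally_finite_itv (a b : R) : (mu `]a, b]%classic < +oo)%E.
Proof.
apply: lfmu.2 => //; exists (`|a| + `|b|); split; first exact: num_real.
move=> M abM x /=; rewrite in_itv/= => /andP[ax xb].
apply: le_trans (ltW abM).
by case: (ger0P a); case: (ger0P b); case: (ger0P x); lra.
Qed.

Lemma distr_fun_itv z : mu `]0, z]%classic = (F z)%:E.
Proof. by rewrite fineK// ge0_fin_numE// locally_finite_itv. Qed.

Lemma distr_fun_ge0 z : 0 <= F z.
Proof. exact: fine_ge0. Qed.

Lemma distr_fun_le0 z : z <= 0 -> F z = 0.
Proof.
move=> z0; rewrite /distr_fun set_itv_ge ?measure0//.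
by rewrite bnd_simp -leNgt.
Qed.

Lemma distr_fun_nd : {homo F : x y / x <= y}.
Proof.
move=> x y xy; apply: fine_le.
- by rewrite ge0_fin_numE// locally_finite_itv.
- by rewrite ge0_fin_numE// locally_finite_itv.
- by apply: le_measure; rewrite ?inE//; apply: subset_itvl; rewrite bnd_simp.
Qed.

Lemma distr_fun_regular : regular F.
Proof. exact/regular_nondecreasing/distr_fun_nd. Qed.

Lemma distr_funB a b : 0 <= a -> a <= b -> mu `]a, b]%classic = (F b - F a)%:E.
Proof.
move=> a0 ab; have : mu `]0, b]%classic = (mu `]0%R, a]%classic + mu `]a, b]%classic)%E.
  rewrite -measureU//; last first.
    rewrite -subset0 => y [/=]; rewrite !in_itv/= => /andP[_ ya] /andP[].
    by rewrite ltNge ya.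
  by congr (mu _); apply: itv_bndbnd_setU; rewrite bnd_simp.
rewrite !distr_fun_itv => Fba.
have : mu `]a, b]%classic \is a fin_num by rewrite ge0_fin_numE// locally_finite_itv.
case: (mu `]a, b]%classic) Fba => //= r []-> _; congr _%:E; ring.
Qed.

Lemma stieltjes_integrable g a b : regular g -> 0 <= a ->
  mu.-integrable `]a, b] (EFin \o g).
Proof.
move=> [mg bg] a0; apply: measurable_bounded_integrable => //.
- exact: locally_finite_itv.
- exact: measurable_funTS.
- have [M gM] := bg b; exists M; split; first exact: num_real.
  move=> y My x /=; rewrite in_itv/= => /andP[ax xb].
  by apply: le_trans (ltW My); apply: gM; rewrite (le_trans a0 (ltW ax)).
Qed.


Lemma stieltjes0 g : stieltjes mu g 0 = 0.
Proof. by rewrite stieltjes.unlock set_itvoc0 Rintegral_set0. Qed.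

Lemma stieltjesB g a b : regular g -> 0 <= a -> a <= b ->
  stieltjes mu g b - stieltjes mu g a = \int[mu]_(h in `]a, b]) g h.
Proof.
move=> rg a0 ab; rewrite stieltjes.unlock (@itv_bndbnd_setU _ _ _ (BRight a))//;
  rewrite ?bnd_simp//.
rewrite Rintegral_setU//; first by rewrite addrAC subrr add0r.
- rewrite -itv_bndbnd_setU ?bnd_simp//; exact: stieltjes_integrable.
- apply/disj_setPS => y [/=]; rewrite !in_itv/= => /andP[_ ya] /andP[].
  by rewrite ltNge ya.
Qed.

Lemma stieltjes_le g h a b : regular g -> regular h -> 0 <= a -> a <= b ->
  (forall x, a < x -> x <= b -> g x <= h x) ->
  stieltjes mu g b - stieltjes mu g a <= stieltjes mu h b - stieltjes mu h a.
Proof.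
move=> rg rh a0 ab gh; rewrite !stieltjesB//; apply: le_Rintegral => //.
- exact: stieltjes_integrable.
- exact: stieltjes_integrable.
- by move=> x; rewrite /= in_itv/= => /andP[]; exact: gh.
Qed.

Lemma stieltjes_cst c a b : 0 <= a -> a <= b ->
  stieltjes mu (cst c) b - stieltjes mu (cst c) a = c * (F b - F a).
Proof.
move=> a0 ab; rewrite stieltjesB//; last exact: regular_cst.
by rewrite Rintegral_cst// distr_funB.
Qed.

Lemma stieltjes_ub g a b M : regular g -> 0 <= a -> a <= b ->
  (forall x, a < x -> x <= b -> g x <= M) ->
  stieltjes mu g b - stieltjes mu g a <= M * (F b - F a).
Proof.
move=> rg a0 ab gM; rewrite -stieltjes_cst//; apply: stieltjes_le => //.
exact: regular_cst.
Qed.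

Lemma stieltjes_lb g a b M : regular g -> 0 <= a -> a <= b ->
  (forall x, a < x -> x <= b -> M <= g x) ->
  M * (F b - F a) <= stieltjes mu g b - stieltjes mu g a.
Proof.
move=> rg a0 ab gM; rewrite -stieltjes_cst//; apply: stieltjes_le => //.
exact: regular_cst.
Qed.

(** Both sides measure the region 0 < t <= s <= h under dF(t) ds. In terms of increments: from a to
    b each side grows by an amount between F a (b - a) and F b (b - a), so the difference obeys
    [additive_const]. This identifies the exponent in [GF] with the one in [exprim]. *)
Lemma stieltjes_id (h : R) : 0 <= h ->
  \int[mu]_(t in `]0, h]) (h - t) = prim F h.
Proof.
move=> h0; have rid : regular (fun x : R => x) by exact: regular_nondecreasing.
have rB (c : R) : regular (fun t => c - t).
  exact: (regularB (regular_cst c) rid).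
pose K (x : R) := stieltjes mu (fun t => x - t) x.
have KE x : K x = x * F x - stieltjes mu idfun x.
  rewrite /K stieltjes.unlock RintegralB//; first by rewrite Rintegral_cst.
    exact: stieltjes_integrable (regular_cst _) _.
  exact: stieltjes_integrable.
have -> : \int[mu]_(t in `]0, h]) (h - t) = K h by rewrite /K stieltjes.unlock.
suff /eqP : K h - prim F h = K 0 - prim F 0.
  by rewrite prim0 (KE 0) mul0r stieltjes0 !subr0 subr_eq0 => /eqP.
apply: (@additive_const _ (fun x => K x - prim F x) F 1) => // a b a0 ab bh.
rewrite !KE mul1r.
have up := prim_ub (M := F b) distr_fun_regular a0 ab
  (fun x _ => @distr_fun_nd x b).
have lo := prim_lb (M := F a) distr_fun_regular a0 ab
  (fun x ax _ => @distr_fun_nd a x (ltW ax)).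
have up2 : stieltjes mu idfun b - stieltjes mu idfun a <= b * (F b - F a).
  by apply: stieltjes_ub.
have lo2 : a * (F b - F a) <= stieltjes mu idfun b - stieltjes mu idfun a.
  by apply: stieltjes_lb => // x /ltW.
rewrite ler_norml; apply/andP; split; lra.
Qed.

End stieltjes.

Section exprim_nd.
Variable R : realType.
Variable f : R -> R.
Hypothesis f_nd : {homo f : x y / x <= y}.
Hypothesis f_ge0 : forall x, 0 <= f x.
Notation e := (exprim f).
Let rf : regular f := regular_nondecreasing f_nd.
Let f0 (x : R) (_ : 0 <= x) : 0 <= f x := f_ge0 x.
Let re : regular e := regular_exprim rf f0.

(** The inequality 1 + x <= exp x at x = pi d and x = - pi d, where d is the increment of the
    primitive, together with the monotonicity of [f]. It stands in for e' = - pi f e, which fails at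
    the jumps of [f]. *)
Lemma exprim_incr a b : 0 <= a -> a <= b ->
  pi * f a * e b * (b - a) <= e a - e b <= pi * f b * e a * (b - a).
Proof.
move=> a0 ab.
pose d := prim f b - prim f a.
have dl : f a * (b - a) <= d.
  by apply: prim_lb => // x ax _; exact/f_nd/ltW.
have du : d <= f b * (b - a) by apply: prim_ub => // x _; exact: f_nd.
have eb : e b = e a * expR (- (pi * d)).
  by rewrite !exprimE -expRD /d; congr expR; ring.
have ea : e a = e b * expR (pi * d).
  by rewrite eb -mulrA -expRD addNr expR0 mulr1.
have ea0 := exprim_ge0 f a.
have eb0 := exprim_ge0 f b.
have ppi := pi_ge0 R.
clearbody d; have h1 := expR_ge1Dx (- (pi * d)); have h2 := expR_ge1Dx (pi * d).
move: pi d (expR (- (pi * d))) (expR (pi * d)) (e a) (e b) (f a) (f b)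
  h1 h2 ea0 eb0 ea eb ppi dl du => p d X Y A B fa fb h1 h2 A0 B0 AB BA p0 dl du.
apply/andP; split.
  apply: (@le_trans _ _ (B * (p * d))).
    have -> : p * fa * B * (b - a) = B * (p * (fa * (b - a))) by ring.
    by rewrite ler_wpM2l// ler_wpM2l.
  rewrite [in leRHS]AB -[X in _ <= _ - X]mulr1 -mulrBr ler_wpM2l//.
  by rewrite lerBrDl.
apply: (@le_trans _ _ (A * (p * d))).
  rewrite BA -[X in X - _ <= _]mulr1 -mulrBr ler_wpM2l//; lra.
have -> : p * fb * A * (b - a) = A * (p * (fb * (b - a))) by ring.
by rewrite ler_wpM2l// ler_wpM2l.
Qed.

(** The integrated form of e' = - pi f e; it survives the jumps of [f] because the two-sided bounds
    of [exprim_incr] also hold for pi times the integral of f e. *)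
Lemma exprim_chain z : 0 <= z ->
  1 - e z = pi * prim (f \* e) z.
Proof.
move=> z0; have ppi := pi_ge0 R.
suff /eqP : e z + pi * prim (f \* e) z = e 0 + pi * prim (f \* e) 0.
  by rewrite prim0 mulr0 addr0 exprim0 => /eqP <-; ring.
(* The upper and lower bounds differ by pi (b - a) ((f b - f a) e a + f a (e a - e b)), and e a - e
   b is at most pi f z (b - a). The square of b - a that results is the reason for adding the
   identity to [f] as control function. *)
pose C := pi * (1 + pi * f z ^+ 2).
apply: (@additive_const _ (fun x => e x + pi * prim (f \* e) x)
  (fun x => f x + x) C) => // a b a0 ab bz.
have /andP[l1 u1] := exprim_incr a0 ab.
have rfe : regular (f \* e) by exact: regularM.
have b0 : 0 <= b by exact: le_trans ab.
have u2 : prim (f \* e) b - prim (f \* e) a <= f b * e a * (b - a).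
  apply: prim_ub => // x ax xb; apply: ler_pM => //.
  - exact: exprim_ge0.
  - exact: f_nd.
  - by apply: exprim_ni => //; exact: ltW.
have l2 : f a * e b * (b - a) <= prim (f \* e) b - prim (f \* e) a.
  apply: prim_lb => // x ax xb; apply: ler_pM => //.
  - exact: exprim_ge0.
  - exact/f_nd/ltW.
  - exact: exprim_ni.
move/(ler_wpM2l ppi): u2; move/(ler_wpM2l ppi): l2 => l2 u2.
have ea1 : e a <= 1 := exprim_le1 a f0.
have ea0 := exprim_ge0 f a.
have ba : 0 <= b - a by rewrite subr_ge0.
have fab : f a <= f b by exact: f_nd.
have fbz : f b <= f z by exact: f_nd.
have key : pi * f b * e a * (b - a) - pi * f a * e b * (b - a) <=
    C * (b - a) * (f b + b - (f a + a)).
  have -> : pi * f b * e a * (b - a) - pi * f a * e b * (b - a) =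
    pi * (b - a) * ((f b - f a) * e a + f a * (e a - e b)) by ring.
  have -> : C * (b - a) * (f b + b - (f a + a)) = pi * (b - a) *
    ((f b - f a) + (b - a) + pi * f z ^+ 2 * (f b - f a + (b - a))).
    by rewrite /C; ring.
  rewrite ler_wpM2l ?mulr_ge0//.
  have h1 : (f b - f a) * e a <= f b - f a by rewrite ler_piMr// subr_ge0.
  have h2 : f a * (e a - e b) <= pi * f z ^+ 2 * (b - a).
    apply: (@le_trans _ _ (f z * (pi * f z * 1 * (b - a)))); last first.
      by rewrite le_eqVlt; apply/orP; left; apply/eqP; ring.
    apply: ler_pM => //; [|exact: le_trans fbz|].
      by rewrite subr_ge0 exprim_ni.
    apply: (le_trans u1); rewrite ler_wpM2r//; apply: ler_pM => //.
      by rewrite mulr_ge0.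
    by rewrite ler_wpM2l.
  have h3 : 0 <= pi * f z ^+ 2 * (f b - f a).
    by rewrite mulr_ge0 ?subr_ge0// mulr_ge0// sqr_ge0.
  rewrite mulrDr; lra.
rewrite ler_norml; apply/andP; split; lra.
Qed.

Lemma exprim_chainB a b : 0 <= a -> a <= b ->
  e a - e b = pi * (prim (f \* e) b - prim (f \* e) a).
Proof.
move=> a0 ab; have b0 := le_trans a0 ab.
rewrite mulrBr -!exprim_chain//; ring.
Qed.

End exprim_nd.

Section stieltjes_identities.
Variable R : realType.
Variable mu : {measure set (measurableTypeR R) -> \bar R}.
Hypothesis lfmu : locally_finite_pos mu.
Variable F : R -> R.
Hypothesis FE : distr_fun mu = F.
Notation e := (exprim F).
Let F_nd : {homo F : x y / x <= y}.
Proof. by rewrite -FE; exact: distr_fun_nd. Qed.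
Let F_ge0 x : 0 <= F x.
Proof. by rewrite -FE; exact: distr_fun_ge0. Qed.
Let Sub g a b M : regular g -> 0 <= a -> a <= b ->
  (forall x, a < x -> x <= b -> g x <= M) ->
  stieltjes mu g b - stieltjes mu g a <= M * (F b - F a).
Proof. by rewrite -FE; exact: stieltjes_ub. Qed.
Let Slb g a b M : regular g -> 0 <= a -> a <= b ->
  (forall x, a < x -> x <= b -> M <= g x) ->
  M * (F b - F a) <= stieltjes mu g b - stieltjes mu g a.
Proof. by rewrite -FE; exact: stieltjes_lb. Qed.
Let F_0 : F 0 = 0.
Proof. by rewrite -FE; exact: distr_fun_le0. Qed.
Let rF : regular F := regular_nondecreasing F_nd.
Let F0 (x : R) (_ : 0 <= x) : 0 <= F x := F_ge0 x.
Let re : regular e := regular_exprim rF F0.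

(** Integration by parts, d(F e) = e dF - pi F^2 e dt. It rewrites the equation defining F from G so
    that only values and ordinary primitives of F occur, the form to which Gronwall's lemma
    applies. *)
Lemma stieltjes_exprim z : 0 <= z ->
  stieltjes mu e z = F z * e z + pi * prim (F \* (F \* e)) z.
Proof.
move=> z0; have ppi := pi_ge0 R.
have rFe : regular (F \* e) by exact: regularM.
have rFFe : regular (F \* (F \* e)) by exact: regularM.
pose Q x := F x * e x - (stieltjes mu e x - pi * prim (F \* (F \* e)) x).
suff : Q z = Q 0.
  by rewrite /Q F_0 mul0r stieltjes0 prim0; lra.
apply: (@additive_const _ _ F (pi * F z)) => // a b a0 ab bz; rewrite {}/Q.
have b0 : 0 <= b by exact: le_trans ab.
have u1 : stieltjes mu e b - stieltjes mu e a <= e a * (F b - F a).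
  by apply: Sub => // x /ltW ax _; exact: exprim_ni.
have l1 : e b * (F b - F a) <= stieltjes mu e b - stieltjes mu e a.
  by apply: Slb => // x _; exact: exprim_ni.
have ch := exprim_chainB F_nd F_ge0 a0 ab.
have e0 := exprim_ge0 F.
have u2 : prim (F \* (F \* e)) b - prim (F \* (F \* e)) a <=
    F b * (prim (F \* e) b - prim (F \* e) a).
  rewrite mulrBr -!primZ//; apply: prim_le => //.
    exact: (regularM (regular_cst _)).
  by move=> x ax xb; rewrite ler_wpM2r ?mulr_ge0//; exact: F_nd.
have l2 : F a * (prim (F \* e) b - prim (F \* e) a) <=
    prim (F \* (F \* e)) b - prim (F \* (F \* e)) a.
  rewrite mulrBr -!primZ//; apply: prim_le => //.
    exact: (regularM (regular_cst _)).
  by move=> x ax xb; rewrite ler_wpM2r ?mulr_ge0//; exact/F_nd/ltW.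
have l2' : F a * (e a - e b) <=
    pi * (prim (F \* (F \* e)) b - prim (F \* (F \* e)) a).
  by rewrite ch mulrCA ler_wpM2l.
have u2' : pi * (prim (F \* (F \* e)) b - prim (F \* (F \* e)) a) <=
   F b * (e a - e b).
  by rewrite ch mulrCA ler_wpM2l.
have Fab := F_nd ab.
have ea1 : e a <= 1 := exprim_le1 a F0.
have key : (e a - e b) * (F b - F a) <= pi * F z * (b - a) * (F b - F a).
  rewrite ler_wpM2r ?subr_ge0//.
  have /andP[_ /le_trans] := exprim_incr F_nd a0 ab; apply.
  rewrite ler_wpM2r ?subr_ge0// -[leRHS]mulr1; apply: ler_pM => //.
    by rewrite mulr_ge0.
  by rewrite ler_wpM2l// F_nd.
rewrite ler_norml; apply/andP; split; lra.
Qed.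

(** Integration by parts against the weight m - int_0^. e, whose differential is - e dt; the
    remaining integral of pi F e is 1 - e by [exprim_chain]. The right-hand side is that of the
    equation defining [Fhat]. *)
Lemma stieltjes_tail m z : 0 <= z ->
  stieltjes mu (fun h => pi * (m - prim e h)) z =
  1 - e z + pi * F z * (m - prim e z).
Proof.
move=> z0; have ppi := pi_ge0 R.
have e0 := exprim_ge0 F.
have ry : regular (fun h => m - prim e h).
  apply/(regularB (regular_cst _))/regular_nondecreasing => x y.
  exact: le_prim.
have rpy : regular (fun h => pi * (m - prim e h)).
  exact: (regularM (regular_cst _)).
apply/eqP; rewrite -subr_eq0; apply/eqP.
pose Q x := stieltjes mu (fun h => pi * (m - prim e h)) x -
  (1 - e x + pi * F x * (m - prim e x)).
suff : Q z = Q 0.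
  rewrite /Q F_0 stieltjes0 prim0 exprim0 => ->; ring.
apply: (@additive_const _ _ F pi) => // a b a0 ab bz; rewrite {}/Q.
have b0 : 0 <= b by exact: le_trans ab.
have u1 : stieltjes mu (fun h => pi * (m - prim e h)) b -
    stieltjes mu (fun h => pi * (m - prim e h)) a <=
    pi * (m - prim e a) * (F b - F a).
  apply: Sub => // x /ltW ax _; rewrite ler_wpM2l// lerD2l lerN2.
  exact: le_prim.
have l1 : pi * (m - prim e b) * (F b - F a) <=
    stieltjes mu (fun h => pi * (m - prim e h)) b -
    stieltjes mu (fun h => pi * (m - prim e h)) a.
  apply: Slb => // x ax xb; rewrite ler_wpM2l// lerD2l lerN2.
  exact: le_prim.
have ch := exprim_chainB F_nd F_ge0 a0 ab.
have u2 : prim (F \* e) b - prim (F \* e) a <= F b * (prim e b - prim e a).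
  rewrite mulrBr -!primZ//; apply: prim_le => //.
  - exact: (regularM rF).
  - exact: (regularM (regular_cst _)).
  - by move=> x ax xb; rewrite ler_wpM2r//; exact: F_nd.
have l2 : F a * (prim e b - prim e a) <= prim (F \* e) b - prim (F \* e) a.
  rewrite mulrBr -!primZ//; apply: prim_le => //.
  - exact: (regularM (regular_cst _)).
  - exact: (regularM rF).
  - by move=> x ax xb; rewrite ler_wpM2r//; exact/F_nd/ltW.
move: ch (ler_wpM2l ppi u2) (ler_wpM2l ppi l2) => ch {}u2 {}l2.
have Fab := F_nd ab.
have Jab : prim e b - prim e a <= 1 * (b - a).
  by apply: prim_ub => // x _ _; exact: exprim_le1.
have key : pi * (prim e b - prim e a) * (F b - F a) <=
    pi * (b - a) * (F b - F a).
  by rewrite ler_wpM2r ?subr_ge0// ler_wpM2l// -[leRHS]mul1r.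
rewrite ler_norml; apply/andP; split; lra.
Qed.

End stieltjes_identities.

(** * Stability of the defining equations *)

Section gronwall.
Variable R : realType.
Implicit Types (D : R -> R) (a b s t Z L r M ep : R).

(** A continuity argument, since the integral inequality is available only while [D] stays below
    [r]. The step [h] is so short that [D] rises by at most ep' / 2 along it. If D <= 3 ep' up to
    t0, the inequality and L (t0 - a) <= 1 / 2 give D t0 <= ep' + 3 ep' / 2, so the bound 3 ep'
    survives one more step. *)
Lemma gronwall_step D Z L r ep a b K :
  (forall s t, 0 <= s <= Z -> 0 <= t <= Z -> `|D s - D t| <= K * `|s - t|) ->
  (forall a t M, 0 <= a -> a <= t -> t <= Z -> M <= r ->
    (forall s, a <= s <= t -> D s <= M) -> D t <= D a + ep + L * (t - a) * M) ->
  0 <= L -> 0 <= a -> a <= b -> b <= Z -> L * (b - a) <= 2^-1 ->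
  forall ep', 0 < ep' -> 0 <= ep -> 0 <= D a -> D a + ep <= ep' -> 3 * ep' <= r ->
  forall t, a <= t <= b -> D t <= 3 * ep'.
Proof.
move=> DK DL L0 a0 ab bZ Lab ep' ep'0 ep0 Da0 Da ep'r.
pose h := ep' / (2 * (`|K| + 1)).
have K0 : 0 < `|K| + 1 by rewrite ltr_wpDl.
have h0 : 0 < h by rewrite divr_gt0// mulr_gt0.
have Kh : `|K| * h <= ep' / 2.
  rewrite /h mulrA ler_pdivrMr ?mulr_gt0//.
  have -> : ep' / 2 * (2 * (`|K| + 1)) = ep' * (`|K| + 1) by field.
  by rewrite mulrC; apply: ler_wpM2l; [exact: ltW|rewrite lerDl].
have main j : forall t, a <= t <= b -> t <= a + j%:R * h -> D t <= 3 * ep'.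
  elim: j => [t /andP[at_ tb]|j IH t /andP[at_ tb] tj].
    rewrite mul0r addr0 => ta; have -> : t = a by apply/le_anti; rewrite ta.
    lra.
  have [tj'|tj'] := leP t (a + j%:R * h); first by apply: IH => //; rewrite at_.
  pose t0 := a + j%:R * h.
  have at0 : a <= t0 by rewrite lerDl mulr_ge0// ltW.
  have t0b : t0 <= b by rewrite (le_trans (ltW tj')).
  have Dt0 : D t0 <= D a + ep + L * (t0 - a) * (3 * ep').
    apply: DL => //; first exact: le_trans bZ.
    move=> s /andP[as_ st0]; apply: IH => //.
    by rewrite as_ (le_trans st0).
  have LL : L * (t0 - a) * (3 * ep') <= 2^-1 * (3 * ep').
    apply: ler_wpM2r; first by rewrite mulr_ge0// ltW.
    by apply: le_trans Lab; rewrite ler_wpM2l// lerD2r.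
  have DD : D t - D t0 <= ep' / 2.
    have := DK t t0; rewrite (le_trans a0 at_) (le_trans tb bZ) (le_trans a0 at0).
    rewrite (le_trans t0b bZ) => /(_ isT isT) Dtt0.
    apply: (le_trans (ler_norm _)); apply: (le_trans Dtt0).
    apply: le_trans Kh; apply: (@le_trans _ _ (`|K| * `|t - t0|)).
      by rewrite ler_wpM2r// ler_norm.
    rewrite ler_wpM2l// ger0_norm ?subr_ge0 ?(ltW tj')//.
    by move: tj; rewrite /t0 -addn1 natrD mulrDl mul1r addrA lerBlDl.
  lra.
move=> t tab; apply: (main (Num.truncn ((t - a) / h)).+1) => //.
by rewrite -lerBlDl -ler_pdivrMr// ltW// truncnS_gt.
Qed.

(** The interval is cut into N + 1 pieces, each short enough for [gronwall_step]. A piece multiplies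
    the bound by 4: the factor 3 of that lemma, and one more to absorb the error [ep], which enters
    again on every piece. *)
Lemma gronwall_iter D Z L r ep K (N : nat) :
  (forall s t, 0 <= s <= Z -> 0 <= t <= Z -> `|D s - D t| <= K * `|s - t|) ->
  (forall a t M, 0 <= a -> a <= t -> t <= Z -> M <= r ->
    (forall s, a <= s <= t -> D s <= M) -> D t <= D a + ep + L * (t - a) * M) ->
  (forall t, 0 <= D t) -> 0 <= L -> 0 <= Z -> 2 * L * Z <= N.+1%:R ->
  forall ep', 0 < ep' -> 0 <= ep -> D 0 + ep <= ep' ->
  4 ^+ N.+1 * ep' <= r ->
  forall t, 0 <= t <= Z -> D t <= 4 ^+ N.+1 * ep'.
Proof.
move=> DK DL D0 L0 Z0 LZ ep' ep'0 ep0 Dep' ep'r.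
pose p k : R := k%:R * Z / N.+1%:R.
have N0 : (0 : R) < N.+1%:R by rewrite ltr0n.
have p0 k : 0 <= p k by rewrite /p divr_ge0// mulr_ge0.
have pZ k : (k <= N.+1)%N -> p k <= Z.
  by move=> kN; rewrite /p ler_pdivrMr// mulrC ler_wpM2l// ler_nat.
have pS k : p k.+1 - p k = Z / N.+1%:R.
  by rewrite /p -addn1 natrD; field; rewrite gt_eqF// ltr0n.
have pSle k : p k <= p k.+1 by rewrite -subr_ge0 pS divr_ge0.
have e4 (k : nat) : 4 ^+ k * ep' = ep' * 4 ^+ k :> R by rewrite mulrC.
have pow k : (k <= N.+1)%N -> 4 ^+ k * ep' <= r.
  by move=> kN; apply: le_trans ep'r; apply: ler_wpM2r; [exact: ltW|rewrite ler_eXn2l// ltr1n].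
have pow1 k : 1 <= 4 ^+ k :> R by rewrite exprn_ege1// ler1n.
have pos k : 0 < 4 ^+ k * ep' by rewrite mulr_gt0// exprn_gt0.
have main k : (k <= N.+1)%N ->
    (D (p k) + ep <= 4 ^+ k * ep') /\
    (forall t, 0 <= t <= p k -> D t <= 4 ^+ k * ep').
  elim: k => [_|k IH kN].
    rewrite /p mul0r mul0r expr0 mul1r; split => // t /andP[t0 t0'].
    have -> : t = 0 by apply/le_anti; rewrite t0 t0'.
    by apply: le_trans Dep'; rewrite lerDl.
  have [Dk IHk] := IH (ltnW kN).
  have powk := pow _ kN; rewrite exprS in powk *.
  have posk := pos k.
  have st t : p k <= t <= p k.+1 -> D t <= 3 * (4 ^+ k * ep').
    apply: (gronwall_step DK DL) => //; first exact: pZ.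
      rewrite pS mulrA ler_pdivrMr//; lra.
    lra.
  have ek : ep <= 4 ^+ k * ep'.
    by apply: le_trans Dk; rewrite lerDr.
  split; first by have := st (p k.+1); rewrite pSle lexx => /(_ isT); lra.
  move=> t /andP[t0 tk]; have [tk'|tk'] := leP t (p k).
    by have := IHk t; rewrite t0 tk' => /(_ isT); lra.
  by have := st t; rewrite tk (ltW tk') => /(_ isT); lra.
have [_] := main N.+1 (leqnn _).
by rewrite {1}/p mulrAC divff ?gt_eqF// mul1r.
Qed.

(** The amplification 4 ^+ N.+1 depends on [L] and [Z] but not on n, so the initial value and the
    error can be made small enough to compensate for it. The Lipschitz constants may depend on n, as
    they only set the step of the continuity argument. *)
Lemma gronwall_cvg (D : nat -> R -> R) Z L r (ep : nat -> R) :
  0 <= Z -> 0 <= L -> 0 < r -> (forall n t, 0 <= D n t) ->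
  (forall n, exists K, forall s t, 0 <= s <= Z -> 0 <= t <= Z ->
    `|D n s - D n t| <= K * `|s - t|) ->
  (\forall n \near \oo, forall a t M, 0 <= a -> a <= t -> t <= Z -> M <= r ->
    (forall s, a <= s <= t -> D n s <= M) ->
    D n t <= D n a + ep n + L * (t - a) * M) ->
  (forall n, 0 <= ep n) -> D n 0 @[n --> \oo] --> 0 -> ep n @[n --> \oo] --> 0 ->
  forall rho, 0 < rho -> \forall n \near \oo, forall t, 0 <= t <= Z -> D n t <= rho.
Proof.
move=> Z0 L0 r0 D0 DK DL ep0 D00 epn rho rho0.
pose N := Num.truncn (2 * L * Z).
have NL : 2 * L * Z <= N.+1%:R by rewrite ltW// truncnS_gt.
pose ep' := Num.min rho r / 4 ^+ N.+1.
have ep'0 : 0 < ep' by rewrite divr_gt0 ?exprn_gt0// lt_min rho0.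
have e4 : 4 ^+ N.+1 * ep' = Num.min rho r.
  by rewrite /ep' mulrC divfK// expf_neq0.
have e2 : 0 < ep' / 2 by rewrite divr_gt0.
have near1 : \forall n \near \oo, D n 0 <= ep' / 2.
  have /cvgrPdist_le/(_ _ e2) := D00; apply: filterS => n.
  by rewrite sub0r normrN ger0_norm.
have near2 : \forall n \near \oo, ep n <= ep' / 2.
  have /cvgrPdist_le/(_ _ e2) := epn; apply: filterS => n.
  by rewrite sub0r normrN ger0_norm.
apply: filterS3 DL near1 near2 => n DLn n1 n2 t tZ; have [K DnK] := DK n.
apply: (@le_trans _ _ (4 ^+ N.+1 * ep')); last by rewrite e4 ge_min lexx.
apply: (gronwall_iter (N := N) (ep := ep n) DnK DLn (D0 n) L0 Z0 NL ep'0) tZ => //.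
- lra.
- by rewrite e4 ge_min lexx orbT.
Qed.

End gronwall.

Section stability.
Variable R : realType.
Implicit Types (f g u v : R -> R) (a b s t z Z M L r : R).
Notation mu := (@lebesgue_measure R).

Lemma prim_normB f a b : regular f -> 0 <= a -> a <= b ->
  `|prim f b - prim f a| <= prim (fun x => `|f x|) b - prim (fun x => `|f x|) a.
Proof.
move=> rf a0 ab; have rnf := regular_norm rf.
rewrite ler_norml; apply/andP; split; last first.
  by apply: prim_le => // x _ _; exact: ler_norm.
have b0 := le_trans a0 ab.
have rNf : regular (fun x => (-1) * `|f x|) by exact: (regularM (regular_cst _)).
rewrite -mulN1r mulrBr -!primZ//; apply: prim_le => // x _ _.
by rewrite mulN1r lerNl -normrN ler_norm.
Qed.

Lemma prim_lipschitz f Z : regular f -> exists K, 0 <= K /\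
  forall s t, 0 <= s <= Z -> 0 <= t <= Z -> `|prim f s - prim f t| <= K * `|s - t|.
Proof.
move=> rf; have [K fK] := rf.2 Z; exists `|K|; split => // s t.
wlog st : s t / s <= t.
  move=> H s0 t0; have [/H|/ltW/H] := leP s t; first exact.
  by rewrite distrC (distrC s); exact.
move=> /andP[s0 _] /andP[_ tZ].
rewrite distrC (distrC s) (ger0_norm (x := t - s)) ?subr_ge0//.
apply: prim_norm => // x sx xt; apply: le_trans (ler_norm K).
by apply: fK; rewrite (le_trans s0 (ltW sx)) (le_trans xt).
Qed.

Lemma prim_norm_cvg0 (g : nat -> R -> R) Z B : (forall n, regular (g n)) ->
  (forall n x, 0 <= x <= Z -> `|g n x| <= B) ->
  (forall x, 0 <= x <= Z -> g n x @[n --> \oo] --> 0) ->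
  prim (fun x => `|g n x|) Z @[n --> \oo] --> 0.
Proof.
move=> rg gB gx.
have intB : mu.-integrable `[0%R, Z] (EFin \o cst B).
  exact/regular_integrable/lexx/regular_cst.
have := @dominated_cvg _ _ _ mu `[0%R, Z] _ (fun n x => `|g n x|%:E) (cst 0)
  (EFin \o cst B).
move=> /(_ _ _ _ _ intB) H.
rewrite prim.unlock /Rintegral.
have -> : (0 : R) = fine (\int[mu]_(x in `[0%R, Z]) cst 0 x)%E by rewrite integral0.
apply: fine_cvg; rewrite integral0/=.
rewrite -[X in _ --> X](integral0 mu `[0%R, Z]); apply: H.
- by [].
- move=> n; apply/measurable_EFinP/measurable_funTS.
  by have [] := regular_norm (rg n).
- move=> x; rewrite /= in_itv/= => xZ; apply: cvg_EFin; first by near=> n.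
  by apply/norm_cvg0P; exact: gx.
- by [].
- by move=> n x; rewrite /= in_itv/= => xZ; rewrite lee_fin normr_id gB.
Unshelve. all: by end_near. Qed.

(** The form in which both equations are treated: the unknowns are two primitives, whose sizes are
    added, and the integrands [u] and [v] are controlled linearly by these sizes as long as they do
    not exceed [r]. The error in the data enters through [g], which need only be small in mean;
    pointwise convergence of the estimators with a common bound is enough. *)
Lemma gronwall_prim (u v g : nat -> R -> R) (dl : nat -> R) Z L r kappa :
  0 <= Z -> 0 <= L -> 0 < r -> 0 <= kappa ->
  (forall n, regular (u n)) -> (forall n, regular (v n)) ->
  (forall n, regular (g n)) -> (forall n x, 0 <= g n x) ->
  (\forall n \near \oo, forall s M, 0 <= s <= Z -> M <= r ->
    `|prim (u n) s| <= M -> `|dl n + prim (v n) s| <= M ->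
    `|u n s| <= kappa * g n s + L * M /\ `|v n s| <= kappa * g n s + L * M) ->
  dl n @[n --> \oo] --> 0 -> prim (g n) Z @[n --> \oo] --> 0 ->
  forall rho, 0 < rho -> \forall n \near \oo, forall t, 0 <= t <= Z ->
    `|prim (u n) t| <= rho /\ `|dl n + prim (v n) t| <= rho.
Proof.
move=> Z0 L0 r0 k0 ru rv rg g0 uv dl0 pg rho rho0.
pose D n t := `|prim (u n) t| + `|dl n + prim (v n) t|.
suff : \forall n \near \oo, forall t, 0 <= t <= Z -> D n t <= rho.
  apply: filterS => n H t /H; rewrite /D.
  move: (normr_ge0 (prim (u n) t)) (normr_ge0 (dl n + prim (v n) t)); lra.
apply: (@gronwall_cvg _ D Z (2 * L) r (fun n => 2 * kappa * prim (g n) Z)) => //.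
- by rewrite mulr_ge0.
- by move=> n t; rewrite addr_ge0.
- move=> n; have [K [K0 uK]] := prim_lipschitz Z (ru n).
  have [K' [K'0 vK]] := prim_lipschitz Z (rv n).
  exists (K + K') => s t sZ tZ; rewrite /D mulrDl.
  have h1 : `| `|prim (u n) s| - `|prim (u n) t| | <= K * `|s - t|.
    by apply: le_trans (uK _ _ sZ tZ); exact: ler_dist_dist.
  have h2 : `| `|dl n + prim (v n) s| - `|dl n + prim (v n) t| | <= K' * `|s - t|.
    apply: le_trans (vK _ _ sZ tZ); apply: le_trans (ler_dist_dist _ _) _.
    by rewrite opprD addrACA subrr add0r.
  rewrite opprD addrACA; apply: le_trans (ler_normD _ _) _; exact: lerD.
- apply: filterS uv => n uvn a t M a0 at_ tZ Mr DM.
  have t0 := le_trans a0 at_.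
  have bnd s : a < s -> s <= t -> `|u n s| <= kappa * g n s + L * M /\
      `|v n s| <= kappa * g n s + L * M.
    move=> as_ st; have := DM s; rewrite (ltW as_) st => /(_ isT); rewrite /D => H.
    apply: uvn => //; first by rewrite (le_trans a0 (ltW as_)) (le_trans st).
      by apply: le_trans H; rewrite lerDl.
    by apply: le_trans H; rewrite lerDr.
  have rgL : regular (fun s => kappa * g n s + L * M).
    apply: (@regularD _ (fun s => kappa * g n s) (cst (L * M))) (regular_cst _).
    exact: (regularM (regular_cst _)).
  have rkg : regular (fun s => kappa * g n s) by exact: (regularM (regular_cst _)).
  have gLE : prim (fun s => kappa * g n s + L * M) t -
      prim (fun s => kappa * g n s + L * M) a <=
      kappa * prim (g n) Z + L * M * (t - a).
    rewrite (@primD _ (fun s => kappa * g n s) (cst (L * M)) t)//;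
      last exact: regular_cst.
    rewrite (@primD _ (fun s => kappa * g n s) (cst (L * M)) a)//;
      last exact: regular_cst.
    rewrite !prim_cst// !primZ//.
    have h1 : kappa * prim (g n) t <= kappa * prim (g n) Z.
      by rewrite ler_wpM2l// le_prim.
    have h2 : 0 <= kappa * prim (g n) a by rewrite mulr_ge0// prim_ge0.
    rewrite mulrBr; lra.
  have hu : `|prim (u n) t - prim (u n) a| <= kappa * prim (g n) Z + L * M * (t - a).
    apply: le_trans gLE; apply: le_trans (prim_normB (ru n) a0 at_) _.
    by apply: prim_le => //; [exact: regular_norm|move=> x ax /(bnd _ ax)[]].
  have hv : `|prim (v n) t - prim (v n) a| <= kappa * prim (g n) Z + L * M * (t - a).
    apply: le_trans gLE; apply: le_trans (prim_normB (rv n) a0 at_) _.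
    by apply: prim_le => //; [exact: regular_norm|move=> x ax /(bnd _ ax)[]].
  have hu' : `|prim (u n) t| <= `|prim (u n) a| + `|prim (u n) t - prim (u n) a|.
    by rewrite -{1}(subrK (prim (u n) a) (prim (u n) t)) addrC ler_normD.
  have hv' : `|dl n + prim (v n) t| <= `|dl n + prim (v n) a| +
      `|prim (v n) t - prim (v n) a|.
    apply: le_trans (ler_normD _ _); rewrite addrA le_eqVlt; apply/orP; left.
    by apply/eqP; congr `|_|; ring.
  rewrite /D; move: hu hv hu' hv'.
  move: `|prim (u n) t| `|prim (u n) a| `|prim (u n) t - prim (u n) a|
    `|dl n + prim (v n) t| `|dl n + prim (v n) a|
    `|prim (v n) t - prim (v n) a| (prim (g n) Z) => *; lra.
- by move=> n; rewrite mulr_ge0 ?mulr_ge0 ?prim_ge0.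
- have -> : (fun n => D n 0) = (fun n => `|dl n|).
    by apply/funext => n; rewrite /D !prim0 normr0 add0r addr0.
  exact/norm_cvg0P.
- by rewrite -[X in _ --> X](mulr0 (2 * kappa)); exact: cvgMr.
Qed.

Lemma expR_lip (x y : R) : x <= y -> expR y - expR x <= expR y * (y - x).
Proof.
move=> xy; have -> : expR x = expR y * expR (- (y - x)).
  by rewrite -expRD; congr expR; ring.
rewrite -[X in X - _ <= _]mulr1 -mulrBr ler_wpM2l ?expR_ge0//.
have := expR_ge1Dx (- (y - x)); lra.
Qed.

Lemma expR_dist (x y M : R) : x <= M -> y <= M ->
  `|expR x - expR y| <= expR M * `|x - y|.
Proof.
wlog xy : x y / x <= y.
  move=> H xM yM; have [/H|/ltW/H] := leP x y; first exact.
  by rewrite distrC (distrC x); exact.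
move=> xM yM; rewrite distrC (distrC x) ger0_norm ?subr_ge0 ?ler_expR//.
rewrite (ger0_norm (x := y - x)) ?subr_ge0//.
by apply: (le_trans (expR_lip xy)); rewrite ler_wpM2r ?subr_ge0// ler_expR.
Qed.

(** The exponential is 1-Lipschitz on the negative half-line. *)
Lemma exprim_dist f g z : 0 <= prim f z -> 0 <= prim g z ->
  `|exprim f z - exprim g z| <= pi * `|prim f z - prim g z|.
Proof.
move=> f0 g0; have ppi := pi_ge0 R; rewrite !exprimE.
apply: (le_trans (expR_dist (M := 0) _ _)).
- by rewrite mulNr oppr_le0 mulr_ge0.
- by rewrite mulNr oppr_le0 mulr_ge0.
- by rewrite expR0 mul1r -mulrBr normrM normrN (ger0_norm ppi).
Qed.

End stability.

Section fhat_stability.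
Variable R : realType.
Variables (f H : nat -> R -> R) (m : nat -> R) (F H0 : R -> R) (m0 : R).
Hypothesis f_nd : forall n, {homo f n : x y / x <= y}.
Hypothesis f_ge0 : forall n x, 0 <= f n x.
Hypothesis F_nd : {homo F : x y / x <= y}.
Hypothesis F_ge0 : forall x, 0 <= F x.
Hypothesis fE : forall n z, 0 <= z -> H n z =
  1 - exprim (f n) z + pi * f n z * (m n - prim (exprim (f n)) z).
Hypothesis FE : forall z, 0 <= z -> H0 z =
  1 - exprim F z + pi * F z * (m0 - prim (exprim F) z).
Hypothesis H_01 : forall n z, 0 <= z -> 0 <= H n z <= 1.
Hypothesis H_cvg : forall z, 0 <= z -> H n z @[n --> \oo] --> H0 z.
Hypothesis m_cvg : m n @[n --> \oo] --> m0.
Hypothesis tail_gt0 : forall z, 0 <= z -> 0 < m0 - prim (exprim F) z.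

(** Subtracting two instances of h = 1 - e + pi f y leaves pi (fn - Fs) yn = (hn - h) + (en - e) -
    pi Fs (yn - y), to be divided by pi yn, which is at least pi c. *)
Let fhat_pointwise (fn Fs en e hn h yn y c B M : R) :
  0 < c -> c <= yn -> hn = 1 - en + pi * fn * yn -> h = 1 - e + pi * Fs * y ->
  `|en - e| <= pi * M -> `|yn - y| <= M -> 0 <= Fs <= B ->
  `|fn - Fs| <= (pi * c)^-1 * `|hn - h| + (1 + B) / c * M.
Proof.
move=> c0 cyn hnE hE ee yy /andP[Fs0 FsB]; have p0 : 0 < pi :> R := pi_gt0 R.
clear fE FE; have M0 : 0 <= M by exact: le_trans (normr_ge0 _) yy.
have key : pi * (fn - Fs) * yn = (hn - h) + (en - e) - pi * Fs * (yn - y).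
  by rewrite hnE hE; ring.
have : `|pi * (fn - Fs) * yn| <= `|hn - h| + pi * M + pi * (B * M).
  rewrite key; apply: (le_trans (ler_normB _ _)); apply: lerD.
    by apply: (le_trans (ler_normD _ _)); apply: lerD.
  by rewrite !normrM (gtr0_norm p0) (ger0_norm Fs0) -mulrA; apply: ler_wpM2l; [exact: ltW|exact: ler_pM].
rewrite !normrM (gtr0_norm p0) (gtr0_norm (lt_le_trans c0 cyn)) => up.
have lo : pi * `|fn - Fs| * c <= pi * `|fn - Fs| * yn.
  by rewrite ler_wpM2l// mulr_ge0// ltW.
move: (pi : R) p0 up lo => p p0 up lo.
rewrite -(ler_pM2l (mulr_gt0 p0 c0)).
have -> : p * c * ((p * c)^-1 * `|hn - h| + (1 + B) / c * M) =
    `|hn - h| + p * M + p * (B * M).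
  by field; rewrite (gt_eqF c0) (gt_eqF p0).
by apply: le_trans up; rewrite mulrAC.
Qed.

Lemma fhat_cvg z : 0 <= z -> f n z @[n --> \oo] --> F z.
Proof.
move=> z0; have p0 : 0 < pi :> R := pi_gt0 R.
have rf n : regular (f n) by exact: regular_nondecreasing.
have rF : regular F by exact: regular_nondecreasing.
have re n : regular (exprim (f n)) by exact: regular_exprim.
have rE : regular (exprim F) by exact: regular_exprim.
have rp (h : R -> R) : regular h -> (forall x, 0 <= h x) -> regular (prim h).
  by move=> rh h0; apply: regular_nondecreasing => x y; exact: le_prim.
have rpe n : regular (prim (exprim (f n))) by apply: rp => // x; exact: exprim_ge0.
have rpE : regular (prim (exprim F)) by apply: rp => // x; exact: exprim_ge0.
(* Half of the smallest value on [0, z] of the limiting divisor m0 - int_0^. e. Taken as the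
   Gronwall threshold, it keeps the divisors of the approximations above [c]. *)
pose c := (m0 - prim (exprim F) z) / 2.
have c0 : 0 < c by rewrite divr_gt0 ?tail_gt0.
(* The sign of [v] is reversed so that [dl n] plus its primitive is the difference of the two
   divisors m - int_0^. e; the error of m thus enters as an initial value. *)
pose u n := f n \- F; pose v n := exprim F \- exprim (f n).
pose dl n := m n - m0.
pose rhs (h : R -> R) (a x : R) := 1 - exprim h x + pi * h x * (a - prim (exprim h) x).
pose gap n x := `|rhs (f n) (m n) x - rhs F m0 x|.
have rrhs h a : regular h -> regular (exprim h) -> regular (prim (exprim h)) ->
    regular (rhs h a).
  move=> rh reh rph; apply: (@regularD _ (cst 1 \- exprim h)
    ((cst pi \* h) \* (cst a \- prim (exprim h)))).
    exact/regularB/reh/regular_cst.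
  apply/regularM/regularB => //; last exact: regular_cst.
  exact/regularM/rh/regular_cst.
pose kappa := (pi * c)^-1; pose L1 := (1 + F z) / c; pose L := L1 + pi.
have k0 : 0 <= kappa by rewrite invr_ge0 mulr_ge0 ?(ltW p0) ?(ltW c0).
have L10 : 0 <= L1 by rewrite divr_ge0 ?(ltW c0)// addr_ge0.
have dlv n s : dl n + prim (v n) s =
    (m n - prim (exprim (f n)) s) - (m0 - prim (exprim F) s).
  by rewrite /v prim_subl// /dl; ring.
have pw n s M : 0 <= s <= z -> M <= c -> `|prim (u n) s| <= M ->
    `|dl n + prim (v n) s| <= M ->
    `|u n s| <= kappa * gap n s + L1 * M /\ `|v n s| <= pi * M.
  move=> /andP[s0 sz] Mc Pu; rewrite dlv => yy.
  have vM : `|exprim (f n) s - exprim F s| <= pi * M.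
    apply: le_trans (exprim_dist _ _) _; [exact: prim_ge0..|].
    by rewrite ler_wpM2l ?(ltW p0)// -prim_subl.
  split; last by rewrite /v/= distrC.
  apply: (fhat_pointwise c0 _ _ _ vM yy) => //; last by rewrite F_ge0/= F_nd.
  have yc : 2 * c <= m0 - prim (exprim F) s.
    have -> : 2 * c = m0 - prim (exprim F) z by rewrite /c; field.
    by rewrite lerD2l lerN2; apply: le_prim => // x _; exact: exprim_ge0.
  move: (le_trans yy Mc); rewrite ler_norml => /andP[+ _].
  move: (m n - _) (m0 - _) yc => A B; lra.
have pos n s : 0 <= gap n s by exact: normr_ge0.
have gapE n s : 0 <= s -> gap n s = `|H n s - H0 s|.
  by move=> s0; rewrite /gap fE// FE.
have gap_cvg s : 0 <= s -> gap n s @[n --> \oo] --> 0.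
  move=> s0; under eq_fun do rewrite gapE//.
  by apply/norm_cvg0P; rewrite -(subrr (H0 s)); apply: cvgB (H_cvg s0) (cvg_cst _).
have L0 : 0 <= L by rewrite addr_ge0 ?(ltW p0).
have rgap n : regular (fun x => rhs (f n) (m n) x - rhs F m0 x).
  by apply: (@regularB _ (rhs (f n) (m n)) (rhs F m0)); exact: rrhs.
have unif := @gronwall_prim R u v gap dl z L c kappa z0 L0 c0 k0 _ _ _ pos.
have {}unif := unif (fun n => regularB (rf n) rF) (fun n => regularB rE (re n))
  (fun n => regular_norm (rgap n)).
have {}unif : forall rho, 0 < rho -> \forall n \near \oo, forall t, 0 <= t <= z ->
    `|prim (u n) t| <= rho /\ `|dl n + prim (v n) t| <= rho.
  apply: unif.
  - apply: nearW => n s M sz Mc Pu yy; have [h1 h2] := pw _ _ _ sz Mc Pu yy.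
    have M0 : 0 <= M by exact: le_trans (normr_ge0 _) Pu.
    have h3 : 0 <= kappa * gap n s by rewrite mulr_ge0.
    have h4 : 0 <= L1 * M by rewrite mulr_ge0.
    have h5 : 0 <= pi * M by rewrite mulr_ge0// ltW.
    by rewrite /L mulrDl; split; [apply: (le_trans h1)|apply: (le_trans h2)]; lra.
  - rewrite /dl -[X in _ --> X](subrr m0); exact: cvgB m_cvg (cvg_cst _).
  - apply: (@prim_norm_cvg0 _ _ _ 2) => //.
      move=> n x /andP[x0 _].
      have -> : rhs (f n) (m n) x - rhs F m0 x = H n x - H0 x by rewrite fE// FE.
      have := H_01 n x0.
      have h0 : 0 <= H0 x <= 1.
        apply/andP; split.
          by apply: (closed_cvg _ (@closed_ge R 0) _ _ (H_cvg x0)); apply: nearW => k;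
             have /andP[] := H_01 k x0.
        by apply: (closed_cvg _ (@closed_le R 1) _ _ (H_cvg x0)); apply: nearW => k;
             have /andP[] := H_01 k x0.
      move: (H n x) (H0 x) h0 => A B /andP[? ?] /andP[? ?].
      rewrite ler_norml; apply/andP; split; lra.
    by move=> x /andP[x0 _]; apply/norm_cvg0P; exact: gap_cvg.
apply/cvgrPdist_le => eps eps0.
pose rho := Num.min c (eps / (2 * (L1 + 1))).
have rho0 : 0 < rho by rewrite lt_min c0 divr_gt0// mulr_gt0// ltr_wpDl.
have L1rho : L1 * rho <= eps / 2.
  apply: (@le_trans _ _ (L1 * (eps / (2 * (L1 + 1))))).
    by rewrite ler_wpM2l// ge_min lexx orbT.
  have L1p : 0 < L1 + 1 by rewrite ltr_wpDl.
  have -> : L1 * (eps / (2 * (L1 + 1))) = eps / 2 * (L1 / (L1 + 1)).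
    by field; rewrite gt_eqF.
  by rewrite ler_piMr ?divr_ge0 ?(ltW eps0)// ler_pdivrMr// mul1r lerDl.
have kgap : \forall n \near \oo, kappa * gap n z <= eps / 2.
  have : kappa * gap n z @[n --> \oo] --> kappa * 0 by exact: cvgMr (gap_cvg _ z0).
  rewrite mulr0 => /cvgrPdist_le/(_ (eps / 2)).
  rewrite divr_gt0// => /(_ isT); apply: filterS => n.
  by rewrite sub0r normrN; apply: le_trans; exact: ler_norm.
apply: filterS2 (unif _ rho0) kgap => n un kn.
have zz : 0 <= z <= z by rewrite z0 lexx.
have [h1 h2] := un _ zz; rewrite distrC.
have [|+ _] := pw n z rho zz _ h1 h2; first by rewrite ge_min lexx.
rewrite /u/= => /le_trans; apply; lra.
Qed.

End fhat_stability.

Section fhat0_stability.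
Variable R : realType.
Variables (g G : nat -> R -> R) (F G0 : R -> R).
Hypothesis g_nd : forall n, {homo g n : x y / x <= y}.
Hypothesis g_ge0 : forall n x, 0 <= g n x.
Hypothesis F_nd : {homo F : x y / x <= y}.
Hypothesis F_ge0 : forall x, 0 <= F x.
Hypothesis gE : forall n z, 0 <= z -> G n z =
  g n z * exprim (g n) z + pi * prim (g n \* (g n \* exprim (g n))) z.
Hypothesis FE : forall z, 0 <= z -> G0 z =
  F z * exprim F z + pi * prim (F \* (F \* exprim F)) z.
Hypothesis G_nd : forall n x y, 0 <= x -> x <= y -> G n x <= G n y.
Hypothesis G_cvg : forall z, 0 <= z -> G n z @[n --> \oo] --> G0 z.

(** The equation is solved for its highest-order term: f = (G - pi I) exp(pi P), with P and I the
    primitives of f and of f^2 e, and then f^2 e = f (G - pi I). So f and f^2 e are functions of G,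
    P and I. The exponential is Lipschitz only below a ceiling, whence the bound [K] on both values
    of P. *)
Let fhat0_pointwise (gn f gg gf In If Pn Pf M K B C : R) :
  gn = (gg - pi * In) * expR (pi * Pn) -> f = (gf - pi * If) * expR (pi * Pf) ->
  0 <= M -> Pn <= K -> Pf <= K -> `|Pn - Pf| <= M -> `|In - If| <= M ->
  `|gg - pi * In| <= B -> `|gf - pi * If| <= C -> 0 <= f <= C -> 0 <= B ->
  `|gn - f| <= expR (pi * K) * `|gg - gf| + pi * expR (pi * K) * (1 + C) * M /\
  `|gn * (gg - pi * In) - f * (gf - pi * If)| <=
   B * (expR (pi * K) * `|gg - gf| + pi * expR (pi * K) * (1 + C) * M) +
   C * (`|gg - gf| + pi * M).
Proof.
clear gE FE; move=> gnE fE M0 PnK PfK PM IM qB qC /andP[f0 fC] B0.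
have p0 : 0 <= pi :> R := pi_ge0 R.
have dq : `|(gg - pi * In) - (gf - pi * If)| <= `|gg - gf| + pi * M.
  have -> : (gg - pi * In) - (gf - pi * If) = (gg - gf) - pi * (In - If) by ring.
  apply: (le_trans (ler_normB _ _)); apply: lerD => //.
  by rewrite normrM (ger0_norm p0); exact: ler_wpM2l.
have dE : `|expR (pi * Pn) - expR (pi * Pf)| <= expR (pi * K) * (pi * M).
  apply: le_trans (expR_dist (M := pi * K) _ _) _; [exact: ler_wpM2l..|].
  rewrite ler_wpM2l ?expR_ge0// -mulrBr normrM (ger0_norm p0); exact: ler_wpM2l.
have En : expR (pi * Pn) <= expR (pi * K) by rewrite ler_expR ler_wpM2l.
move: (expR_ge0 (pi * Pn)) (expR_ge0 (pi * K)) dE En gnE fE dq qB qC.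
move: (pi : R) p0 (expR (pi * Pn)) (expR (pi * Pf)) (expR (pi * K)) => p p0 X Y E.
move: (gg - p * In) (gf - p * If) => qn q X0 E0 dE En gnE fE dq qB qC.
have C0 : 0 <= C := le_trans f0 fC.
have d1 : `|gn - f| <= E * `|gg - gf| + p * E * (1 + C) * M.
  have -> : gn - f = (qn - q) * X + q * (X - Y) by rewrite gnE fE; ring.
  apply: (le_trans (ler_normD _ _)); rewrite !normrM (ger0_norm X0).
  have h1 : `|qn - q| * X <= (`|gg - gf| + p * M) * E by exact: ler_pM.
  have h2 : `|q| * `|X - Y| <= C * (E * (p * M)) by exact: ler_pM.
  by apply: (le_trans (lerD h1 h2)); rewrite le_eqVlt; apply/orP; left; apply/eqP; ring.
split => //.
have -> : gn * qn - f * q = qn * (gn - f) + f * (qn - q) by ring.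
apply: (le_trans (ler_normD _ _)); rewrite !normrM (ger0_norm f0).
by apply: lerD; apply: ler_pM.
Qed.

(** The Gronwall unknowns are the primitives of g and of g^2 e. Both outcomes are kept: closeness of
    the primitives, needed for the limit of m, and the pointwise bound, needed for g itself. The
    threshold 1, which forces rho <= 1, caps the primitive of g n by that of F plus 1. *)
Let unif z : 0 <= z -> exists K L : R, [/\ 0 <= K, 0 <= L &
  forall rho, 0 < rho -> rho <= 1 -> \forall n \near \oo, forall t, 0 <= t <= z ->
    `|prim (g n) t - prim F t| <= rho /\
    `|g n t - F t| <= K * `|G n t - G0 t| + L * rho].
Proof.
move=> z0; have p0 : 0 <= pi :> R := pi_ge0 R.
have rg n : regular (g n) by exact: regular_nondecreasing.
have rF : regular F by exact: regular_nondecreasing.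
have re n : regular (exprim (g n)) by exact: regular_exprim.
have rE : regular (exprim F) by exact: regular_exprim.
have rp (h : R -> R) : regular h -> (forall x, 0 <= h x) -> regular (prim h).
  by move=> rh h0; apply: regular_nondecreasing => x y; exact: le_prim.
pose J (h : R -> R) := h \* (h \* exprim h).
have rJg n : regular (J (g n)) by do 2 apply: regularM => //.
have rJF : regular (J F) by do 2 apply: regularM => //.
have J0 (h : R -> R) : (forall x, 0 <= h x) -> forall x, 0 <= J h x.
  by move=> h0 x; rewrite /J/= !mulr_ge0// exprim_ge0.
pose u n := g n \- F; pose v n := J (g n) \- J F.
pose rhs (h : R -> R) (x : R) := h x * exprim h x + pi * prim (J h) x.
have rrhs h : regular h -> (forall x, 0 <= h x) -> regular (exprim h) ->
    regular (J h) -> regular (rhs h).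
  move=> rh h0 reh rJh; apply: (@regularD _ (h \* exprim h) (cst pi \* prim (J h))).
    exact: regularM.
  by apply: regularM; [exact: regular_cst|apply: rp => //; exact: J0].
pose gap n x := `|rhs (g n) x - rhs F x|.
have gapE n s : 0 <= s -> gap n s = `|G n s - G0 s|.
  by move=> s0; rewrite /gap gE// FE.
have [B0 GB] : exists B0, forall n, `|G n z| <= B0.
  have /cvg_seq_bounded[M [_ GM]] : cvgn (G ^~ z).
    by apply/cvg_ex; exists (G0 z); exact: G_cvg.
  exists (M + 1) => n; apply: (GM (M + 1)) => //; lra.
have Gge0 n x : 0 <= x -> 0 <= G n x.
  move=> x0; rewrite gE// addr_ge0// ?mulr_ge0 ?exprim_ge0 ?prim_ge0//.
  by move=> y _; rewrite -/(J (g n) y); exact: J0.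
have GzB n s : 0 <= s <= z -> 0 <= G n s <= B0.
  move=> /andP[s0 sz]; rewrite Gge0//=; apply: le_trans (GB n).
  by apply: le_trans (ler_norm _); exact: G_nd.
have BB : 0 <= B0 by have /andP[] := GzB 0%N 0 ltac:(by rewrite lexx z0); exact: le_trans.
pose KK := prim F z + 1; pose E := expR (pi * KK).
have E0 : 0 <= E by exact: expR_ge0.
pose C := F z.
have C0 : 0 <= C by exact: F_ge0.
pose L1 := pi * E * (1 + C).
have L10 : 0 <= L1 by rewrite !mulr_ge0// addr_ge0.
pose kappa := E * (1 + B0) + C; pose L := L1 * (1 + B0) + C * pi.
have k0 : 0 <= kappa by rewrite addr_ge0// mulr_ge0// addr_ge0.
have L0 : 0 <= L by rewrite addr_ge0// mulr_ge0// addr_ge0.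
have uE n s : prim (u n) s = prim (g n) s - prim F s by rewrite /u prim_subl.
have vE n s : 0 + prim (v n) s = prim (J (g n)) s - prim (J F) s.
  by rewrite add0r /v prim_subl.
have solve (h : R -> R) s : rhs h s - pi * prim (J h) s = h s * exprim h s.
  by rewrite /rhs; ring.
have inv (h : R -> R) s : h s = (rhs h s - pi * prim (J h) s) * expR (pi * prim h s).
  by rewrite solve exprimE -mulrA -expRD mulNr addNr expR0 mulr1.
have pw n s M : 0 <= s <= z -> M <= 1 -> `|prim (u n) s| <= M ->
    `|0 + prim (v n) s| <= M ->
    `|u n s| <= E * gap n s + L1 * M /\
    `|v n s| <= B0 * (E * gap n s + L1 * M) + C * (gap n s + pi * M).
  move=> /andP[s0 sz] M1; rewrite uE vE => Pu Pv.
  have M0 : 0 <= M by exact: le_trans (normr_ge0 _) Pu.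
  have PF : prim F s <= prim F z by exact: le_prim.
  have JE (h : R -> R) : J h s = h s * (rhs h s - pi * prim (J h) s).
    by rewrite solve.
  rewrite /u /v/= !JE; apply: fhat0_pointwise => //.
  - move: Pu; rewrite ler_norml => /andP[_]; rewrite /KK.
    move: (prim (g n) s) (prim F s) (prim F z) PF => *; lra.
  - by rewrite /KK; lra.
  - have /andP[Gs0 GsB] := GzB n s ltac:(by rewrite s0 sz).
    rewrite solve ger0_norm ?mulr_ge0 ?exprim_ge0//; apply: le_trans GsB.
    rewrite gE// lerDl mulr_ge0// prim_ge0// => x _; exact: J0.
  - rewrite solve ger0_norm ?mulr_ge0 ?exprim_ge0//.
    rewrite -[leRHS]mulr1; apply: ler_pM => //; first exact: exprim_ge0.
      exact: F_nd.
    exact: exprim_le1.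
  - by rewrite F_ge0 F_nd.
have gap0 n s : 0 <= gap n s by exact: normr_ge0.
have rgap n : regular (fun x => rhs (g n) x - rhs F x).
  by apply: (@regularB _ (rhs (g n)) (rhs F)); exact: rrhs.
have un := @gronwall_prim R u v gap (cst 0) z L 1 kappa z0 L0 ltr01 k0 _ _ _ gap0.
have {}un := un (fun n => regularB (rg n) rF) (fun n => regularB (rJg n) rJF)
  (fun n => regular_norm (rgap n)).
exists E, L1; split => // rho rho0 rho1.
suff : \forall n \near \oo, forall t, 0 <= t <= z ->
    `|prim (u n) t| <= rho /\ `|0 + prim (v n) t| <= rho.
  apply: filterS => n H t tz; have [h1 h2] := H t tz.
  rewrite -uE; split => //; rewrite -gapE; last by have /andP[] := tz.
  by have [] := pw n t rho tz rho1 h1 h2.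
apply: un => //.
- apply: nearW => n s M sz M1 Pu yy; have [h1 h2] := pw _ _ _ sz M1 Pu yy.
  have M0 : 0 <= M by exact: le_trans (normr_ge0 _) Pu.
  have i1 : 0 <= E * gap n s by rewrite mulr_ge0.
  have i2 : 0 <= L1 * M by rewrite mulr_ge0.
  have i3 : 0 <= C * gap n s by rewrite mulr_ge0.
  have i4 : 0 <= C * pi * M by rewrite !mulr_ge0.
  have i5 : 0 <= B0 * (E * gap n s + L1 * M) by rewrite mulr_ge0// addr_ge0.
  have -> : kappa * gap n s + L * M = E * gap n s + L1 * M +
    (B0 * (E * gap n s + L1 * M) + C * gap n s + C * pi * M).
    by rewrite /kappa /L; ring.
  have {}h2 : `|v n s| <= B0 * (E * gap n s + L1 * M) + C * gap n s + C * pi * M.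
    by apply: (le_trans h2); rewrite le_eqVlt; apply/orP; left; apply/eqP; ring.
  split.
    by apply: (le_trans h1); rewrite lerDl; do 2 apply: addr_ge0 => //.
  by apply: (le_trans h2); rewrite -[leLHS]add0r lerD2r addr_ge0.
- exact: cvg_cst.
- have G0B x : 0 <= x <= z -> 0 <= G0 x <= B0.
    move=> /andP[x0 xz]; apply/andP; split.
      by apply: (closed_cvg _ (@closed_ge R 0) _ _ (G_cvg x0)); apply: nearW => k;
         have /andP[] := GzB k x ltac:(by rewrite x0 xz).
    by apply: (closed_cvg _ (@closed_le R B0) _ _ (G_cvg x0)); apply: nearW => k;
         have /andP[] := GzB k x ltac:(by rewrite x0 xz).
  apply: (@prim_norm_cvg0 _ _ _ (2 * B0)) => //.
    move=> n x xz; have x0 : 0 <= x by have /andP[] := xz.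
    have -> : rhs (g n) x - rhs F x = G n x - G0 x by rewrite gE// FE.
    move: (GzB n x xz) (G0B x xz); move: (G n x) (G0 x) => A B /andP[? ?] /andP[? ?].
    rewrite ler_norml; apply/andP; split; lra.
  move=> x /andP[x0 _]; have -> : (fun n => rhs (g n) x - rhs F x) = (fun n => G n x - G0 x).
    by apply/funext => n; rewrite gE// FE.
  by rewrite -(subrr (G0 x)); apply: cvgB (G_cvg x0) (cvg_cst _).
Qed.

Lemma fhat0_prim_cvg z : 0 <= z -> prim (g n) z @[n --> \oo] --> prim F z.
Proof.
move=> z0; have [K [L [K0 L0 H]]] := unif z0.
apply/cvgrPdist_le => eps eps0; pose rho := Num.min 1 eps.
have rho0 : 0 < rho by rewrite lt_min ltr01.
have rho1 : rho <= 1 by rewrite ge_min lexx.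
apply: filterS (H rho rho0 rho1) => n /(_ z); rewrite z0 lexx => /(_ isT)[h _].
by rewrite distrC (le_trans h)// ge_min lexx orbT.
Qed.

Lemma fhat0_cvg z : 0 <= z -> g n z @[n --> \oo] --> F z.
Proof.
move=> z0; have [K [L [K0 L0 H]]] := unif z0.
apply/cvgrPdist_le => eps eps0; pose rho := Num.min 1 (eps / (2 * (L + 1))).
have rho0 : 0 < rho by rewrite lt_min ltr01/= divr_gt0// mulr_gt0// ltr_wpDl.
have rho1 : rho <= 1 by rewrite ge_min lexx.
have Lrho : L * rho <= eps / 2.
  have Lp : 0 < L + 1 by rewrite ltr_wpDl.
  apply: (@le_trans _ _ (L * (eps / (2 * (L + 1))))).
    by rewrite ler_wpM2l// ge_min lexx orbT.
  have -> : L * (eps / (2 * (L + 1))) = eps / 2 * (L / (L + 1)).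
    by field; rewrite gt_eqF.
  by rewrite ler_piMr ?divr_ge0 ?(ltW eps0)// ler_pdivrMr// mul1r lerDl.
have Kgap : \forall n \near \oo, K * `|G n z - G0 z| <= eps / 2.
  have : K * `|G n z - G0 z| @[n --> \oo] --> K * 0.
    apply: cvgMr; rewrite -(normr0 R); apply: cvg_norm.
    by rewrite -(subrr (G0 z)); apply: cvgB (G_cvg z0) (cvg_cst _).
  rewrite mulr0 => /cvgrPdist_le/(_ (eps / 2)).
  rewrite divr_gt0// => /(_ isT); apply: filterS => n.
  by rewrite sub0r normrN; apply: le_trans; exact: ler_norm.
apply: filterS2 (H rho rho0 rho1) Kgap => n /(_ z).
rewrite z0 lexx => /(_ isT)[_ h] kn; rewrite distrC (le_trans h)//; lra.
Qed.

End fhat0_stability.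

(** * The total integral of e and the normalisation of H *)

Section exprim_integral.
Variable R : realType.
Notation mu := (@lebesgue_measure R).
Implicit Types (f : R -> R) (k t z : R).

Let measurable_pos : measurable (`[(0 : R), +oo[%classic : set (measurableTypeR R)).
Proof. by []. Qed.

(** Beyond t0 the primitive of [f] grows at rate at least k; the prefactor makes the bound exceed 1
    before t0. *)
Lemma exprim_bound f k (t0 u : R) : {homo f : x y / x <= y} -> (forall x, 0 <= f x) ->
  0 <= t0 -> 0 <= k -> k <= f t0 -> 0 <= u ->
  exprim f u <= expR (pi * k * t0) * expR (- (pi * k) * u).
Proof.
move=> fnd f0 t00 k0 kf u0; have p0 : 0 <= pi :> R := pi_ge0 R.
have rf : regular f by exact: regular_nondecreasing.
rewrite -expRD exprimE ler_expR.
have -> : pi * k * t0 + - (pi * k) * u = - pi * (k * (u - t0)) by ring.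
rewrite !mulNr lerN2 ler_wpM2l//; have [t0u|ut0] := leP t0 u.
  apply: (@le_trans _ _ (prim f u - prim f t0)).
    by apply: prim_lb => // x tx _; apply: le_trans kf _; exact/fnd/ltW.
  by rewrite gerBl prim_ge0.
apply: le_trans (prim_ge0 _ (fun x _ => f0 x)).
by rewrite mulr_ge0_le0// subr_le0 ltW.
Qed.

(** Read off from the normalisation of the exponential density. *)
Lemma integrable_expRN k : 0 < k ->
  mu.-integrable `[0, +oo[ (fun u => (expR (- k * u))%:E).
Proof.
move=> k0; have mexp : measurable_fun [set: R] (fun u => expR (- k * u)).
  by apply: measurableT_comp => //; exact: measurable_funM.
apply/integrableP; split.
  by apply/measurable_EFinP; exact: measurable_funTS.
under eq_integral do rewrite gee0_abs ?lee_fin ?expR_ge0//.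
have : (\int[mu]_x ((fun u => (k * expR (- k * u))%:E) \_ `[0%R, +oo[) x = 1)%E.
  rewrite -(integral_exponential_pdf k0); apply: eq_integral => x _.
  by rewrite /exponential_pdf !patchE; case: ifP.
rewrite -integral_mkcond => H.
suff : (k%:E * \int[mu]_(u in `[0%R, +oo[) (expR (- k * u))%:E = 1)%E.
  case: (\int[mu]_(u in _) _)%E => [r|//|//]; rewrite ?ltry//.
  by rewrite gt0_muley.
rewrite -ge0_integralZl ?lee_fin ?(ltW k0)//.
by apply/measurable_EFinP; exact: measurable_funTS.
Qed.

Lemma integrable_exprim f (t0 : R) : {homo f : x y / x <= y} -> (forall x, 0 <= f x) ->
  0 <= t0 -> 0 < f t0 -> mu.-integrable `[0, +oo[ (EFin \o exprim f).
Proof.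
move=> fnd f0 t00 ft0; have p0 : 0 < pi :> R := pi_gt0 R.
have rf : regular f by exact: regular_nondecreasing.
have [mE _] : regular (exprim f) by exact: regular_exprim.
have ib := integrableZl measurable_pos (expR (pi * f t0 * t0))
  (integrable_expRN (mulr_gt0 p0 ft0)).
apply: le_integrable ib => //.
  by apply/measurable_EFinP; exact: measurable_funTS.
move=> u; rewrite /= in_itv/= andbT => u0; rewrite lee_fin.
rewrite !ger0_norm ?mulr_ge0 ?exprim_ge0 ?expR_ge0//.
by apply: exprim_bound => //; exact: ltW.
Qed.

Definition exprim_total f : R := \int[mu]_(u in `[0, +oo[) exprim f u.

Lemma prim_le_total f z : mu.-integrable `[0, +oo[ (EFin \o exprim f) -> 0 <= z ->
  prim (exprim f) z <= exprim_total f.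
Proof.
move=> ie z0; rewrite -subr_ge0 /exprim_total prim.unlock Rintegral_itvB//.
by apply: Rintegral_ge0 => x _; exact: exprim_ge0.
Qed.

Lemma exprim_tail_gt0 f z : regular f -> (forall x, 0 <= f x) ->
  mu.-integrable `[0, +oo[ (EFin \o exprim f) -> 0 <= z ->
  0 < exprim_total f - prim (exprim f) z.
Proof.
move=> rf f0 ie z0; have z10 : 0 <= z + 1 by rewrite addr_ge0.
have rE : regular (exprim f) by exact: regular_exprim.
apply: (@lt_le_trans _ _ (prim (exprim f) (z + 1) - prim (exprim f) z)); last first.
  by rewrite lerD2r prim_le_total.
apply: (@lt_le_trans _ _ (exprim f (z + 1) * (z + 1 - z))).
  by rewrite addrAC subrr add0r mulr1 exprim_gt0.
by apply: prim_lb => //; [rewrite lerDl|move=> x _ xz; exact: exprim_ni].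
Qed.

Lemma prim_cvg_integral f : (forall x, 0 <= f x) ->
  mu.-integrable `[0, +oo[ (EFin \o f) ->
  prim f n%:R @[n --> \oo] --> \int[mu]_(u in `[0, +oo[) f u.
Proof.
move=> f0 ie; rewrite prim.unlock /Rintegral; apply: fine_cvg.
rewrite fineK; last exact: integrable_fin_num.
have -> : `[(0 : R), +oo[%classic = \bigcup_n `[(0 : R), n%:R]%classic.
  apply/seteqP; split => x /=.
    rewrite in_itv/= andbT => x0; exists (Num.truncn x).+1 => //=.
    by rewrite in_itv/= x0 ltW// truncnS_gt.
  by move=> [n _]; rewrite /= !in_itv/= andbT => /andP[].
apply: ge0_nondecreasing_set_cvg_integral => //.
- move=> n m nm; apply/subsetPset => x; rewrite /= !in_itv/= => /andP[-> xn].
  by rewrite (le_trans xn)// ler_nat.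
- move=> n; have := ie => /integrableP[mE _].
  by apply: measurable_funS mE => // x; rewrite /= !in_itv/= andbT => /andP[].
- by move=> n x _; rewrite lee_fin f0.
Qed.

Lemma prim_cvg_total f : mu.-integrable `[0, +oo[ (EFin \o exprim f) ->
  prim (exprim f) n%:R @[n --> \oo] --> exprim_total f.
Proof. by move=> ie; apply: prim_cvg_integral => // x; exact: exprim_ge0. Qed.

(** Dominated convergence. A common exponential bound needs a common lower bound for the g n at t0;
    half of f t0 serves from some index N on, hence the shift of the sequence by N. *)
Lemma exprim_total_cvg (g : nat -> R -> R) f (t0 : R) :
  (forall n, {homo g n : x y / x <= y}) -> (forall n x, 0 <= g n x) ->
  {homo f : x y / x <= y} -> (forall x, 0 <= f x) ->
  (forall z, 0 <= z -> prim (g n) z @[n --> \oo] --> prim f z) ->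
  g n t0 @[n --> \oo] --> f t0 -> 0 <= t0 -> 0 < f t0 ->
  exprim_total (g n) @[n --> \oo] --> exprim_total f.
Proof.
move=> gnd g0 fnd f0 pg gt ft00 ft0; have p0 : 0 < pi :> R := pi_gt0 R.
have rg n : regular (g n) by exact: regular_nondecreasing.
have rf : regular f by exact: regular_nondecreasing.
pose k := f t0 / 2; have k0 : 0 < k by rewrite divr_gt0.
have [N _ Nk] : \forall n \near \oo, k <= g n t0.
  have /cvgrPdist_le/(_ _ k0) := gt; apply: filterS => n.
  rewrite ler_norml => /andP[_]; rewrite /k; lra.
rewrite -(cvg_shiftn N).
have ib := integrableZl measurable_pos (expR (pi * k * t0))
  (integrable_expRN (mulr_gt0 p0 k0)).
have me (h : R -> R) : regular h -> (forall x, 0 <= h x) ->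
    measurable_fun `[(0 : R), +oo[%classic (EFin \o exprim h).
  move=> rh h0; apply/measurable_EFinP/measurable_funTS.
  by have [] : regular (exprim h) by exact: regular_exprim.
rewrite /exprim_total /Rintegral; apply: fine_cvg.
rewrite fineK; last by apply: integrable_fin_num => //; exact: integrable_exprim ft0.
apply: (dominated_cvg _ _ _ _ ib) => //.
- by move=> n; exact: me.
- move=> u; rewrite /= in_itv/= andbT => u0; apply: cvg_EFin; first exact: nearW.
  suff : exprim (g n) u @[n --> \oo] --> exprim f u by rewrite -(cvg_shiftn N).
  under eq_fun do rewrite exprimE; rewrite exprimE.
  apply: continuous_cvg; first exact: continuous_expR.
  exact: cvgMr (pg _ u0).
- move=> n u; rewrite /= in_itv/= andbT => u0; rewrite lee_fin.
  rewrite ger0_norm ?exprim_ge0//; apply: exprim_bound => //; first exact: ltW.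
  by apply: Nk; rewrite /= leq_addl.
Qed.

End exprim_integral.

Section stieltjes_tail_total.
Variable R : realType.
Variable mu : {measure set (measurableTypeR R) -> \bar R}.
Hypothesis lfmu : locally_finite_pos mu.
Variables (F : R -> R) (t0 : R).
Hypothesis FE : distr_fun mu = F.
Hypothesis t00 : 0 <= t0.
Hypothesis Ft0 : 0 < F t0.
Let F_nd : {homo F : x y / x <= y}.
Proof. by rewrite -FE; exact: distr_fun_nd. Qed.
Let F_ge0 x : 0 <= F x.
Proof. by rewrite -FE; exact: distr_fun_ge0. Qed.
Let rF : regular F := regular_nondecreasing F_nd.
Let ie := integrable_exprim F_nd F_ge0 t00 Ft0.
Notation m := (exprim_total F).

(** Past z the function F is at least F z, so pi F z times the integral of e over (z, n] is at most
    pi times that of F e, which is e z - e n. Then n tends to infinity. *)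
Lemma exprim_tail_le z : 0 <= z ->
  pi * F z * (m - prim (exprim F) z) <= exprim F z.
Proof.
move=> z0; have p0 : 0 <= pi :> R := pi_ge0 R.
have rE : regular (exprim F) by exact: regular_exprim.
have : pi * F z * (prim (exprim F) n%:R - prim (exprim F) z) @[n --> \oo] -->
    pi * F z * (m - prim (exprim F) z).
  by apply: cvgMr; apply: cvgB (prim_cvg_total ie) (cvg_cst _).
apply: (closed_cvg _ (@closed_le R (exprim F z))).
near=> n; have zn : z <= n%:R by near: n; exact: nbhs_infty_ger.
apply: (@le_trans _ _ (exprim F z - exprim F n%:R)); last first.
  by rewrite gerBl exprim_ge0.
rewrite (exprim_chainB F_nd F_ge0)// -mulrA ler_wpM2l// mulrBr -!primZ//.
apply: prim_le => //.
- exact: (regularM (regular_cst _)).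
- exact: (regularM rF).
- by move=> x /ltW zx _; rewrite ler_wpM2r ?exprim_ge0//; exact: F_nd.
Unshelve. all: by end_near. Qed.

Lemma exprim_cvg0 : exprim F n%:R @[n --> \oo] --> 0.
Proof.
have p0 : 0 < pi :> R := pi_gt0 R.
apply: (@squeeze_cvgr _ _ _ _ (cst 0)
  (fun n : nat => expR (pi * F t0 * t0) * expR (- (pi * F t0) * n%:R))).
- near=> n; rewrite exprim_ge0/=; apply: exprim_bound => //; exact: F_ge0.
- exact: cvg_cst.
- rewrite -[X in _ --> X](mulr0 (expR (pi * F t0 * t0))); apply: cvgMr.
  under eq_fun do rewrite mulNr.
  apply: (@cvg_comp _ _ _ (fun n : nat => pi * F t0 * n%:R) (fun x => expR (- x)));
    last exact: cvgr_expR.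
  apply/cvgryPge => A; have /cvgryPge/(_ (A / (pi * F t0))) := @cvgr_idn R.
  by apply: filterS => n; rewrite ler_pdivrMr ?mulr_gt0// mulrC.
Unshelve. all: by end_near. Qed.

(** By integration by parts and [exprim_tail_le] the value lies between 1 - e and 1. This is why the
    cells of all points of W have total mean area |W|, and why the normalised denominator of [FhatV]
    tends to 1. *)
Lemma stieltjes_tail_cvg1 :
  stieltjes mu (fun h => pi * (m - prim (exprim F) h)) n%:R @[n --> \oo] --> (1 : R).
Proof.
have p0 : 0 <= pi :> R := pi_ge0 R.
apply: (@squeeze_cvgr _ _ _ _ (fun n : nat => 1 - exprim F n%:R) (cst 1)).
- near=> n; rewrite (stieltjes_tail lfmu FE)//; apply/andP; split.
    rewrite lerDl !mulr_ge0//; apply: ltW; exact: exprim_tail_gt0.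
  have : pi * F n%:R * (m - prim (exprim F) n%:R) <= exprim F n%:R.
    by apply: exprim_tail_le.
  move: (pi * _ * _) (exprim _ _) => A B /=; lra.
- by rewrite -[X in _ --> X](subr0 1); apply: cvgB (cvg_cst _) exprim_cvg0.
- exact: cvg_cst.
Unshelve. all: by end_near. Qed.

End stieltjes_tail_total.

Section lebesgue_stieltjes_distr.
Variable R : realType.
Variable F : cumulative R R.
Notation mu := (lebesgue_stieltjes_measure F :
  {measure set (measurableTypeR R) -> \bar R}).

Lemma lebesgue_stieltjes_measure_itvoc (a b : R) : a <= b ->
  mu `]a, b]%classic = (F b - F a)%:E.
Proof.
move=> ab; rewrite /= /lebesgue_stieltjes_measure/= /measure_extension/=.
by rewrite measurable_mu_extE/=; [rewrite wlength_itv_bnd|exact: is_ocitv].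
Qed.

Hypothesis F0 : forall z, z <= 0 -> F z = 0.

Lemma lebesgue_stieltjes_locally_finite : locally_finite_pos mu.
Proof.
split.
  have -> : `]-oo, (0 : R)]%classic = \bigcup_n `](- n%:R : R), 0]%classic.
    apply/seteqP; split => x /=; last by move=> [n _]; rewrite /= !in_itv/= => /andP[].
    rewrite in_itv/= => x0; exists (Num.truncn (- x)).+1 => //=.
    by rewrite in_itv/= x0 andbT ltrNl truncnS_gt.
  have : (mu \o (fun n => `](- n%:R : R), 0]%classic)) n @[n --> \oo] -->
      mu (\bigcup_n `](- n%:R : R), 0]%classic).
    apply: nondecreasing_cvg_mu => //.
      exact: bigcup_measurable.
    move=> n m nm; apply/subsetPset/subset_itvr.
    by rewrite bnd_simp lerN2 ler_nat.
  have -> : (mu \o (fun n => `](- n%:R : R), 0]%classic)) = cst 0%E.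
    apply/funext => n /=; rewrite lebesgue_stieltjes_measure_itvoc ?oppr_le0//.
    by rewrite !F0 ?oppr_le0// subrr.
  by move=> /(cvg_unique _ (cvg_cst _)) <-.
move=> B mB [M [_ MB]].
pose K : R := `|M| + 1.
have K0 : 0 <= K by rewrite addr_ge0.
have MK : M < K by rewrite (le_lt_trans (ler_norm M))// ltrDl.
apply: (@le_lt_trans _ _ (mu `](- (K + 1)), K]%classic)).
  apply: le_measure; rewrite ?inE// => x Bx.
  have := MB _ MK _ Bx; rewrite /= ler_norml => /andP[h1 h2].
  rewrite /= in_itv/= h2 andbT; apply: lt_le_trans h1.
  by rewrite ltrN2 ltrDl.
rewrite lebesgue_stieltjes_measure_itvoc ?ltry//.
by rewrite (@le_trans _ _ 0)// oppr_le0 addr_ge0.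
Qed.

(** Lets a bundled [cumulative], the form required by [GF], be treated by the lemmas on distribution
    functions of locally finite measures. *)
Lemma distr_fun_lebesgue_stieltjes : distr_fun mu = F.
Proof.
apply/funext => z; have [z0|z0] := leP z 0.
  by rewrite distr_fun_le0// F0.
by rewrite /distr_fun lebesgue_stieltjes_measure_itvoc ?(ltW z0)// (F0 (lexx _)) subr0.
Qed.

Lemma GFE z : 0 <= z ->
  GF F z = F z * exprim F z + pi * prim (F \* (F \* exprim F)) z.
Proof.
move=> z0; have lf := lebesgue_stieltjes_locally_finite.
have FE := distr_fun_lebesgue_stieltjes.
rewrite -(stieltjes_exprim lf FE)// /GF stieltjes.unlock.
apply: eq_Rintegral => h; rewrite inE/= in_itv/= => /andP[h0 _].
by rewrite exprimE (stieltjes_id lf (ltW h0)) FE.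
Qed.

End lebesgue_stieltjes_distr.

(** * From convergence of the estimators to convergence of Fhat *)

Section deconvolution.
Variable R : realType.
Variable FF : {measure set (measurableTypeR R) -> \bar R}.
Hypothesis lfF : locally_finite_pos FF.
Hypothesis FF_neq0 : FF setT <> 0%E.
Notation F := (distr_fun FF).

Lemma distr_fun_gt0 : exists t : R, 0 <= t /\ 0 < F t.
Proof.
apply: contrapT => H.
have F0 z : F z = 0.
  have [z0|z0] := leP z 0; first by rewrite distr_fun_le0.
  apply/eqP; rewrite eq_le distr_fun_ge0 andbT leNgt; apply/negP => Fz.
  by apply: H; exists z; rewrite (ltW z0).
apply: FF_neq0.
pose A : set (measurableTypeR R) := `]-oo, (0 : R)]%classic.
pose B n : set (measurableTypeR R) := `](0 : R), n%:R]%classic.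
have -> : [set: measurableTypeR R] = A `|` \bigcup_n B n.
  apply/seteqP; split => // x _; have [x0|x0] := leP (x : R) 0.
    by left; rewrite /A /= in_itv.
  right; exists (Num.truncn (x : R)).+1 => //=.
  by rewrite /B /= in_itv/= x0 ltW// truncnS_gt.
have mB n : measurable (B n) by exact: measurable_itv.
have mUB : measurable (\bigcup_n B n) by exact: bigcup_measurable.
have FB : FF (\bigcup_n B n) = 0%E.
  have : (FF \o B) n @[n --> \oo] --> FF (\bigcup_n B n).
    apply: nondecreasing_cvg_mu => // n m nm.
    by apply/subsetPset/subset_itvl; rewrite bnd_simp ler_nat.
  have -> : (FF \o B) = cst 0%E.
    by apply/funext => n /=; rewrite /B distr_fun_itv// F0.
  by move=> /(cvg_unique _ (cvg_cst _)) <-.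
have FA : FF A = 0%E by exact: lfF.1.
apply/eqP; rewrite -measure_le0; apply: (le_trans (measureU2 _ _ _)) => //.
  exact: measurable_itv.
by rewrite le_eqVlt; apply/orP; left; apply/eqP; rewrite -[RHS]adde0; exact: (congr2 adde FA FB).
Qed.

Variables (W : nat -> set (R * R)) (e : set (R * R * R)).

Lemma Fplus_nd_ge0 (f : R -> R) : Fplus f ->
  {homo f : x y / x <= y} /\ forall x, 0 <= f x.
Proof.
by move=> [mu [lf ->]]; split; [exact: distr_fun_nd|exact: distr_fun_ge0].
Qed.

Lemma nu2_ge0 (A : set (R * R)) : (0 <= nu2 A)%E.
Proof. exact: measure_ge0. Qed.

(** True for degenerate windows as well: the [fine] of an infinite sum and the inverse of 0 are both
    0. The bounds are what dominated convergence needs. *)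
Lemma FhatV_01 (V : set (R * R)) z : 0 <= FhatV V e z <= 1.
Proof.
rewrite /FhatV.
set A := (\esum_(p in e) _)%E; set B := (\esum_(p in e) _)%E.
have A0 : (0 <= A)%E.
  by apply: esum_ge0 => p _; rewrite mule_ge0 ?nu2_ge0// lee_fin mulr_ge0.
have AB : (A <= B)%E.
  apply: le_esum => p _; rewrite lee_wpmul2r ?nu2_ge0// lee_fin.
  by rewrite ler_piMr// indicE; case: (_ \in _).
have B0 := le_trans A0 AB.
apply/andP; split; first by rewrite divr_ge0 ?fine_ge0.
case: B AB B0 => [b| |]; case: A A0 => [a| |]//=; rewrite ?invr0 ?mulr0//.
rewrite !lee_fin => a0 ab b0; have [->|bn0] := eqVneq b 0.
  by rewrite invr0 mulr0.
by rewrite ler_pdivrMr ?mul1r// lt_neqAle eq_sym bn0.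
Qed.

(** The windows at which [Fhat] would solve an equation whose [mhat] comes from the default value of
    [Fhat0]. *)
Let bad n := Fhat_defined (W n) e /\ ~ exists g, is_Fhat0 (W n) e g.

(** With the default [Fhat0] = 0 the integrand is constantly 1, the integral is infinite, and its
    [fine] is 0. *)
Lemma mhat_bad n : ~ (exists g, is_Fhat0 (W n) e g) -> mhat (W n) e = 0.
Proof.
move=> H; rewrite /mhat /Fhat0 xgetPN; last by move=> g hg; apply: H; exists g.
under eq_Rintegral do rewrite exp_primitiveE exprimE.
rewrite /Rintegral.
under eq_integral.
  move=> x; rewrite inE/= in_itv/= andbT => x0.
  rewrite (_ : prim _ _ = 0) ?mulr0 ?expR0; last by rewrite prim_cst// mul0r.
  over.
by rewrite integral_cst//= mul1e lebesgue_measure_itv/= ltry.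
Qed.

(** With m = 0 the equation reads 1 - e - pi f(z) int_0^z e, and 1 - e = pi int_0^z f e is at most
    pi f(z) int_0^z e since f is nondecreasing. This is incompatible with a positive limit of
    [FhatV]. *)
Lemma FhatV_bad n z : bad n -> 0 <= z -> FhatV (W n) e z <= 0.
Proof.
move=> [[f [/Fplus_nd_ge0[fnd f0] fE]] /mhat_bad m0] z0.
rewrite fE// m0 exp_primitiveE prim_exp_primitive sub0r (exprim_chain fnd f0)//.
have p0 : 0 <= pi :> R := pi_ge0 R.
have rf : regular f by exact: regular_nondecreasing.
have rE : regular (exprim f) by exact: regular_exprim.
rewrite mulrN subr_le0 -mulrA ler_wpM2l// -primZ//.
have := @prim_le _ (f \* exprim f) (fun x => f z * exprim f x) 0 z.
rewrite !prim0 !subr0; apply => //.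
- exact: regularM.
- exact: (regularM (regular_cst _)).
- by move=> x _ xz; rewrite ler_wpM2r ?exprim_ge0//; exact: fnd.
Qed.

Lemma Fhat_cvg :
  (forall z, 0 <= z -> FhatV (W n) e z @[n --> \oo] -->
    stieltjes FF (fun h => pi * (exprim_total F - prim (exprim F) h)) z) ->
  (forall z, 0 <= z -> Ghat (W n) e z @[n --> \oo] --> stieltjes FF (exprim F) z) ->
  forall z, 0 <= z -> Fhat (W n) e z
      @[n --> within [set n | Fhat_defined (W n) e] \oo] --> F z.
Proof.
move=> HV HG z z0.
have [t0 [t00 Ft0]] := distr_fun_gt0.
have F_nd := distr_fun_nd lfF; have F_ge0 := distr_fun_ge0 FF.
have p0 : 0 < pi :> R := pi_gt0 R.
have ie := integrable_exprim F_nd F_ge0 t00 Ft0.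
have rF : regular F by exact: regular_nondecreasing.
pose H0 s := stieltjes FF (fun h => pi * (exprim_total F - prim (exprim F) h)) s.
pose G0 s := stieltjes FF (exprim F) s.
pose good n := Fhat_defined (W n) e /\ exists g, is_Fhat0 (W n) e g.
(* The stability lemmas want their equations at every n. At windows that are not good all data are
   replaced by those of the limit, which satisfy the same equations and leave the convergence
   hypotheses intact. *)
pose pick T n (a b : T) := if `[< good n >] then a else b.
pose f n := pick _ n (Fhat (W n) e) F.
pose g n := pick _ n (Fhat0 (W n) e) F.
pose H n := pick _ n (FhatV (W n) e) H0.
pose G n s := pick _ n (Ghat (W n) e s) (G0 s).
have fP n : good n -> is_Fhat (W n) e (Fhat (W n) e) by move=> [hd _]; exact: (xgetPex (cst 0) hd).
have gP n : good n -> is_Fhat0 (W n) e (Fhat0 (W n) e).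
  by move=> [_ hd]; exact: (xgetPex (cst 0) hd).
have cP n : good n -> exists C : cumulative R R, [/\ Fhat0 (W n) e = C,
    forall x, x <= 0 -> C x = 0 & forall s, 0 <= s -> GF C s = Ghat (W n) e s].
  move=> /gP[[mu [lf gmu]] [C [gC GC]]]; exists C; split => // x x0.
  by rewrite -gC gmu distr_fun_le0.
have f_ndge n : {homo f n : x y / x <= y} /\ forall x, 0 <= f n x.
  rewrite /f /pick; case: asboolP => [gn|_]; last by split.
  by have [/Fplus_nd_ge0] := fP _ gn.
have g_ndge n : {homo g n : x y / x <= y} /\ forall x, 0 <= g n x.
  rewrite /g /pick; case: asboolP => [gn|_]; last by split.
  by have [/Fplus_nd_ge0] := gP _ gn.
have GE n s : 0 <= s -> G n s =
    g n s * exprim (g n) s + pi * prim (g n \* (g n \* exprim (g n))) s.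
  move=> s0; rewrite /g /G /pick; case: asboolP => [gn|_]; last first.
    by rewrite /G0 (stieltjes_exprim lfF).
  by have [C [-> C0 <-//]] := cP _ gn; rewrite GFE.
have G_nd n x y : 0 <= x -> x <= y -> G n x <= G n y.
  move=> x0 xy; have rgn : regular (g n).
    by apply: regular_nondecreasing; have [] := g_ndge n.
  have rE : regular (exprim (g n)) by apply: regular_exprim => // u _; have [] := g_ndge n.
  have st (nu : {measure set (measurableTypeR R) -> \bar R}) h :
      locally_finite_pos nu -> regular h -> (forall u, 0 <= h u) ->
      stieltjes nu h x <= stieltjes nu h y.
    move=> lfn rh h0; rewrite -subr_ge0.
    rewrite -[leLHS](mul0r (distr_fun nu y - distr_fun nu x)).
    by apply: stieltjes_lb => // u _ _; exact: h0.
  have y0 := le_trans x0 xy.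
  rewrite !GE//; rewrite /g /pick in rgn rE *; case: asboolP rgn rE => [gn|_] rgn rE.
    have [C [CE C0 _]] := cP _ gn; rewrite CE in rgn rE *.
    have lfC := lebesgue_stieltjes_locally_finite C0.
    have CC := distr_fun_lebesgue_stieltjes C0.
    by rewrite -!(stieltjes_exprim lfC CC)//; apply: st => // u; exact: exprim_ge0.
  by rewrite -!(stieltjes_exprim lfF erefl)//; apply: st => // u; exact: exprim_ge0.
have G_cvg s : 0 <= s -> G n s @[n --> \oo] --> G0 s.
  move=> s0; apply/cvgrPdist_le => ep ep0.
  have /cvgrPdist_le/(_ _ ep0) := HG _ s0; apply: filterS => n.
  by rewrite /G /pick; case: asboolP => // _ _; rewrite subrr normr0 ltW.
have H_cvg s : 0 <= s -> H n s @[n --> \oo] --> H0 s.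
  move=> s0; apply/cvgrPdist_le => ep ep0.
  have /cvgrPdist_le/(_ _ ep0) := HV _ s0; apply: filterS => n.
  by rewrite /H /pick; case: asboolP => // _ _; rewrite subrr normr0 ltW.
have H0E s : 0 <= s -> H0 s =
    1 - exprim F s + pi * F s * (exprim_total F - prim (exprim F) s).
  by move=> s0; rewrite /H0 (stieltjes_tail lfF erefl).
have H001 s : 0 <= s -> 0 <= H0 s <= 1.
  move=> s0; apply/andP; split.
    apply: (closed_cvg _ (@closed_ge R 0) _ _ (HV _ s0)); apply: nearW => k.
    by have /andP[] := FhatV_01 (W k) s.
  apply: (closed_cvg _ (@closed_le R 1) _ _ (HV _ s0)); apply: nearW => k.
  by have /andP[] := FhatV_01 (W k) s.
have H01 n s : 0 <= s -> 0 <= H n s <= 1.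
  move=> s0; rewrite /H /pick; case: asboolP => _; last exact: H001.
  exact: FhatV_01.
have g_pcvg s : 0 <= s -> prim (g n) s @[n --> \oo] --> prim F s.
  apply: (@fhat0_prim_cvg _ g G F G0) => //.
  - by move=> n; have [] := g_ndge n.
  - by move=> n; have [] := g_ndge n.
  - by move=> s' s'0; rewrite /G0 (stieltjes_exprim lfF).
have g_cvg s : 0 <= s -> g n s @[n --> \oo] --> F s.
  apply: (@fhat0_cvg _ g G F G0) => //.
  - by move=> n; have [] := g_ndge n.
  - by move=> n; have [] := g_ndge n.
  - by move=> s' s'0; rewrite /G0 (stieltjes_exprim lfF).
pose m n := exprim_total (g n).
have m_cvg : m n @[n --> \oo] --> exprim_total F.
  apply: (@exprim_total_cvg _ g F t0) => //.
  - by move=> n; have [] := g_ndge n.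
  - by move=> n; have [] := g_ndge n.
  - exact: g_cvg.
have f_cvg : f n z @[n --> \oo] --> F z.
  apply: (@fhat_cvg _ f H m F H0 (exprim_total F)) => //.
  - by move=> n; have [] := f_ndge n.
  - by move=> n; have [] := f_ndge n.
  - move=> n s s0; rewrite /f /H /m /g /pick; case: asboolP => [gn|_]; last exact: H0E.
    have [_ ->//] := fP _ gn.
    by rewrite exprim.unlock prim.unlock /exprim_total /mhat exprim.unlock.
  - by move=> s s0; exact: exprim_tail_gt0.
(* At t0, where F is positive, the limit of [FhatV] is positive, while [FhatV_bad] makes it
   nonpositive at bad windows. *)
have nbad : \forall n \near \oo, ~ bad n.
  have Ht0 : 0 < H0 t0.
    rewrite H0E// ltr_wpDl//.
      by rewrite subr_ge0; apply: exprim_le1.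
    by rewrite !mulr_gt0// exprim_tail_gt0.
  have Ht02 : 0 < H0 t0 / 2 by rewrite divr_gt0.
  have /cvgrPdist_le/(_ _ Ht02) := HV _ t00; apply: filterS => n + bn.
  have := FhatV_bad bn t00; rewrite -/(H0 t0) ler_norml => h1 /andP[_].
  by move: (H0 t0) (FhatV _ _ _) Ht0 h1 => A B *; lra.
apply/cvgrPdist_le => ep ep0.
have /cvgrPdist_le/(_ _ ep0) := f_cvg.
rewrite near_withinE; apply: filterS2 nbad => n nb fn dn; move: fn.
rewrite /f /pick; case: asboolP => // ngn _; exfalso.
by apply: nb; split => // gex; apply: ngn; split.
Qed.

End deconvolution.

(** * A strong law for monotone sums *)

Section slln.
Variables (R : realType) (d : measure_display) (Omega : measurableType d).
Variable P : probability Omega R.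
(** For x >= 1 the inverse square of x is at most 2 / x - 2 / (x + 1), and the right-hand side
    telescopes. *)
Lemma sum_inv_sq (n : nat) : \sum_(0 <= k < n) ((k.+1%:R : R) ^+ 2)^-1 <= 2.
Proof.
have h (k : nat) : ((k.+1%:R : R) ^+ 2)^-1 <= 2 * k.+1%:R^-1 - 2 * k.+2%:R^-1.
  have k1 : 0 < k.+1%:R :> R by rewrite ltr0n.
  have e : k.+2%:R = k.+1%:R + 1 :> R by rewrite -addn1 natrD.
  have k2 : 0 < k.+1%:R + 1 :> R by rewrite addr_gt0.
  have k3 : 1 <= k.+1%:R :> R by rewrite ler1n.
  rewrite e; move: (k.+1%:R : R) k1 k2 k3 => x x0 x1 x2.
  have -> : 2 * x^-1 - 2 * (x + 1)^-1 = 2 / (x * (x + 1)).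
    by field; rewrite (gt_eqF x0) (gt_eqF x1).
  rewrite -[leLHS]mul1r ler_pdivrMr ?exprn_gt0// mulrAC ler_pdivlMr ?mulr_gt0//.
  by rewrite mul1r expr2 mulrCA ler_wpM2l ?(ltW x0)//; lra.
apply: (@le_trans _ _ (\sum_(0 <= k < n) (2 * k.+1%:R^-1 - 2 * k.+2%:R^-1))).
  by apply: ler_sum => k _.
have -> : \sum_(0 <= k < n) (2 * k.+1%:R^-1 - 2 * k.+2%:R^-1) =
    \sum_(0 <= k < n) ((- (2 * k.+2%:R^-1)) - (- (2 * k.+1%:R^-1))) :> R.
  by apply: eq_bigr => k _; ring.
rewrite (telescope_sumr (fun k : nat => - (2 * k.+1%:R^-1 : R)))//.
by rewrite opprK invr1 mulr1 addrC gerBl.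
Qed.

Local Open Scope ereal_scope.

(** Taken on extended reals because the random sums are not known to be finite beforehand; an
    infinite x gives +oo, so smallness of this quantity also yields finiteness. *)
Definition sqdist (x : \bar R) (c : R) : \bar R := (x - c%:E) * (x - c%:E).

Lemma sqdist_ge0 x c : 0 <= sqdist x c.
Proof.
rewrite /sqdist; case: x => [r| |] /=; rewrite ?mulyy ?mulNyNy//.
by rewrite -EFinB -EFinM lee_fin -expr2 sqr_ge0.
Qed.

Lemma measurable_sqdist (T : Omega -> \bar R) c :
  measurable_fun setT T -> measurable_fun setT (fun w => sqdist (T w) c).
Proof.
move=> mT; have mTc : measurable_fun setT (fun w => T w - c%:E).
  by apply: emeasurable_funB => //; exact: measurable_cst.
exact: emeasurable_funM.
Qed.

Lemma sqdist_cvg (u : nat -> \bar R) c :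
  sqdist (u n) c @[n --> \oo] --> 0 -> u n @[n --> \oo] --> c%:E.
Proof.
move=> uc; have fu (eps : R) : (0 < eps)%R -> \forall n \near \oo,
    exists2 r : R, u n = r%:E & (`|r - c| < eps)%R.
  move=> e0; have e20 : (0 < eps ^+ 2)%R by rewrite exprn_gt0.
  have : \forall n \near \oo, sqdist (u n) c < (eps ^+ 2)%:E.
    have /fine_cvgP[uf /cvgrPdist_lt/(_ _ e20)] := uc.
    apply: filterS2 uf => n fn /=; rewrite sub0r normrN => /(le_lt_trans (ler_norm _)).
    by rewrite -lte_fin fineK.
  apply: filterS => n; rewrite /sqdist; case: (u n) => [r| |]//=.
  rewrite -EFinB -EFinM lte_fin => h; exists r => //.
  by rewrite -(ltr_pXn2r (n := 2)) ?nnegrE ?(ltW e0)// real_normK ?num_real// expr2.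
apply/fine_cvgP; split.
  by apply: filterS (fu 1%R ltr01) => n [r -> _].
apply/cvgrPdist_lt => eps e0; apply: filterS (fu _ e0) => n [r /= -> /=].
by rewrite distrC.
Qed.

(** The series of squared deviations has finite expectation, so it is almost surely finite and its
    terms tend to 0; this does the work of Chebyshev's inequality and the Borel-Cantelli lemma at
    once. *)
Lemma ae_cvg_of_summable (T : nat -> Omega -> \bar R) (c : R) (b : nat -> R) (K : R) :
  (forall k, measurable_fun setT (T k)) ->
  (forall k, \int[P]_w sqdist (T k w) c <= (b k)%:E) ->
  (forall n, (\sum_(0 <= k < n) b k <= K)%R) ->
  {ae P, forall w, T k w @[k --> \oo] --> c%:E}.
Proof.
move=> mT Tb bK; pose Y k w := sqdist (T k w) c.
have mY k : measurable_fun setT (Y k) by exact: measurable_sqdist.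
have Y0 k w : 0 <= Y k w by exact: sqdist_ge0.
pose Z w := \sum_(0 <= k <oo) Y k w.
have mZ : measurable_fun setT Z.
  by apply: ge0_emeasurable_sum => // k w _ _; exact: Y0.
have Z0 w : 0 <= Z w by apply: nneseries_ge0.
have iZ : P.-integrable setT Z.
  apply/integrableP; split => //.
  under eq_integral do rewrite gee0_abs//.
  rewrite integral_nneseries//.
  apply: (@le_lt_trans _ _ K%:E); last exact: ltry.
  apply: lime_le.
    by apply: is_cvg_nneseries => k _ _; exact: integral_ge0.
  apply: nearW => n.
  apply: (@le_trans _ _ (\sum_(0 <= k < n) (b k)%:E)).
    by apply: lee_sum => k _; exact: Tb.
  by rewrite sumEFin lee_fin.
have := integrable_ae measurableT iZ.
apply: filterS => w /(_ I) Zfin; apply: sqdist_cvg.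
have Zlt : \sum_(0 <= k <oo) Y k w < +oo by rewrite ltey_eq Zfin.
have tail := nneseries_tail_cvg Zlt (fun k _ => Y0 k w).
apply: (squeeze_cvge _ (cvg_cst 0) tail); apply: nearW => N.
rewrite sqdist_ge0/=.
rewrite (@nneseries_split _ _ N 1)// addn1 big_nat1.
by rewrite leeDl// nneseries_ge0.
Qed.

Lemma ratio_cvg1 :
  ((k.+1%:R / k.+2%:R : R) @[k --> \oo] --> (1 : R))%R.
Proof.
have -> : (fun k : nat => k.+1%:R / k.+2%:R : R)%R = (fun k : nat => 1 - k.+2%:R^-1)%R.
  apply/funext => k; have k2 : (0 < k.+2%:R :> R)%R by rewrite ltr0n.
  have -> : (k.+1%:R = k.+2%:R - 1 :> R)%R by rewrite -[in RHS]addn1 natrD addrK.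
  by rewrite mulrBl divff ?gt_eqF// mul1r.
rewrite -[X in _ --> X](subr0 (1 : R)%R); apply: cvgB; first exact: cvg_cst.
have : (harmonic n @[n --> \oo] --> (0 : R))%R by exact: cvg_harmonic.
by rewrite -(cvg_shiftn 1)/=; under eq_fun do rewrite addn1.
Qed.

(** Variances of order 1 / V are summable along indices with V at least (k+1)^2. For each k the
    first and the last index with V in [(k+1)^2, (k+2)^2) are retained; an index n between them has
    S n / V n squeezed between the ratios at these two, up to factors ((k+1)/(k+2))^2 and its
    inverse, which tend to 1. Taking both ends of each band copes with areas that jump over whole
    bands; for an empty band any index with V large enough will do. *)
Lemma slln_monotone (S : nat -> Omega -> \bar R) (V : nat -> R) (c C : R) :
  (0 <= C)%R ->
  (forall n, measurable_fun setT (S n)) -> (forall n w, 0 <= S n w) ->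
  (forall n m w, (n <= m)%N -> S n w <= S m w) ->
  (forall n m, (n <= m)%N -> (V n <= V m)%R) -> (V n @[n --> \oo] --> +oo)%R ->
  (forall n, (0 < V n)%R ->
    \int[P]_w sqdist (S n w * ((V n)^-1)%:E) c <= (C / V n)%:E) ->
  {ae P, forall w, S n w * ((V n)^-1)%:E @[n --> \oo] --> c%:E}.
Proof.
move=> C0 mS S0 Snd Vnd Voo SC.
have levels k : exists lh : nat * nat,
    [/\ ((k.+1%:R ^+ 2 : R) <= V lh.1)%R, ((k.+1%:R ^+ 2 : R) <= V lh.2)%R &
     forall n, (k.+1%:R ^+ 2 <= V n < k.+2%:R ^+ 2)%R ->
       [/\ (lh.1 <= n <= lh.2)%N, (V lh.1 < k.+2%:R ^+ 2)%R &
           (V lh.2 < k.+2%:R ^+ 2)%R]].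
  pose T n := (k.+1%:R ^+ 2 <= V n < k.+2%:R ^+ 2)%R.
  have Vge (a : R) : exists N, forall n, (N <= n)%N -> (a <= V n)%R.
    by have /cvgryPge/(_ a)[N _ Na] := Voo; exists N => n /Na.
  have [[n0 Tn0]|nT] := pselect (exists n, T n); last first.
    have [N VN] := Vge (k.+1%:R ^+ 2)%R; exists (N, N); split => /=; [exact: VN..|].
    by move=> n Tn; exfalso; apply: nT; exists n.
  have exT : exists n, T n by exists n0.
  have [N VN] := Vge (k.+2%:R ^+ 2)%R.
  have ubT n : T n -> (n <= N)%N.
    move=> /andP[_ Vn]; rewrite leqNgt; apply/negP => /ltnW /VN.
    by rewrite leNgt Vn.
  case: (ex_minnP exT) => lo Tlo lomin.
  case: (ex_maxnP exT ubT) => hi Thi himax.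
  have /andP[l1 l2] := Tlo; have /andP[h1 h2] := Thi.
  by exists (lo, hi); split => // n Tn; split => //=; rewrite lomin ?himax.
have [lh lhP] := choice levels.
have kpos k : (0 < k.+1%:R ^+ 2 :> R)%R by rewrite exprn_gt0// ltr0n.
have sub (l : nat -> nat) : (forall k, (k.+1%:R ^+ 2 <= V (l k))%R) ->
    {ae P, forall w, S (l k) w * ((V (l k))^-1)%:E @[k --> \oo] --> c%:E}.
  move=> Vl; have Vl0 k : (0 < V (l k))%R by exact: lt_le_trans (Vl k).
  apply: (@ae_cvg_of_summable (fun k w => S (l k) w * ((V (l k))^-1)%:E) c
    (fun k => C * (k.+1%:R ^+ 2)^-1)%R (C * 2)%R).
  - by move=> k; apply: emeasurable_funM => //; exact: measurable_cst.
  - move=> k; apply: (le_trans (SC _ (Vl0 k))); rewrite lee_fin ler_wpM2l//.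
    by rewrite lef_pV2// posrE.
  - by move=> n; rewrite -mulr_sumr ler_wpM2l// sum_inv_sq.
have lo := sub (fun k => (lh k).1) (fun k => let: And3 h _ _ := lhP k in h).
have hi := sub (fun k => (lh k).2) (fun k => let: And3 _ h _ := lhP k in h).
apply: filterS2 lo hi => w low hiw.
pose r k : R := (k.+1%:R / k.+2%:R)%R.
pose a k := S (lh k).1 w * ((V (lh k).1)^-1)%:E * ((r k) * (r k))%:E.
pose b k := S (lh k).2 w * ((V (lh k).2)^-1)%:E * ((r k)^-1 * (r k)^-1)%:E.
have r0 k : (0 < r k)%R by rewrite divr_gt0// ltr0n.
have a_cvg : a k @[k --> \oo] --> c%:E.
  rewrite -[c%:E]mule1; apply: cvgeM => //.
  apply: cvg_EFin; first exact: nearW.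
  rewrite -[X in (_ --> X)%R](mulr1 (1 : R)%R); exact: (cvgM ratio_cvg1 ratio_cvg1).
have b_cvg : b k @[k --> \oo] --> c%:E.
  rewrite -[c%:E]mule1; apply: cvgeM => //.
  apply: cvg_EFin; first exact: nearW.
  rewrite -[X in (_ --> X)%R](mulr1 (1 : R)%R).
  have rV : ((r k)^-1 @[k --> \oo] --> (1 : R))%R.
    rewrite -[X in (_ --> X)%R](invr1 R); apply: cvgV; [exact: oner_neq0|].
    exact: ratio_cvg1.
  exact: (cvgM rV rV).
(* The band of n: bands are numbered from 0 but start at V = 1, hence the predecessor. *)
pose kk n := (Num.truncn (Num.sqrt (V n))).-1.
have kk_oo : kk n @[n --> \oo] --> \oo.
  apply/cvgnyPge => A; have /cvgryPge/(_ (A.+1%:R ^+ 2)%R) := Voo.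
  apply: filterS => n Vn; rewrite /kk -ltnS (leq_trans _ (leqSpred _))//.
  rewrite truncn_ge_nat ?sqrtr_ge0//.
  by rewrite -(ler_pXn2r (n := 2)) ?nnegrE ?sqrtr_ge0// sqr_sqrtr// (le_trans _ Vn)// ltW.
have ka : a (kk n) @[n --> \oo] --> c%:E by exact: (cvg_comp _ _ kk_oo a_cvg).
have kb : b (kk n) @[n --> \oo] --> c%:E by exact: (cvg_comp _ _ kk_oo b_cvg).
apply: (squeeze_cvge _ ka kb).
have /cvgryPge/(_ 1%R) := Voo; apply: filterS => n Vn1.
have Vn0 : (0 < V n)%R by exact: lt_le_trans Vn1.
have [h1 h2 h3] := lhP (kk n).
have Vkk : ((kk n).+1%:R ^+ 2 <= V n < (kk n).+2%:R ^+ 2)%R.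
  have t1 : (0 < Num.truncn (Num.sqrt (V n)))%N.
    rewrite truncn_gt0 -[leLHS]sqrtr1; apply: ler_wsqrtr; exact: Vn1.
  rewrite /kk prednK//; have /andP[i1 i2] := truncn_itv (sqrtr_ge0 (V n)).
  have Vs : (Num.sqrt (V n) ^+ 2 = V n)%R by rewrite sqr_sqrtr// ltW.
  by rewrite -[X in (_ <= X < _)%R]Vs ler_pXn2r ?ltr_pXn2r ?nnegrE ?sqrtr_ge0// i1 i2.
have [/andP[lon nhi] Vlo Vhi] := h3 _ Vkk.
have /andP[v1 v2] := Vkk.
move: (kk n) h1 h2 lon nhi Vlo Vhi v1 v2 => k h1 h2 lon nhi Vlo Vhi v1 v2.
have V1 : (0 < V (lh k).1)%R by exact: lt_le_trans h1.
have V2 : (0 < V (lh k).2)%R by exact: lt_le_trans h2.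
have k1 : (0 < k.+1%:R :> R)%R by rewrite ltr0n.
have k2 : (0 < k.+2%:R :> R)%R by rewrite ltr0n.
apply/andP; split.
  rewrite /a -muleA -EFinM; apply: lee_pmul => //.
  - by rewrite lee_fin mulr_ge0 ?invr_ge0 ?(ltW V1)// mulr_ge0 ?(ltW (r0 k)).
  - exact: Snd.
  - rewrite lee_fin /r mulrC ler_pdivrMr// ler_pdivlMl// mulrC.
    have -> : (k.+1%:R / k.+2%:R * (k.+1%:R / k.+2%:R) * V n =
       (k.+1%:R ^+ 2 * V n) / k.+2%:R ^+ 2 :> R)%R.
      by field; rewrite gt_eqF.
    by rewrite ler_pdivrMr// ler_pM// ltW.
rewrite /b -muleA -EFinM; apply: lee_pmul => //.
- by rewrite lee_fin invr_ge0 ltW.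
- exact: Snd.
- rewrite lee_fin /r [leRHS]mulrC ler_pdivlMr// ler_pdivrMl// mulrC.
  have -> : ((k.+1%:R / k.+2%:R)^-1 * (k.+1%:R / k.+2%:R)^-1 * V n =
     (k.+2%:R ^+ 2 * V n) / k.+1%:R ^+ 2 :> R)%R.
    by field; rewrite !gt_eqF.
  by rewrite ler_pdivlMr//; apply: ler_pM => //; exact: ltW.
Qed.

End slln.

(** * Area in the plane *)

HB.instance Definition _ (R : realType) :=
  Measure.copy (@nu2 R) (@lebesgue_measure R \x @lebesgue_measure R)%E.

Lemma nu2_setX (R : realType) (A B : set (measurableTypeR R)) :
  measurable A -> measurable B ->
  nu2 (A `*` B) = (lebesgue_measure A * lebesgue_measure B)%E.
Proof. by move=> mA mB; rewrite /nu2 product_measure1E. Qed.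

Lemma nu2_sigma_finite (R : realType) : sigma_finite setT (@nu2 R).
Proof.
exists (fun n : nat => `[(- n%:R : R), n%:R]%classic `*` `[(- n%:R : R), n%:R]%classic).
  apply/seteqP; split => // -[x y] _; exists (Num.truncn (`|x| + `|y|)).+1 => //.
  have := truncnS_gt (`|x| + `|y|); move: (_.+1%:R) => N N0.
  have := ler_norm x; have := ler_norm y; have := ler_norm (- x); have := ler_norm (- y).
  rewrite !normrN => *; split; rewrite /= in_itv/=; apply/andP; split;
    move: (normr_ge0 x) (normr_ge0 y) => *; lra.
move=> n; have mI : measurable (`[(- n%:R : R), n%:R]%classic : set (measurableTypeR R)).
  exact: measurable_itv.
split; first exact: measurableX.
rewrite nu2_setX//.
by rewrite lebesgue_measure_itv/=; case: ifP => _; rewrite ?mul0e ?ltry// -EFinD -EFinM ltry.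
Qed.

HB.instance Definition _ (R : realType) :=
  @Measure_isSigmaFinite.Build _ _ _ (@nu2 R) (nu2_sigma_finite R).

Section disc.
Variable R : realType.
Notation mu := (@lebesgue_measure R).

Lemma integral_cos_sqr :
  (\int[mu]_(t in `[(- (pi / 2))%R, (pi / 2)%R]) (2 * cos t ^+ 2)%:E = (pi : R)%:E)%E.
Proof.
have p2 : 0 < pi / 2 :> R by rewrite divr_gt0 ?pi_gt0.
have dG (x : R) : is_derive x (1 : R) (fun t : R => t + sin t * cos t) (2 * cos x ^+ 2).
  have h : is_derive x (1 : R) (fun t : R => t + sin t * cos t)
      (1 + (sin x *: (- sin x) + cos x *: cos x)).
    by apply: is_deriveD.
  apply: (is_derive_eq h); have := cos2Dsin2 x.
  rewrite /GRing.scale/= => e; lra.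
rewrite (@continuous_FTC2 _ _ (fun t => t + sin t * cos t)).
- by rewrite sinN cosN sin_pihalf cos_pihalf !mulr0 !addr0 -EFinB; congr _%:E; field.
- by rewrite gtrN.
- apply: continuous_subspaceT => x; apply: cvgMr.
  by apply: (@continuous_comp _ _ _ cos (fun y : R => y ^+ 2));
    [exact: continuous_cos|exact: exprn_continuous].
- have cG (x : R) : {for x, continuous (fun t : R => t + sin t * cos t)}.
    by apply: differentiable_continuous; apply/derivable1_diffP; exact: ex_derive.
  split.
  + by move=> x _; exact: ex_derive.
  + exact/cvg_at_right_filter/cG.
  + exact/cvg_at_left_filter/cG.
- by move=> x _; rewrite derive1E; exact: derive_val.
Qed.

(** Substitution x = a + rho sin t in the integral of the chord lengths of a disc, which reduces it
    to [integral_cos_sqr]. *)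
Lemma integral_sqrt_disc (a rho : R) : 0 < rho ->
  (\int[mu]_(x in `[(a - rho)%R, (a + rho)%R])
    (2 * Num.sqrt (rho ^+ 2 - (x - a) ^+ 2))%:E = (pi * rho ^+ 2)%:E)%E.
Proof.
move=> r0; pose F (t : R) := a + rho * sin t.
have p2 : 0 < pi / 2 :> R by rewrite divr_gt0 ?pi_gt0.
have dF (x : R) : is_derive x (1 : R) F (rho * cos x).
  have h : is_derive x (1 : R) F (0 + (rho *: cos x)).
    by apply: is_deriveD.
  by apply: (is_derive_eq h); rewrite add0r.
have F'E : F^`()%classic = (fun x => rho * cos x).
  by apply/funext => x; rewrite derive1E; exact: derive_val.
have cF' : continuous F^`()%classic.
  by rewrite F'E => x; apply: cvgMr; exact: continuous_cos.
have cF (x : R) : {for x, continuous F}.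
  by apply: differentiable_continuous; apply/derivable1_diffP; exact: ex_derive.
have -> : a - rho = F (- (pi / 2)) by rewrite /F sinN sin_pihalf mulrN1.
have -> : a + rho = F (pi / 2) by rewrite /F sin_pihalf mulr1.
rewrite (@integration_by_substitution_increasing _ F
  (fun x => 2 * Num.sqrt (rho ^+ 2 - (x - a) ^+ 2)) (- (pi / 2)) (pi / 2)).
- transitivity (\int[mu]_(t in `[(- (pi / 2))%R, (pi / 2)%R])
      ((rho ^+ 2)%:E * (2 * cos t ^+ 2)%:E)%E)%E.
    apply: eq_integral => t; rewrite inE/= in_itv/= => /andP[t1 t2].
    rewrite -EFinM; congr _%:E; rewrite F'E /F !fctE /=.
    have -> : rho ^+ 2 - (a + rho * sin t - a) ^+ 2 = (rho * cos t) ^+ 2.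
      by have := cos2Dsin2 t; rewrite !exprMn => e; rewrite addrAC subrr add0r exprMn; 
         rewrite -[X in X - _]mulr1 -e; ring.
    rewrite sqrtr_sqr ger0_norm; first by ring.
    by rewrite mulr_ge0 ?(ltW r0)// cos_ge0_pihalf// t1.
  rewrite ge0_integralZl//.
  + by rewrite integral_cos_sqr -EFinM mulrC.
  + apply/measurable_EFinP/measurable_funTS; apply: measurable_funM => //.
    by apply: measurable_funX; apply: continuous_measurable_fun; exact: continuous_cos.
  + by move=> x _; rewrite lee_fin mulr_ge0// sqr_ge0.
  + by rewrite lee_fin sqr_ge0.
- by rewrite ge0_cp ?(ltW p2)//.
- by move=> x y xi yi xy; rewrite /F ltrD2l ltr_pM2l// ltr_sin.
- by move=> x _; exact: cF'.
- by apply/cvg_ex; eexists; apply/cvg_at_right_filter/cF'.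
- by apply/cvg_ex; eexists; apply/cvg_at_left_filter/cF'.
- split.
  + by move=> x _; exact: ex_derive.
  + exact/cvg_at_right_filter/cF.
  + exact/cvg_at_left_filter/cF.
- apply: continuous_subspaceT => x; apply: cvgMr.
  apply: continuous_comp; last exact: sqrt_continuous.
  apply: cvgB; first exact: cvg_cst.
  by apply: cvgM; apply: cvgB => //; exact: cvg_cst.
Qed.

End disc.

(** * The cost function on the plane *)

Section measurable_sublevel.
Context d (T : measurableType d) (R : realType).
Implicit Types f : T -> R.

Lemma measurable_sublevel f r : measurable_fun setT f ->
  measurable [set x | f x <= r].
Proof.
move=> mf; have := mf measurableT `]-oo, r]%classic (measurable_itv _).
by rewrite setTI; congr measurable; apply/seteqP; split => x; rewrite /= in_itv.
Qed.

Lemma measurable_strict_sublevel f r : measurable_fun setT f ->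
  measurable [set x | f x < r].
Proof.
move=> mf; have := mf measurableT `]-oo, r[%classic (measurable_itv _).
by rewrite setTI; congr measurable; apply/seteqP; split => x; rewrite /= in_itv.
Qed.

End measurable_sublevel.

Definition cost (R : realType) (y : R * R) (p : R * R * R) : R :=
  (y.1 - p.1.1) ^+ 2 + (y.2 - p.1.2) ^+ 2 + p.2.

Section plane.
Variable R : realType.
Notation mR := (measurableTypeR R).
Notation leb := (@lebesgue_measure R).

Lemma enorm_sqr (v : R * R) : enorm v ^+ 2 = v.1 ^+ 2 + v.2 ^+ 2.
Proof. by rewrite /enorm sqr_sqrtr// addr_ge0 ?sqr_ge0. Qed.

Lemma costE (y : R * R) (p : R * R * R) : enorm (y - p.1) ^+ 2 + p.2 = cost y p.
Proof. by rewrite enorm_sqr. Qed.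

Lemma measurable_cost :
  measurable_fun [set: (mR * mR) * (mR * mR * mR)] (fun z => cost z.1 z.2).
Proof.
have m1 := @measurable_fst _ _ (mR * mR)%type (mR * mR * mR)%type.
have m2 := @measurable_snd _ _ (mR * mR)%type (mR * mR * mR)%type.
have mp := measurableT_comp (@measurable_fst _ _ (mR * mR)%type mR) m2.
apply: measurable_funD.
  apply: measurable_funD; apply: measurable_funX; apply: measurable_funB.
  - exact: measurableT_comp (@measurable_fst _ _ mR mR) m1.
  - exact: measurableT_comp (@measurable_fst _ _ mR mR) mp.
  - exact: measurableT_comp (@measurable_snd _ _ mR mR) m1.
  - exact: measurableT_comp (@measurable_snd _ _ mR mR) mp.
exact: measurableT_comp (@measurable_snd _ _ (mR * mR)%type mR) m2.
Qed.

Lemma measurable_cost1 (p : R * R * R) :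
  measurable_fun [set: mR * mR] (fun y => cost y p).
Proof.
have h : measurable_fun setT
    (fun y : mR * mR => (y, p) : (mR * mR) * (mR * mR * mR)).
  exact: measurable_pair2.
exact: (measurableT_comp measurable_cost h).
Qed.

Lemma measurable_cost2 (y : R * R) :
  measurable_fun [set: mR * mR * mR] (fun p => cost y p).
Proof.
have h : measurable_fun setT
    (fun p : mR * mR * mR => (y, p) : (mR * mR) * (mR * mR * mR)).
  exact: measurable_pair1.
exact: (measurableT_comp measurable_cost h).
Qed.

(** The sublevel set is a disc of squared radius s - p.2; its vertical sections are the chords
    integrated in [integral_sqrt_disc]. *)
Lemma nu2_disc (p : R * R * R) s : p.2 <= s ->
  nu2 [set y : mR * mR | cost y p <= s] = (pi * (s - p.2))%:E.
Proof.
move=> ps; pose r := s - p.2; have r0 : 0 <= r by rewrite subr_ge0.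
pose rho := Num.sqrt r.
have rho2 : rho ^+ 2 = r by rewrite sqr_sqrtr.
rewrite /nu2 /product_measure1.
transitivity (\int[leb]_x (2 * Num.sqrt (rho ^+ 2 - (x - p.1.1) ^+ 2))%:E)%E.
  apply: eq_integral => x _ /=; rewrite rho2.
  have [xr|xr] := leP ((x - p.1.1) ^+ 2) r; last first.
    rewrite [X in leb X](_ : _ = set0) ?measure0.
      by rewrite ler0_sqrtr ?mulr0// subr_le0 ltW.
    rewrite -subset0 => v /xsectionP /=; rewrite /cost/=.
    have := sqr_ge0 (v - p.1.2); move: xr; rewrite /r; lra.
  pose t := Num.sqrt (r - (x - p.1.1) ^+ 2).
  have t0 : 0 <= t by exact: sqrtr_ge0.
  have t2 : t ^+ 2 = r - (x - p.1.1) ^+ 2 by rewrite sqr_sqrtr// subr_ge0.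
  rewrite [X in leb X](_ : _ = `[p.1.2 - t, p.1.2 + t]%classic).
    rewrite lebesgue_measure_itv/= lte_fin; case: ltP => h.
      by rewrite -EFinD; congr _%:E; rewrite -/t; ring.
    have -> : Num.sqrt (r - (x - p.1.1) ^+ 2) = 0 by rewrite -/t; lra.
    by rewrite mulr0.
  have e v : (cost (x, v) p <= s) = ((v - p.1.2) ^+ 2 <= t ^+ 2).
    by rewrite t2 /cost/= /r; apply/idP/idP; lra.
  apply/seteqP; split => v.
    move=> /xsectionP; rewrite /= e -ler_sqrt ?sqr_ge0// !sqrtr_sqr (ger0_norm t0).
    by rewrite in_itv/= ler_distl.
  move=> /=; rewrite in_itv/= => h; apply/xsectionP; rewrite /= e.
  by rewrite -ler_sqrt ?sqr_ge0// !sqrtr_sqr (ger0_norm t0) ler_distl.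
have [rho0|rho0] := ltP 0 rho; last first.
  have rho00 : rho = 0 by apply/eqP; rewrite eq_le rho0 sqrtr_ge0.
  have -> : s - p.2 = 0 by rewrite -/r -rho2 rho00 expr0n.
  rewrite mulr0; apply: integral0_eq => x _; rewrite rho00 expr0n/= sub0r.
  by rewrite ler0_sqrtr ?mulr0// oppr_le0 sqr_ge0.
rewrite -/r -rho2 -(integral_sqrt_disc p.1.1 rho0) [RHS]integral_mkcond.
apply: eq_integral => x _; rewrite patchE; case: ifPn => //.
rewrite notin_setE/= in_itv/= => xn.
rewrite ler0_sqrtr ?mulr0// subr_le0 -ler_sqrt ?sqr_ge0// !sqrtr_sqr.
rewrite (ger0_norm (ltW rho0)) ltW// ltNge ler_distl; exact/negP.
Qed.

Lemma nu2_disc0 (p : R * R * R) s : s <= p.2 ->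
  nu2 [set y : mR * mR | cost y p <= s] = 0%E.
Proof.
rewrite le_eqVlt => /predU1P[->|sp]; first by rewrite nu2_disc// subrr mulr0.
rewrite [X in nu2 X](_ : _ = set0) ?measure0// -subset0 => y /=.
by rewrite /cost; have := sqr_ge0 (y.1 - p.1.1); have := sqr_ge0 (y.2 - p.1.2); lra.
Qed.

End plane.

Section plane_integral.
Variable R : realType.
Notation mR := (measurableTypeR R).
Notation leb := (@lebesgue_measure R).
Variable p : R * R * R.
Hypothesis p0 : 0 <= p.2.

Let cp := (fun y : mR * mR => cost y p : mR).
Let mcp : measurable_fun setT cp := measurable_cost1 p.
Let nu := measure_function_pushforward__canonical__measure_function_Measure
  (@nu2 R) mcp : {measure set mR -> \bar R}.

Let nu_le s : p.2 <= s -> nu `]-oo, s]%classic = (pi * (s - p.2))%:E.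
Proof. exact: nu2_disc. Qed.

Let nu_le0 : nu `]-oo, 0]%classic = 0%E.
Proof. exact: nu2_disc0. Qed.

Let lfnu : locally_finite_pos nu.
Proof.
split => // B mB [M [_ MB]].
pose K : R := `|M| + 1 + p.2.
have MK : M < K by have := ler_norm M; rewrite /K; move: p0; lra.
have pK : p.2 <= K by rewrite /K lerDr addr_ge0.
apply: (@le_lt_trans _ _ (nu `]-oo, K]%classic)).
  apply: le_measure; rewrite ?inE// => x Bx.
  by have := MB _ MK _ Bx; rewrite /= ler_norml in_itv/= => /andP[_ ->].
by rewrite nu_le// ltry.
Qed.

Let nu_distr s : p.2 <= s -> distr_fun nu s = pi * (s - p.2).
Proof.
move=> ps; rewrite /distr_fun.
have : nu `]-oo, s]%classic = (nu `]-oo, 0%R]%classic + nu `]0%R, s]%classic)%E.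
  rewrite -measureU//; last first.
    rewrite -subset0 => y [/=]; rewrite !in_itv/= => y0 /andP[].
    by rewrite ltNge y0.
  congr (nu _); apply: itv_bndbnd_setU; rewrite ?bnd_simp//.
  exact: le_trans ps.
by rewrite nu_le// nu_le0 add0e => <-.
Qed.

Variable g : R -> R.
Hypothesis g_ni : {homo g : x y /~ x <= y}.
Hypothesis g_ge0 : forall x, 0 <= g x.
Hypothesis g_int : leb.-integrable `[0, +oo[ (EFin \o g).
Let rg : regular g := regular_nonincreasing g_ni.

Let stieltjes_disc z : p.2 <= z ->
  stieltjes nu g z = pi * (prim g z - prim g p.2).
Proof.
move=> pz; have ppi := pi_ge0 R.
have base : stieltjes nu g p.2 = 0.
  apply/eqP; rewrite eq_le; apply/andP; split; last first.
    by rewrite stieltjes.unlock; apply: Rintegral_ge0 => x _; exact: g_ge0.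
  have := stieltjes_ub lfnu (M := g 0) rg (lexx _) p0 (fun x x0 _ => g_ni (ltW x0)).
  by rewrite stieltjes0 subr0 nu_distr// subrr distr_fun_le0// subr0 !mulr0.
(* Shifted by p.2 because [additive_const] starts at 0. The control function is - g, which is
   nondecreasing: both terms grow by between pi g(b) (b - a) and pi g(a) (b - a), at the shifted
   arguments. *)
pose Q r := stieltjes nu g (p.2 + r) - pi * prim g (p.2 + r).
suff : Q (z - p.2) = Q 0.
  by rewrite /Q addr0 (addrC p.2) subrK base; lra.
apply: (@additive_const _ Q (fun r => - g (p.2 + r)) pi) => //.
  by rewrite subr_ge0.
move=> a b a0 ab bz; rewrite /Q.
have a1 : 0 <= p.2 + a by rewrite addr_ge0.
have ab1 : p.2 + a <= p.2 + b by rewrite lerD2l.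
have pa : p.2 <= p.2 + a by rewrite lerDl.
have pb : p.2 <= p.2 + b by rewrite lerDl (le_trans a0).
have u1 := stieltjes_ub lfnu (M := g (p.2 + a)) rg a1 ab1
  (fun x ax _ => g_ni (ltW ax)).
have l1 := stieltjes_lb lfnu (M := g (p.2 + b)) rg a1 ab1
  (fun x _ xb => g_ni xb).
have u2 := prim_ub (M := g (p.2 + a)) rg a1 ab1 (fun x ax _ => g_ni (ltW ax)).
have l2 := prim_lb (M := g (p.2 + b)) rg a1 ab1 (fun x _ xb => g_ni xb).
move: u1 l1; rewrite !nu_distr//.
move: (ler_wpM2l ppi u2) (ler_wpM2l ppi l2).
move: (stieltjes nu g _) (stieltjes nu g _) (prim g _) (prim g _) (g _) (g _) => *.
rewrite ler_norml; apply/andP; split; lra.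
Qed.

(** Polar coordinates in disguise: by [nu2_disc] the image of the area under the cost of [p] has
    distribution function pi (s - p.2) beyond p.2, so it is pi times Lebesgue measure there. *)
Lemma plane_integral :
  (\int[@nu2 R]_y (g (cost y p))%:E =
   (pi * (\int[leb]_(u in `[0%R, +oo[) g u - prim g p.2))%:E)%E.
Proof.
have mg : measurable_fun setT (EFin \o g) by apply/measurable_EFinP; exact: rg.1.
transitivity (\int[nu]_x (g x)%:E)%E.
  rewrite (@ge0_integral_pushforward _ _ _ _ _ _ mcp (@nu2 R) setT (EFin \o g))//.
  by move=> y _; rewrite lee_fin.
transitivity (\int[nu]_(x in \bigcup_n `]0%R, n%:R%R]%classic) (g x)%:E)%E.
  rewrite (@ge0_negligible_integral _ _ _ nu setT `]-oo, 0%R]%classic)//.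
    congr (integral _ _ _); apply/seteqP; split => x /=.
      rewrite in_itv/= => -[_ /negP]; rewrite -ltNge => x0.
      by exists (Num.truncn x).+1 => //=; rewrite in_itv/= x0 ltW// truncnS_gt.
    by move=> [n _]; rewrite /= !in_itv/= => /andP[x0 _]; split => //; rewrite leNgt x0.
  by move=> x _; rewrite lee_fin.
have c1 : (\int[nu]_(x in `]0%R, n%:R%R]) (g x)%:E)%E @[n --> \oo] -->
    (\int[nu]_(x in \bigcup_n `]0%R, n%:R%R]%classic) (g x)%:E)%E.
  apply: ge0_nondecreasing_set_cvg_integral => //.
  - move=> n m nm; apply/subsetPset => x; rewrite /= !in_itv/= => /andP[-> xn].
    by rewrite (le_trans xn)// ler_nat.
  - by move=> n; exact: measurable_funTS.
  - by move=> n x _; rewrite lee_fin.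
apply: (cvg_unique _ c1) => //.
have c2 : (pi * (prim g n%:R - prim g p.2)) @[n --> \oo] -->
    pi * (\int[leb]_(u in `[0, +oo[) g u - prim g p.2).
  apply: cvgMr; apply: cvgB; last exact: cvg_cst.
  exact: prim_cvg_integral.
have : (pi * (prim g n%:R - prim g p.2))%:E @[n --> \oo] -->
    (pi * (\int[leb]_(u in `[0, +oo[) g u - prim g p.2))%:E.
  by apply: cvg_EFin => //; exact: nearW.
apply: cvg_trans; apply: near_eq_cvg; near=> n.
have pn : p.2 <= n%:R by near: n; exact: nbhs_infty_ger.
rewrite -stieltjes_disc// stieltjes.unlock /Rintegral fineK//.
apply: integrable_fin_num => //.
exact: (stieltjes_integrable lfnu).
Unshelve. all: by end_near. Qed.

End plane_integral.

Lemma cost_sym (R : realType) (x y : R * R) h : cost y (x, h) = cost x (y, h).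
Proof. rewrite /cost/=; ring. Qed.

(** * The intensity measure and paraboloids *)

Section intensity.
Variable R : realType.
Notation mR := (measurableTypeR R).
Variable FF : {sigma_finite_measure set mR -> \bar R}.

Definition intensity : set (mR * mR * mR) -> \bar R := (@nu2 R \x FF)%E.

HB.instance Definition _ := Measure.copy intensity (@nu2 R \x FF)%E.

Let intensity_sigma_finite : sigma_finite setT intensity.
Proof.
have /sigma_finiteP[A [TA ndA Aoo]] := sigma_finiteT (@nu2 R).
have /sigma_finiteP[B [TB ndB Boo]] := sigma_finiteT FF.
exists (fun n => A n `*` B n).
  apply/seteqP; split => // -[x y] _.
  have [k _ Akx] : (\bigcup_n A n) x by rewrite -TA.
  have [l _ Bly] : (\bigcup_n B n) y by rewrite -TB.
  exists (maxn k l) => //; split.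
    by move: x Akx; exact/subsetPset/ndA/leq_maxl.
  by move: y Bly; exact/subsetPset/ndB/leq_maxr.
move=> k; have [mA Ak] := Aoo k; have [mB Bk] := Boo k.
split; first exact: measurableX.
rewrite /intensity product_measure1E//.
by apply: lte_mul_pinfty => //; rewrite ge0_fin_numE.
Qed.

HB.instance Definition _ :=
  @Measure_isSigmaFinite.Build _ _ _ intensity intensity_sigma_finite.

Lemma intensity_setX (A : set (mR * mR)) (B : set mR) :
  measurable A -> measurable B -> intensity (A `*` B) = (nu2 A * FF B)%E.
Proof. by move=> mA mB; rewrite /intensity product_measure1E. Qed.

Lemma integral_intensity (f : mR * mR * mR -> \bar R) :
  measurable_fun setT f -> (forall p, 0 <= f p)%E ->
  (\int[intensity]_p f p = \int[FF]_h \int[@nu2 R]_x f (x, h))%E.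
Proof.
move=> mf f0; rewrite /intensity.
exact: (@fubini_tonelli2 _ _ _ _ _ (@nu2 R) FF f mf f0).
Qed.

Lemma intensityE (A : set (mR * mR * mR)) : measurable A ->
  (intensity A = \int[FF]_h nu2 (ysection A h))%E.
Proof.
move=> mA; rewrite -[A in LHS]setIT -integral_indic// integral_intensity//.
- apply: eq_integral => h _.
  transitivity (\int[@nu2 R]_x (\1_(ysection A h) x)%:E)%E.
    apply: eq_integral => x _; rewrite !indicE; congr ((_ : bool)%:R%:E).
    by apply/idP/idP; rewrite !inE => /ysectionP.
  by rewrite integral_indic ?setIT//; exact: measurable_ysection.
- exact/measurable_EFinP/measurable_indic.
Qed.

Hypothesis lfF : locally_finite_pos FF.

(** A downward paraboloid with apex (y, s), cut at height 0. That it contains no point of the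
    process means that the least cost seen from y exceeds s. *)
Definition par (y : R * R) (s : R) : set (mR * mR * mR) :=
  [set p | 0 < p.2 /\ cost y p <= s].

Lemma measurable_par y s : measurable (par y s).
Proof.
apply: measurableI; last exact: measurable_sublevel (measurable_cost2 y).
have := @measurable_snd _ _ (mR * mR)%type mR measurableT `]0, +oo[%classic (measurable_itv _).
by rewrite setTI; congr measurable; apply/seteqP; split => x; rewrite /= in_itv/= andbT.
Qed.

Lemma integral_positive (f : mR -> \bar R) : measurable_fun setT f ->
  (forall h, 0 <= f h)%E -> (\int[FF]_h f h = \int[FF]_(h in `]0%R, +oo[) f h)%E.
Proof.
move=> mf f0; rewrite (@ge0_negligible_integral _ _ _ FF setT `]-oo, 0%R]%classic)//.
  congr (integral _ _ _); apply/seteqP; split => x /=.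
    by rewrite !in_itv/= andbT => -[_ /negP]; rewrite -ltNge.
  by rewrite !in_itv/= andbT => x0; split => //; rewrite leNgt x0.
exact: lfF.1.
Qed.

(** The slice at height h is a disc of area pi (s - h), and [stieltjes_id] turns the integral over h
    into a primitive. Hence the paraboloid is empty with probability [exprim F s]. *)
Lemma intensity_par y s : intensity (par y s) = (pi * prim (distr_fun FF) s)%:E.
Proof.
have mp := measurable_par y s.
rewrite intensityE// integral_positive//; last exact: measurable_fun_ysection.
have [s0|s0] := leP s 0.
  rewrite (_ : prim _ s = 0); last first.
    by have [/prim_neg|] := ltP s 0 => // s0'; rewrite (_ : s = 0) ?prim0//; apply/le_anti/andP.
  rewrite mulr0; apply: integral0_eq => h; rewrite /= in_itv/= andbT => h0.
  rewrite [X in nu2 X](_ : _ = set0) ?measure0// -subset0 => x /ysectionP[_ /=].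
  rewrite /cost/=; have := sqr_ge0 (y.1 - x.1); have := sqr_ge0 (y.2 - x.2); lra.
have yE h : 0 < h -> nu2 (ysection (par y s) h) = nu2 [set x : mR * mR | cost x (y, h) <= s].
  move=> h0; congr (nu2 _); apply/seteqP; split => x.
      by move=> /ysectionP[_ /=]; rewrite cost_sym.
  by move=> /= xs; apply/ysectionP; split => //=; rewrite cost_sym.
transitivity (\int[FF]_(h in `]0%R, s]) (pi * (s - h))%:E)%E.
  rewrite integral_mkcond [RHS]integral_mkcond; apply: eq_integral => h _.
  rewrite !patchE; case: ifPn; rewrite ?inE ?notin_setE/= !in_itv/= ?andbT => h0.
    rewrite yE//; case: ifPn; rewrite ?inE ?notin_setE/= in_itv/= h0/=.
      by move=> hs; rewrite nu2_disc.
    by move=> /negP; rewrite -ltNge => /ltW sh; rewrite nu2_disc0.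
  by case: ifPn => //; rewrite inE/= in_itv/= => /andP[].
have rs : regular (fun h => s - h).
  by apply: (@regularB _ (cst s) idfun); [exact: regular_cst|exact: regular_nondecreasing].
have rps : regular (fun h => pi * (s - h)) by exact: (regularM (regular_cst pi) rs).
rewrite -(stieltjes_id lfF (ltW s0)) -RintegralZl//; last exact: (stieltjes_integrable lfF s rs (lexx 0)).
rewrite /Rintegral fineK//.
exact: (integrable_fin_num _ (stieltjes_integrable lfF s rps (lexx 0))).
Qed.

End intensity.

(** * Poisson processes *)

Section poisson_events.
Context (R : realType) d d' (Omega : measurableType d) (T : measurableType d').
Variables (P : probability Omega R) (Lam : {measure set T -> \bar R}).
Variable eta : Omega -> set T.
Hypothesis hP : poisson_process P Lam eta.
Implicit Types B C : set T.

Definition hit B : set Omega := [set w | exists2 p, eta w p & B p].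

Lemma npoints_eq0 B : npoints R eta B @^-1` [set 0%:R%:E] = ~` hit B.
Proof.
apply/seteqP; split => w /=; rewrite /npoints.
  move=> H [p ep Bp]; move: H; rewrite /counting; case: asboolP => // fin [].
  move/eqP; rewrite pnatr_eq0 finmap.cardfs_eq0 => /eqP f0.
  have e0 : eta w `&` B = set0 by rewrite -(fset_setK fin) f0 set_fset0.
  by have : (eta w `&` B) p by []; rewrite e0.
move=> nh; rewrite (_ : eta w `&` B = set0) ?measure0//.
by rewrite -subset0 => p [ep Bp]; apply: nh; exists p.
Qed.

Lemma npoints_neq0 B : npoints R eta B @^-1` (~` [set 0%:R%:E]) = hit B.
Proof. by rewrite -preimage_setC npoints_eq0 setCK. Qed.

Lemma measurable_hit B : measurable B -> measurable (hit B).
Proof.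
case: hP => mN _ _ _ mB; rewrite -npoints_neq0 -[X in measurable X]setTI.
by apply: mN => //; exact: measurableC.
Qed.

Lemma poisson_void B : measurable B -> (Lam B < +oo)%E ->
  P (~` hit B) = (expR (- fine (Lam B)))%:E.
Proof.
case: hP => _ pN _ _ mB LB; rewrite -npoints_eq0 pN// /poisson_prob.
have L0 : 0 <= fine (Lam B) by exact: fine_ge0.
case: ifPn => L0'.
  rewrite esum_set1 ?lee_fin ?poisson_pmf_ge0//.
  by rewrite /poisson_pmf L0' expr0 fact0 invr1 !mul1r.
have -> : fine (Lam B) = 0 by apply/eqP; rewrite eq_le L0 leNgt L0'.
by rewrite oppr0 expR0 diracE mem_set.
Qed.

Lemma poisson_hit B : measurable B -> (Lam B < +oo)%E ->
  P (hit B) = (1 - expR (- fine (Lam B)))%:E.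
Proof.
move=> mB LB; rewrite -[hit B]setCK probability_setC; last first.
  exact/measurableC/measurable_hit.
by rewrite poisson_void.
Qed.

Let ev B (b : bool) := if b then hit B else ~` hit B.

Let evE B b : ev B b =
  npoints R eta B @^-1` (if b then ~` [set 0%:R%:E] else [set 0%:R%:E]).
Proof. by case: b; rewrite /ev ?npoints_neq0 ?npoints_eq0. Qed.

Let indep m (B : 'I_m -> set T) (b : 'I_m -> bool) :
  (forall i, measurable (B i)) -> trivIset setT B ->
  P (\bigcap_i ev (B i) (b i)) = (\prod_(i < m) P (ev (B i) (b i)))%E.
Proof.
case: hP => _ _ _ ind mB tB.
under eq_bigr do rewrite evE; rewrite -ind//.
  by congr (P _); apply: eq_bigcapr => i _; rewrite evE.
by move=> i; case: (b i) => //; exact: measurableC.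
Qed.

Let indep2 B1 B2 b1 b2 : measurable B1 -> measurable B2 -> B1 `&` B2 = set0 ->
  P (ev B1 b1 `&` ev B2 b2) = (P (ev B1 b1) * P (ev B2 b2))%E.
Proof.
move=> m1 m2 B12.
have := @indep 2 (fun i => nth set0 [:: B1; B2] i) (fun i => nth true [:: b1; b2] i).
rewrite !big_ord_recl big_ord0 mule1/= => <-.
- congr (P _); apply/seteqP; split => w.
    by move=> [w1 w2] [[|[|//]] hi] _.
  by move=> h; split; [exact: (h ord0)|exact: (h (lift ord0 ord0))].
- by case=> [[|[|//]] hi].
- apply/trivIsetP => -[[|[|//]] hi] [[|[|//]] hj] _ _ //= _.
  by rewrite setIC.
Qed.

Lemma hit_void_indep B C : measurable B -> measurable C -> B `&` C = set0 ->
  P (hit B `&` ~` hit C) = (P (hit B) * P (~` hit C))%E.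
Proof. exact: (@indep2 B C true false). Qed.

Lemma hit_hit_indep B C : measurable B -> measurable C -> B `&` C = set0 ->
  P (hit B `&` hit C) = (P (hit B) * P (hit C))%E.
Proof. exact: (@indep2 B C true true). Qed.

Lemma hit_void_indep2 B1 C1 B2 C2 : measurable B1 -> measurable C1 ->
  measurable B2 -> measurable C2 -> B1 `&` C1 = set0 -> B2 `&` C2 = set0 ->
  (B1 `|` C1) `&` (B2 `|` C2) = set0 ->
  P ((hit B1 `&` ~` hit C1) `&` (hit B2 `&` ~` hit C2)) =
  (P (hit B1 `&` ~` hit C1) * P (hit B2 `&` ~` hit C2))%E.
Proof.
move=> mB1 mC1 mB2 mC2 BC1 BC2 BC.
rewrite !hit_void_indep//.
have := @indep 4 (fun i => nth set0 [:: B1; C1; B2; C2] i)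
  (fun i => nth true [:: true; false; true; false] i).
rewrite !big_ord_recl big_ord0 mule1/= => H.
rewrite -[RHS]muleA -H.
- congr (P _); apply/seteqP; split => w.
    by move=> [[w1 w2] [w3 w4]] [[|[|[|[|//]]]] hi] _.
  move=> h; split; split; [exact: (h ord0)|exact: (h (lift ord0 ord0))|
    exact: (h (lift ord0 (lift ord0 ord0)))|
    exact: (h (lift ord0 (lift ord0 (lift ord0 ord0))))].
- by case=> [[|[|[|[|//]]]] hi].
- move: BC; rewrite setIUl !setIUr => BC.
  have dis X Y : X `&` Y `<=` (B1 `&` B2) `|` (B1 `&` C2) `|` ((C1 `&` B2) `|` (C1 `&` C2)) ->
    X `&` Y = set0 by rewrite BC subset0.
  have d1 : B1 `&` B2 = set0 by apply: dis => p; left; left.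
  have d2 : B1 `&` C2 = set0 by apply: dis => p; left; right.
  have d3 : C1 `&` B2 = set0 by apply: dis => p; right; left.
  have d4 : C1 `&` C2 = set0 by apply: dis => p; right; right.
  apply/trivIsetP => -[[|[|[|[|//]]]] hi] [[|[|[|[|//]]]] hj] _ _ //= _; rewrite //;
    by rewrite setIC.
Qed.

End poisson_events.

(** * The point of least cost *)

Section nearest.
Variable R : realType.
Implicit Types (y : R * R) (e D : set (R * R * R)).

(** That y lies in the Laguerre cell of some point of D. Ties are allowed: points outside D may have
    the same cost. *)
Definition nearest y D e := exists p, [/\ e p, D p & forall q, e q -> cost y p <= cost y q].

Definition level (m j : nat) : R := j%:R / 2 ^+ m.

Definition shell y m j : set (R * R * R) :=
  par y (level m j.+1) `\` par y (level m j).

Lemma finite_argmin (T : eqType) (X : set T) (f : T -> R) : finite_set X ->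
  X !=set0 -> exists2 p, X p & forall q, X q -> f p <= f q.
Proof.
move=> /finite_seqP[s ->]; elim: s => [[p]//|a s IH] _.
have [s0|] := eqVneq s [::].
  by exists a => [|q]; rewrite s0 /= inE// => /eqP ->.
case: s IH => // b s IH _.
have [|p ps pmin] := IH; first by exists b; rewrite /= inE eqxx.
have [ap|pa] := leP (f a) (f p).
  exists a => [|q]; first by rewrite /= inE eqxx.
  by rewrite /= inE => /predU1P[->//|qs]; exact: le_trans (pmin _ qs).
exists p => [|q]; first by rewrite /= inE ps orbT.
by rewrite /= inE => /predU1P[->|qs]; [exact: ltW|exact: pmin].
Qed.

Lemma level_half m j : level m.+1 j.*2 = level m j.
Proof.
rewrite /level exprS -muln2 natrM; field.
by rewrite expf_neq0//= ?pnatr_eq0.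
Qed.

Lemma level_le m i j : (i <= j)%N -> level m i <= level m j.
Proof. by move=> ij; rewrite /level ler_wpM2r ?invr_ge0 ?exprn_ge0// ler_nat. Qed.

Lemma level_lt m i j : level m i < level m j -> (i < j)%N.
Proof. by move=> h; rewrite ltnNge; apply/negP => /(level_le m); rewrite leNgt h. Qed.

Lemma levelS m j : level m j.+1 = level m j + 2 ^- m.
Proof. by rewrite /level -addn1 natrD mulrDl mul1r. Qed.

Lemma level_exists m (x : R) : 0 < x -> exists j, level m j < x <= level m j.+1.
Proof.
move=> x0; have p0 : 0 < 2 ^+ m :> R by rewrite exprn_gt0.
have ex : exists j, x <= level m j.
  exists (Num.truncn (x * 2 ^+ m)).+1; rewrite /level ler_pdivlMr//.
  exact/ltW/truncnS_gt.
case: (ex_minnP ex) => -[|j]; first by rewrite /level mul0r leNgt x0.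
move=> xj jmin; exists j; rewrite xj andbT ltNge; apply/negP => /jmin.
by rewrite ltnn.
Qed.

Lemma shellP y m j p : shell y m j p <->
  0 < p.2 /\ level m j < cost y p <= level m j.+1.
Proof.
rewrite /shell /par /=; split => [[[p0 ->] h]|[p0 /andP[h ->]]]; split => //.
  by rewrite andbT ltNge; apply/negP => pj; exact: h.
by move=> [_]; rewrite leNgt h.
Qed.

Lemma shell_eq y m i j p : shell y m i p -> shell y m j p -> i = j.
Proof.
move=> /shellP[_ /andP[i1 i2]] /shellP[_ /andP[j1 j2]]; apply/eqP.
rewrite eqn_leq; apply/andP; split; rewrite -ltnS; apply: (@level_lt m).
  exact: lt_le_trans i1 j2.
exact: lt_le_trans j1 i2.
Qed.

Section configurations.
Variable e : set (R * R * R).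
Hypothesis he : configuration e.

Lemma cost_ge_weight y p : p.2 <= cost y p.
Proof. by rewrite /cost lerDr addr_ge0 ?sqr_ge0. Qed.

Lemma finite_par y s : finite_set (e `&` [set p | cost y p <= s]).
Proof.
have [e0 efin] := he.
pose M := `|y.1| + `|y.2| + 1 + `|s|.
pose B : set (R * R * R) := [set p | 0 < p.2 /\ cost y p <= s].
apply: (@sub_finite_set _ _ (e `&` B)).
  by move=> p [ep ps]; split => //; split => //; exact: e0.
apply: efin; exists M; split; first exact: num_real.
move=> N MN p [/= h0 cs0]; rewrite !prod_normE/= !ge_max.
have cs : (y.1 - p.1.1) ^+ 2 + (y.2 - p.1.2) ^+ 2 + p.2 <= s := cs0.
move: (p.1.1 : R) (p.1.2 : R) (p.2 : R) h0 cs => x1 x2 h h0 cs {cs0}.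
have s1 := sqr_ge0 (y.1 - x1); have s2 := sqr_ge0 (y.2 - x2).
have ss := ler_norm s.
have sq a b : (a - b) ^+ 2 <= `|s| -> `|b| <= `|a| + 1 + `|s|.
  move=> h2; have ab : `|b| <= `|a| + `|a - b|.
    by rewrite -{1}(subKr a b); exact: ler_normB.
  have : `|a - b| <= 1 + `|s|.
    rewrite -(ler_pXn2r (n := 2)) ?nnegrE// ?addr_ge0// real_normK ?num_real//.
    apply: (le_trans h2); rewrite sqrrD expr1n mul1r mulr2n.
    have := sqr_ge0 `|s|; have := normr_ge0 s; lra.
  lra.
have a1 : `|x1| <= `|y.1| + 1 + `|s| by apply: sq; lra.
have a2 : `|x2| <= `|y.2| + 1 + `|s| by apply: sq; lra.
have h1 : `|h| <= `|s| by rewrite (ger0_norm (ltW h0)); lra.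
have n1 := normr_ge0 y.1; have n2 := normr_ge0 y.2.
have n3 := normr_ge0 s.
move: MN; rewrite /M => MN.
by apply/andP; split; [apply/andP; split|]; lra.
Qed.

Lemma exists_nearest y : e !=set0 -> exists2 p, e p & forall q, e q -> cost y p <= cost y q.
Proof.
move=> [p0 ep0].
have [|p [ep pp0] pmin] := @finite_argmin _ _ (cost y) (finite_par y (cost y p0)).
  by exists p0; split => /=.
exists p => // q eq; have [qp0|/ltW p0q] := leP (cost y q) (cost y p0).
  exact: pmin.
exact: le_trans p0q.
Qed.

Definition hits (B : set (R * R * R)) := exists2 p, e p & B p.

(** Expresses a minimum through countably many events that a set is hit or empty. For the converse,
    precision m provides a point of D whose cost is within 2^-m of the minimum over e; only finitely
    many points of D come within 1 of that minimum, so the cheapest of them attains it. *)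
Lemma nearestP y D : nearest y D e <->
  forall m, exists j, hits (D `&` shell y m j) /\ ~ hits (par y (level m j)).
Proof.
have [e0 efin] := he.
split.
  move=> [p [ep Dp pmin]] m.
  have p0 : 0 < cost y p by apply: lt_le_trans (cost_ge_weight y p); exact: e0.
  have [j pj] := level_exists m p0; exists j; split.
    by exists p => //; split => //; apply/shellP; split => //; exact: e0.
  move=> [q eq [_ qj]]; have := pmin _ eq; have /andP[+ _] := pj.
  by move=> h1 h2; have := lt_le_trans h1 (le_trans h2 qj); rewrite ltxx.
move=> H.
have [j0 [[p0 ep0 _] _]] := H 0%N.
have [q eq qmin] := exists_nearest y (ex_intro _ p0 ep0 : e !=set0).
have step m : exists2 p, (e `&` D) p & cost y p <= cost y q + 2 ^- m.
  have [j [[p ep [Dp /shellP[_ /andP[pj1 pj2]]]] nj]] := H m.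
  exists p => //; apply: (le_trans pj2); rewrite levelS lerD2r.
  rewrite leNgt; apply/negP => qj; apply: nj; exists q => //; split; first exact: e0.
  exact: ltW.
have fin : finite_set (e `&` D `&` [set p | cost y p <= cost y q + 1]).
  apply: sub_finite_set (finite_par y (cost y q + 1)).
  by move=> p [[ep _] pp]; split.
have [|p [[ep Dp] pq] pmin] := finite_argmin (cost y) fin.
  have [p eDp pq] := step 0%N; exists p; split => //=.
  by move: pq; rewrite expr0 invr1.
exists p; split => // r er; apply: le_trans (qmin _ er).
rewrite leNgt; apply/negP => qp.
pose dl := cost y p - cost y q; have dl0 : 0 < dl by rewrite subr_gt0.
have [m dm] : exists m, 2 ^- m < dl.
  exists (Num.truncn dl^-1); rewrite -[ltRHS]invrK ltf_pV2 ?posrE ?invr_gt0 ?exprn_gt0//.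
  apply: (@lt_le_trans _ _ (Num.truncn dl^-1).+1%:R); first exact: truncnS_gt.
  by rewrite -natrX ler_nat; exact: ltn_expl.
have [s [es Ds] sq] := step m.
have s1 : cost y s <= cost y q + 1.
  by apply: (le_trans sq); rewrite lerD2l invf_le1 ?exprn_gt0// exprn_ege1// ler1n.
have := pmin s (conj (conj es Ds) s1); move: sq dm; rewrite /dl.
by move: (cost y p) (cost y q) (cost y s) (2 ^- m) => *; lra.
Qed.

End configurations.

(** Dyadic levels are nested: the fine shell j lies in the coarse shell j./2, whose lower paraboloid
    is contained in the fine one. *)
Lemma appr_nonincr e y D m :
  (exists j, hits e (D `&` shell y m.+1 j) /\ ~ hits e (par y (level m.+1 j))) ->
  exists j, hits e (D `&` shell y m j) /\ ~ hits e (par y (level m j)).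
Proof.
move=> [j [[p ep [Dp /shellP[p0 /andP[pj1 pj2]]]] nj]].
have jE : (j = odd j + (j./2).*2)%N by rewrite odd_double_half.
exists j./2; split.
  exists p => //; split => //; apply/shellP; split => //; apply/andP; split.
    apply: le_lt_trans pj1; rewrite -(level_half m); apply: level_le.
    by rewrite [leqRHS]jE leq_addl.
  apply: (le_trans pj2); rewrite -(level_half m); apply: level_le.
  by rewrite [in leqLHS]jE doubleS ltnS -add1n leq_add2r; case: (odd j).
move=> [q eq [q0 qj]]; apply: nj; exists q => //; split => //.
apply: (le_trans qj); rewrite -(level_half m); apply: level_le.
by rewrite [leqRHS]jE leq_addl.
Qed.

End nearest.

(** * Probability and independence of nearest-point events *)

Section nearest_probability.
Context (R : realType) d (Omega : measurableType d).
Notation mR := (measurableTypeR R).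
Variables (P : probability Omega R) (FF : {sigma_finite_measure set mR -> \bar R}).
Variable eta : Omega -> set (R * R * R).
Hypothesis lfF : locally_finite_pos FF.
Hypothesis conf : forall w, configuration (eta w).
Hypothesis hP : poisson_process P (intensity FF) eta.
Notation Lam := (intensity FF).
Notation F := (distr_fun FF).
Notation ev := (hit eta).
Implicit Types (D : set (mR * mR * mR)) (y : R * R).

Let F_nd := distr_fun_nd lfF.
Let F_ge0 := distr_fun_ge0 FF.
Let rF : regular F := regular_nondecreasing F_nd.

Lemma measurable_shell y m j : measurable (shell y m j : set (mR * mR * mR)).
Proof. by apply: measurableD; exact: measurable_par. Qed.

Let cell_ev y D m j := ev (D `&` shell y m j) `&` ~` ev (par y (level R m j)).

(* [appr y D m]: up to precision [2 ^- m] the least cost seen from [y] is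
   attained in [D]; these events decrease to [nearest_ev y D]. *)
Let appr y D m := \bigcup_j cell_ev y D m j.

Definition nearest_ev y D : set Omega := [set w | nearest y D (eta w)].

Let nearest_evE y D : nearest_ev y D = \bigcap_m appr y D m.
Proof.
apply/seteqP; split => w.
  by move=> /(nearestP (conf w)) H m _; have [j Hj] := H m; exists j.
by move=> H; apply/(nearestP (conf w)) => m; have [j _ Hj] := H m I; exists j.
Qed.

Let measurable_cell_ev y D m j : measurable D -> measurable (cell_ev y D m j).
Proof.
move=> mD; apply: measurableI.
  by apply: (measurable_hit hP); apply: measurableI => //; exact: measurable_shell.
by apply: measurableC; apply: (measurable_hit hP); exact: measurable_par.
Qed.

Let measurable_appr y D m : measurable D -> measurable (appr y D m).
Proof. by move=> mD; apply: bigcup_measurable => j _; exact: measurable_cell_ev. Qed.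

Lemma measurable_nearest_ev y D : measurable D -> measurable (nearest_ev y D).
Proof.
move=> mD; rewrite nearest_evE; apply: bigcap_measurable => // m _.
exact: measurable_appr.
Qed.

Let appr_ni y D : {homo appr y D : n m / (n <= m)%N >-> (m <= n)%O}.
Proof.
apply/nonincreasing_seqP => n; apply/subsetPset => w [j _ Hj].
have [i Hi] := @appr_nonincr R (eta w) y D n (ex_intro _ j Hj).
by exists i.
Qed.

Let level_ge0 m j : 0 <= level R m j.
Proof. by rewrite /level divr_ge0// exprn_ge0. Qed.

Let disj_shell_par y D m j : (D `&` shell y m j) `&` par y (level R m j) = set0.
Proof. by rewrite -subset0 => p [[_ [_ h]] /h]. Qed.

Let par_le y s t : s <= t -> par y s `<=` par y t.
Proof. by move=> st p [p0 ps]; split => //; exact: le_trans st. Qed.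

Let par_lty y t : (Lam (par y t) < +oo)%E.
Proof. by rewrite intensity_par// ltry. Qed.

Let intensity_shell_lty y D m j : measurable D -> (Lam (D `&` shell y m j) < +oo)%E.
Proof.
move=> mD; apply: (@le_lt_trans _ _ (Lam (par y (level R m j.+1)))).
  apply: le_measure; rewrite ?inE//; last by move=> p [_ []].
  - by apply: measurableI => //; exact: measurable_shell.
  - exact: measurable_par.
exact: par_lty.
Qed.

Let intensity_shell_le y D m j : measurable D ->
  fine (Lam (D `&` shell y m j)) <=
  pi * (prim F (level R m j.+1) - prim F (level R m j)).
Proof.
move=> mD; rewrite -lee_fin fineK; last first.
  by rewrite ge0_fin_numE// intensity_shell_lty.
apply: (@le_trans _ _ (Lam (shell y m j))).
  apply: le_measure; rewrite ?inE//; last exact: measurable_shell.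
  by apply: measurableI => //; exact: measurable_shell.
have mp := measurable_par y.
rewrite /shell (measureD (mp _) (mp _) (par_lty _ _)).
rewrite setIidr; last by apply: par_le; exact: level_le.
have h1 := intensity_par lfF y (level R m j.+1).
have h2 := intensity_par lfF y (level R m j).
by rewrite mulrBr EFinB -h1 -h2.
Qed.

Let shell_integral y D m j :=
  (\int[Lam]_(p in D `&` shell y m j) (exprim F (cost y p))%:E)%E.

Let measurable_decay y : measurable_fun setT (fun p : mR * mR * mR => (exprim F (cost y p))%:E).
Proof.
apply/measurable_EFinP; apply: (measurableT_comp _ (measurable_cost2 y)).
by have [] : regular (exprim F) by exact: regular_exprim.
Qed.

Let cell_ev_prob y D m j : measurable D -> P (cell_ev y D m j) =
  ((1 - expR (- fine (Lam (D `&` shell y m j)))) * exprim F (level R m j))%:E.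
Proof.
move=> mD.
have ms : measurable (D `&` shell y m j).
  by apply: measurableI => //; exact: measurable_shell.
have mp := measurable_par y (level R m j).
rewrite (hit_void_indep hP)// (poisson_hit hP)//; last exact: intensity_shell_lty.
rewrite (poisson_void hP mp (par_lty _ _)).
by have /= -> := intensity_par lfF y (level R m j); rewrite -EFinM exprimE mulNr.
Qed.

Let shell_integral_bounds y D m j : measurable D ->
  exists r, [/\ shell_integral y D m j = r%:E,
    fine (Lam (D `&` shell y m j)) * exprim F (level R m j.+1) <= r &
    r <= fine (Lam (D `&` shell y m j)) * exprim F (level R m j)].
Proof.
move=> mD.
have ms : measurable (D `&` shell y m j).
  by apply: measurableI => //; exact: measurable_shell.
have L0 : Lam (D `&` shell y m j) \is a fin_num.
  by rewrite ge0_fin_numE// intensity_shell_lty.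
have up : (shell_integral y D m j <=
    (fine (Lam (D `&` shell y m j)) * exprim F (level R m j))%:E)%E.
  rewrite EFinM fineK// muleC -integral_cst//; apply: ge0_le_integral => //.
  - by move=> p _; rewrite lee_fin exprim_ge0.
  - exact: measurable_funTS (measurable_decay y).
  - move=> p [_ /shellP[_ /andP[pj _]]]; rewrite lee_fin.
    by apply: exprim_ni => //; exact: ltW.
have lo : ((fine (Lam (D `&` shell y m j)) * exprim F (level R m j.+1))%:E <=
    shell_integral y D m j)%E.
  rewrite EFinM fineK// muleC -integral_cst//; apply: ge0_le_integral => //.
  - by move=> p _; rewrite lee_fin exprim_ge0.
  - exact: measurable_funTS (measurable_decay y).
  - move=> p [_ /shellP[_ /andP[_ pj]]]; rewrite lee_fin.
    exact: exprim_ni.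
move: up lo; case: (shell_integral y D m j) => [r||]//= up lo.
by exists r; rewrite -!lee_fin.
Qed.

(** With a the mean number of points of D in the shell, the event has probability (1 - exp(-a)) e at
    the lower level. Here a exp(-a) <= 1 - exp(-a) <= a with a <= ep, and e changes across the shell
    by a factor at most exp(ep). *)
Let shell_estimate y D m j ep : measurable D ->
  pi * (prim F (level R m j.+1) - prim F (level R m j)) <= ep ->
  ((expR (- ep))%:E * shell_integral y D m j <= P (cell_ev y D m j))%E /\
  (P (cell_ev y D m j) <= (expR ep)%:E * shell_integral y D m j)%E.
Proof.
move=> mD Hep; have [r [-> lo up]] := shell_integral_bounds y m j mD.
rewrite cell_ev_prob// -!EFinM !lee_fin.
have a0 : 0 <= fine (Lam (D `&` shell y m j)) by exact: fine_ge0.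
have aep := le_trans (intensity_shell_le y m j mD) Hep.
have e1 : exprim F (level R m j) <= expR ep * exprim F (level R m j.+1).
  by rewrite !exprimE -expRD ler_expR; move: Hep; rewrite mulrBr !mulNr; lra.
move: (fine _) (exprim F (level R m j)) (exprim F (level R m j.+1))
  (exprim_ge0 F (level R m j)) a0 aep e1 lo up => a x x' x0 a0 aep e1 lo up.
have ea := expR_ge1Dx (- a).
have E0 := expR_ge0 ep.
split.
  apply: (@le_trans _ _ (expR (- ep) * (a * x))); first by rewrite ler_wpM2l ?expR_ge0.
  rewrite mulrA ler_wpM2r//.
  apply: (@le_trans _ _ (expR (- a) * a)).
    by rewrite ler_wpM2r// ler_expR lerN2.
  have h : expR (- a) * expR a = 1 by rewrite -expRD addNr expR0.
  have := expR_ge1Dx a; move=> h2.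
  have : expR (- a) * (1 + a) <= expR (- a) * expR a by rewrite ler_wpM2l// expR_ge0.
  by rewrite h mulrDr mulr1; lra.
apply: (@le_trans _ _ (a * x)); first by rewrite ler_wpM2r//; lra.
apply: (@le_trans _ _ (a * (expR ep * x'))); first by rewrite ler_wpM2l.
by rewrite mulrCA ler_wpM2l.
Qed.

Let trivIset_cell y D m : trivIset setT (cell_ev y D m).
Proof.
apply/trivIsetP => i j _ _; wlog ij : i j / (i < j)%N.
  move=> H; rewrite neq_ltn => /orP[/[dup] ij|/[dup] ji].
    by move/H; apply; rewrite neq_ltn ij.
  by move/H; rewrite setIC; apply; rewrite neq_ltn ji.
move=> _; rewrite -subset0 => w [[[p ep [Dp [[p0 pi'] _]]] _] [_ nj]].
apply: nj; exists p => //; split => //; apply: (le_trans pi').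
exact: level_le.
Qed.

Let trivIset_shell y D m : trivIset setT (fun j => D `&` shell y m j).
Proof.
apply/trivIsetP => i j _ _ ij; rewrite -subset0 => p [[_ pi'] [_ pj]].
by move: ij; rewrite (shell_eq pi' pj) eqxx.
Qed.

Let bigcup_shell y D m : (forall p, D p -> 0 < p.2) ->
  \bigcup_j (D `&` shell y m j) = D.
Proof.
move=> D0; apply/seteqP; split => p; first by move=> [j _ []].
move=> Dp; have p0 : 0 < cost y p.
  exact: lt_le_trans (D0 _ Dp) (cost_ge_weight y p).
have [j pj] := level_exists m p0; exists j => //; split => //.
by apply/shellP; split => //; exact: D0.
Qed.

(** Sum of [shell_estimate] over the shells, the events of distinct shells being disjoint.
    Boundedness of D makes the error the same for all shells, and the factors exp(- ep m) and exp(ep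
    m) tend to 1. *)
Let nearest_prob_bounded y D S : measurable D -> 0 <= S -> D `<=` par y S ->
  P (nearest_ev y D) = (\int[Lam]_(p in D) (exprim F (cost y p))%:E)%E.
Proof.
move=> mD S0 DS.
have ms m j : measurable (D `&` shell y m j).
  by apply: measurableI => //; exact: measurable_shell.
set I0 := (\int[Lam]_(p in D) _)%E.
have I00 : (0 <= I0)%E by apply: integral_ge0 => p _; rewrite lee_fin exprim_ge0.
have ppi := pi_ge0 R.
(* Only shells with lower level below S meet D. They have width 2^-m <= 1, so F is at most F (S + 1)
   on them. *)
pose ep m := pi * (F (S + 1) * 2 ^- m).
have IE m : I0 = (\sum_(0 <= j <oo) shell_integral y D m j)%E.
  rewrite /I0 -{1}(@bigcup_shell y D m); last by move=> p /DS[].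
  rewrite ge0_integral_bigcup//.
  - exact: measurable_funTS (measurable_decay y).
  - by move=> p _; rewrite lee_fin exprim_ge0.
have PE m : P (appr y D m) = (\sum_(0 <= j <oo) P (cell_ev y D m j))%E.
  rewrite /appr measure_bigcup//; last by move=> j _; exact: measurable_cell_ev.
  by apply: eq_eseriesl => j; exact: mem_set.
have I0j m j : (0 <= shell_integral y D m j)%E.
  by apply: integral_ge0 => p _; rewrite lee_fin exprim_ge0.
have est m j : ((expR (- ep m))%:E * shell_integral y D m j <= P (cell_ev y D m j))%E /\
    (P (cell_ev y D m j) <= (expR (ep m))%:E * shell_integral y D m j)%E.
  have [jS|Sj] := ltP (level R m j) S.
    apply: shell_estimate => //; rewrite /ep ler_wpM2l//.
    have -> : 2 ^- m = level R m j.+1 - level R m j by rewrite levelS addrAC subrr add0r.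
    apply: prim_ub => //; first exact: level_le.
    move=> x _ xj; apply: F_nd; apply: (le_trans xj); rewrite levelS.
    by apply: lerD; [exact: ltW|rewrite invf_le1 ?exprn_gt0// exprn_ege1// ler1n].
  have e0 : D `&` shell y m j = set0.
    rewrite -subset0 => p [/DS[_ pS] /shellP[_ /andP[pj _]]].
    by have := lt_le_trans pj (le_trans pS Sj); rewrite ltxx.
  rewrite /shell_integral /cell_ev e0 integral_set0 !mule0; split => //.
  by rewrite (_ : _ `&` _ = set0) ?measure0// -subset0 => w [[]].
have lo m : ((expR (- ep m))%:E * I0 <= P (appr y D m))%E.
  rewrite (IE m) PE -nneseriesZl//; apply: lee_nneseries.
    by move=> j _ _; rewrite mule_ge0// lee_fin expR_ge0.
  by move=> j _; have [] := est m j.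
have up m : (P (appr y D m) <= (expR (ep m))%:E * I0)%E.
  rewrite (IE m) PE -nneseriesZl//; apply: lee_nneseries => //.
  by move=> j _; have [] := est m j.
have epcvg : ep m @[m --> \oo] --> 0.
  rewrite -[X in _ --> X](mulr0 pi); apply: cvgMr.
  rewrite -[X in _ --> X](mulr0 (F (S + 1))); apply: cvgMr.
  have := @cvg_geometric R 1 2^-1; rewrite ger0_norm// invf_lt1// ltr1n => /(_ isT).
  by rewrite /geometric/=; under eq_fun do rewrite mul1r exprVn.
have fin0 : I0 \is a fin_num.
  rewrite ge0_fin_numE//; have := lo 0%N.
  have e0 := expR_gt0 (- ep 0%N).
  case: I0 I00 {IE lo up} => [r||]//= _; first by rewrite ltry.
  rewrite gt0_muley ?lte_fin// => /le_trans/(_ (probability_le1 P (measurable_appr y 0 mD))).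
  by rewrite leye_eq.
have cI (s : R -> R) : (s x @[x --> 0] --> s 0) -> s 0 = 0 ->
    ((expR (s (ep m)))%:E * I0)%E @[m --> \oo] --> I0.
  move=> cs s0; rewrite -[X in _ --> X]mul1e; apply: cvgeM.
  - by rewrite mule_def_fin.
  - apply: cvg_EFin; first exact: nearW.
    rewrite -expR0 -s0; apply: continuous_cvg; first exact: continuous_expR.
    by apply: (cvg_comp _ _ epcvg); exact: cs.
  - exact: cvg_cst.
have cP : P (appr y D m) @[m --> \oo] --> P (nearest_ev y D).
  rewrite nearest_evE; apply: nonincreasing_cvg_mu => //.
  - by apply: (@le_lt_trans _ _ 1%E); [apply: probability_le1; exact: measurable_appr|exact: ltry].
  - by move=> m; exact: measurable_appr.
  - by apply: bigcap_measurable => // m _; exact: measurable_appr.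
have cI0 : P (appr y D m) @[m --> \oo] --> I0.
  apply: (squeeze_cvge (f := fun m => ((expR (- ep m))%:E * I0)%E)
    (h := fun m => ((expR (ep m))%:E * I0)%E)).
  - by apply: nearW => m; rewrite lo up.
  - by apply: (cI (fun x => - x)); [apply: cvgN; exact: cvg_id|rewrite oppr0].
  - by apply: (cI idfun) => //; exact: cvg_id.
exact: (cvg_unique _ cP cI0).
Qed.

Lemma nearest_prob y D : measurable D -> (forall p, D p -> 0 < p.2) ->
  P (nearest_ev y D) = (\int[Lam]_(p in D) (exprim F (cost y p))%:E)%E.
Proof.
move=> mD D0; pose DN (n : nat) := D `&` par y n%:R.
have mDN n : measurable (DN n) by apply: measurableI => //; exact: measurable_par.
have DU : D = \bigcup_n DN n.
  apply/seteqP; split => p; last by move=> [n _ []].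
  move=> Dp; exists (Num.truncn (cost y p)).+1 => //; split => //; split; first exact: D0.
  exact/ltW/truncnS_gt.
have DNnd n m : (n <= m)%N -> DN n `<=` DN m.
  by move=> nm p [Dp pn]; split => //; apply: par_le pn; rewrite ler_nat.
have EU : nearest_ev y D = \bigcup_n nearest_ev y (DN n).
  apply/seteqP; split => w.
    move=> [p [ep Dp pmin]]; move: (Dp); rewrite {1}DU => -[n _ Dnp].
    by exists n => //; exists p.
  by move=> [n _ [p [ep [Dp _] pmin]]]; exists p.
have c1 : P (nearest_ev y (DN n)) @[n --> \oo] --> P (nearest_ev y D).
  rewrite EU; apply: nondecreasing_cvg_mu.
  - by move=> n; exact: measurable_nearest_ev.
  - by apply: bigcup_measurable => n _; exact: measurable_nearest_ev.
  - move=> n m nm; apply/subsetPset => w [p [ep Dp pmin]].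
    by exists p; split => //; exact: DNnd Dp.
apply: (cvg_unique _ c1) => //.
rewrite (_ : (fun n => _) = fun n => (\int[Lam]_(p in DN n) (exprim F (cost y p))%:E)%E); last first.
  by apply/funext => n; apply: (@nearest_prob_bounded _ (DN n) n%:R) => // p [].
have c : (\int[Lam]_(p in DN n) (exprim F (cost y p))%:E)%E @[n --> \oo] -->
    (\int[Lam]_(p in \bigcup_n DN n) (exprim F (cost y p))%:E)%E.
  apply: ge0_nondecreasing_set_cvg_integral => //.
  - by move=> n m nm; apply/subsetPset; exact: DNnd.
  - by move=> n; exact: measurable_funTS (measurable_decay y).
  - by move=> n p _; rewrite lee_fin exprim_ge0.
by move: c; rewrite -DU.
Qed.

(** At each precision both events are disjoint unions of hit-and-empty events. A shell starting at
    level s or higher does not meet D; for the other shells all sets involved lie inside par y s,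
    and likewise at y'. Factorisation is inherited by the limit over m. *)
Lemma nearest_indep y y' D D' s s' : measurable D -> measurable D' ->
  D `<=` par y s -> D' `<=` par y' s' -> par y s `&` par y' s' = set0 ->
  P (nearest_ev y D `&` nearest_ev y' D') =
  (P (nearest_ev y D) * P (nearest_ev y' D'))%E.
Proof.
move=> mD mD' Ds Ds' dis.
have ms z (E : set (mR * mR * mR)) m j : measurable E -> measurable (E `&` shell z m j).
  by move=> mE; apply: measurableI => //; exact: measurable_shell.
have cellI m i j : P (cell_ev y D m i `&` cell_ev y' D' m j) =
    (P (cell_ev y D m i) * P (cell_ev y' D' m j))%E.
  have small z E t k : E `<=` par z t -> t <= level R m k -> cell_ev z E m k = set0.
    move=> Et tk; rewrite -subset0 => w [[p ep [/Et[_ pt] /shellP[_ /andP[pk _]]]] _].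
    by have := lt_le_trans pk (le_trans pt tk); rewrite ltxx.
  have [si|is_] := leP s (level R m i).
    by rewrite (small y D s)// set0I measure0 mul0e.
  have [sj|js] := leP s' (level R m j).
    by rewrite (small y' D' s')// setI0 measure0 mule0.
  apply: (hit_void_indep2 hP); rewrite ?disj_shell_par//.
  - exact: ms.
  - exact: measurable_par.
  - exact: ms.
  - exact: measurable_par.
  - rewrite -subset0 -dis => p [h1 h2]; split.
      by case: h1 => [[/Ds]//|]; exact/par_le/ltW.
    by case: h2 => [[/Ds']//|]; exact/par_le/ltW.
have apprI m : P (appr y D m `&` appr y' D' m) = (P (appr y D m) * P (appr y' D' m))%E.
  have step (E : set Omega) : measurable E -> P (E `&` appr y' D' m) =
      (\sum_(0 <= j <oo) P (E `&` cell_ev y' D' m j))%E.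
    move=> mE; rewrite /appr setI_bigcupr measure_bigcup//.
    - by apply: eq_eseriesl => j; exact: mem_set.
    - by move=> j _; apply: measurableI => //; exact: measurable_cell_ev.
    - exact/trivIset_setIl/trivIset_cell.
  have PE z (E : set (mR * mR * mR)) : measurable E -> P (appr z E m) = (\sum_(0 <= j <oo) P (cell_ev z E m j))%E.
    move=> mE; rewrite /appr measure_bigcup//; last by move=> j _; exact: measurable_cell_ev.
    by apply: eq_eseriesl => j; exact: mem_set.
  rewrite (_ : appr y D m `&` _ = \bigcup_i (cell_ev y D m i `&` appr y' D' m)); last first.
    by rewrite -setI_bigcupl.
  rewrite measure_bigcup//.
  - transitivity (\sum_(0 <= i <oo) (P (cell_ev y D m i) * P (appr y' D' m)))%E.
      rewrite (eq_eseriesl (Q := xpredT)); last by move=> i; exact: mem_set.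
      apply: eq_eseriesr => i _; apply: (etrans (step _ _)); first exact: measurable_cell_ev.
      under eq_eseriesr do rewrite cellI.
      have fi : P (cell_ev y D m i) \is a fin_num.
        by apply: fin_num_measure; exact: measurable_cell_ev.
      by rewrite -{1}(fineK fi) nneseriesZl// fineK// PE.
    have fP : P (appr y' D' m) \is a fin_num.
      by apply: fin_num_measure; exact: measurable_appr.
    rewrite -{1}(fineK fP); under eq_eseriesr do rewrite muleC.
    by rewrite nneseriesZl// fineK// -PE// muleC.
  - by move=> i _; apply: measurableI; [exact: measurable_cell_ev|exact: measurable_appr].
  - exact/trivIset_setIr/trivIset_cell.
have cvgN z (E : set (mR * mR * mR)) : measurable E -> P (appr z E m) @[m --> \oo] --> P (nearest_ev z E).
  move=> mE; rewrite nearest_evE; apply: nonincreasing_cvg_mu => //.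
  - by apply: (@le_lt_trans _ _ 1%E); [apply: probability_le1; exact: measurable_appr|exact: ltry].
  - by move=> m; exact: measurable_appr.
  - by apply: bigcap_measurable => // m _; exact: measurable_appr.
have c1 : P (appr y D m `&` appr y' D' m) @[m --> \oo] -->
    P (nearest_ev y D `&` nearest_ev y' D').
  rewrite !nearest_evE -bigcapI; apply: nonincreasing_cvg_mu => //.
  - apply: (@le_lt_trans _ _ 1%E); last exact: ltry.
    by apply: probability_le1; apply: measurableI; exact: measurable_appr.
  - by move=> m; apply: measurableI; exact: measurable_appr.
  - by apply: bigcap_measurable => // m _; apply: measurableI; exact: measurable_appr.
  - move=> n m nm; apply/subsetPset; apply: setISS.
      apply/subsetPset; exact: appr_ni nm.
    apply/subsetPset; exact: appr_ni nm.
apply: (cvg_unique _ c1) => //.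
have c2 : (P (appr y D m) * P (appr y' D' m))%E @[m --> \oo] -->
    (P (nearest_ev y D) * P (nearest_ev y' D'))%E.
  apply: cvgeM; [|exact: cvgN..].
  by rewrite mule_def_fin// fin_num_measure//; exact: measurable_nearest_ev.
by move: c2; rewrite -(funext apprI).
Qed.

End nearest_probability.

(** * Borel sets of the plane and joint measurability *)

Section rational_boxes.
Variable R : realType.
Notation mR := (measurableTypeR R).

Lemma rat_near (x e : R) : 0 < e -> exists q : rat, `|x - ratr q| < e.
Proof.
move=> e0; have [q] := @rat_in_itvoo R (x - e) (x + e) ltac:(lra).
by rewrite in_itv/= => /andP[h1 h2]; exists q; rewrite ltr_distl; apply/andP; split; lra.
Qed.

Lemma inv_succ_lt (e : R) : 0 < e -> exists n : nat, n.+1%:R^-1 < e.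
Proof.
move=> e0; exists (Num.truncn e^-1); rewrite -[ltRHS]invrK ltf_pV2 ?posrE ?invr_gt0//.
exact: truncnS_gt.
Qed.

Definition box (i j : rat) (n : nat) : set (mR * mR) :=
  [set y : mR * mR | `|(y.1 : R) - ratr i| < n.+1%:R^-1 /\ `|(y.2 : R) - ratr j| < n.+1%:R^-1].

Lemma measurable_box i j n : measurable (box i j n).
Proof.
pose I (q : rat) := `](ratr q - n.+1%:R^-1 : R), ratr q + n.+1%:R^-1[%classic.
rewrite (_ : box i j n = I i `*` I j); first by apply: measurableX; exact: measurable_itv.
by apply/seteqP; split => y [h1 h2]; split; move: h1 h2; rewrite /I /= !in_itv/= !ltr_distl.
Qed.

(** An open set is the countable union of the rational boxes it contains. This brings the compact
    windows into the product sigma-algebra. *)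
Lemma measurable_open2 (U : set (R * R)) : open U -> measurable (U : set (mR * mR)).
Proof.
move=> oU; pose B i j n := if `[< box i j n `<=` U >] then box i j n else set0.
rewrite (_ : U = \bigcup_i \bigcup_j \bigcup_n B i j n).
  apply: bigcupT_measurable_rat => i; apply: bigcupT_measurable_rat => j.
  apply: bigcup_measurable => n _; rewrite /B; case: ifP => _ //.
  exact: measurable_box.
apply/seteqP; split => x; last first.
  by move=> [i _ [j _ [n _]]]; rewrite /B; case: asboolP => // h /h.
move=> Ux; have /nbhs_ballP[e /= e0 xe] := oU x Ux.
have e20 : 0 < e / 2 by rewrite divr_gt0.
have [n ne] := inv_succ_lt e20.
have n0 : 0 < n.+1%:R^-1 :> R by rewrite invr_gt0 ltr0n.
have [i xi] := rat_near x.1 n0; have [j xj] := rat_near x.2 n0.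
exists i => //; exists j => //; exists n => //; rewrite /B; case: asboolP => //; case.
have tri (a b q f : R) : f < e / 2 -> `|a - q| < f -> `|b - q| < f -> `|a - b| < e.
  move=> fe aq bq; apply: le_lt_trans (ler_distD q _ _) _.
  by rewrite (distrC q); lra.
move=> y [yi yj]; apply: xe; split; [exact: tri ne xi yi|exact: tri ne xj yj].
Qed.

Lemma measurable_compact2 (K : set (R * R)) : compact K -> measurable (K : set (mR * mR)).
Proof.
move=> cK; rewrite -[X in measurable X]setCK; apply: measurableC.
apply: measurable_open2; apply: closed_openC; apply: compact_closed cK.
exact: norm_hausdorff.
Qed.

End rational_boxes.

Section joint_measurability.
Context (R : realType) d (Omega : measurableType d).
Notation mR := (measurableTypeR R).
Variable eta : Omega -> set (R * R * R).
Hypothesis conf : forall w, configuration (eta w).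
Hypothesis mhit : forall B : set (mR * mR * mR), measurable B -> measurable (hit eta B).
Implicit Types D : set (mR * mR * mR).

Let close D (s : R) : set (Omega * (mR * mR)) :=
  [set z | exists p, [/\ eta z.1 p, D p & cost z.2 p < s]].

(** An upper bound for the cost of [p] valid for every location in the box, so that the condition on
    the configuration no longer involves the location. *)
Let ucost (i j : rat) (n : nat) (p : mR * mR * mR) : mR :=
  (`|ratr i - p.1.1| + n.+1%:R^-1) ^+ 2 + (`|ratr j - p.1.2| + n.+1%:R^-1) ^+ 2 + p.2.

Let measurable_ucost i j n : measurable_fun setT (ucost i j n).
Proof.
have m1 : measurable_fun setT (fun p : mR * mR * mR => p.1.1).
  exact: measurableT_comp (@measurable_fst _ _ mR mR) (@measurable_fst _ _ (mR * mR)%type mR).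
have m2 : measurable_fun setT (fun p : mR * mR * mR => p.1.2).
  exact: measurableT_comp (@measurable_snd _ _ mR mR) (@measurable_fst _ _ (mR * mR)%type mR).
have H (q : R) (f : mR * mR * mR -> mR) : measurable_fun setT f ->
    measurable_fun setT (fun p => (`|q - f p| + n.+1%:R^-1) ^+ 2 : mR).
  move=> mf; apply: measurable_funX; apply: measurable_funD => //.
  by apply: measurableT_comp; [exact: normr_measurable|exact: measurable_funB].
apply: measurable_funD; last exact: (@measurable_snd _ _ (mR * mR)%type mR).
by apply: measurable_funD; exact: H.
Qed.

Let box_cost i j n (y : mR * mR) p : box i j n y -> cost y p <= ucost i j n p.
Proof.
move=> [yi yj]; rewrite /cost /ucost lerD2r.
have sq (a q e b : R) : `|a - q| < e -> (a - b) ^+ 2 <= (`|q - b| + e) ^+ 2.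
  move=> h; rewrite -real_normK ?num_real// ler_pXn2r// ?nnegrE//.
    have := ler_distD q a b; lra.
  by rewrite addr_ge0// ltW// (le_lt_trans _ h).
by apply: lerD; apply: sq.
Qed.

(** The strict inequality persists on a small rational box around the location, so the set is a
    countable union of products of a hitting event and a box. *)
Let measurable_close D s : measurable D -> measurable (close D s).
Proof.
move=> mD; pose B i j n := D `&` [set p | ucost i j n p < s].
have mB i j n : measurable (B i j n).
  apply: measurableI => //.
  exact: (@measurable_strict_sublevel _ _ R (ucost i j n) s (@measurable_ucost i j n)).
rewrite (_ : close D s = \bigcup_i \bigcup_j \bigcup_n (hit eta (B i j n) `*` box i j n)).
  apply: bigcupT_measurable_rat => i; apply: bigcupT_measurable_rat => j.
  apply: bigcup_measurable => n _; apply: measurableX; first exact: mhit.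
  exact: measurable_box.
apply/seteqP; split => -[w y]; last first.
  move=> [i _ [j _ [n _ [[p ep [Dp ps]] hb]]]]; exists p; split => //=.
  exact: le_lt_trans (box_cost _ hb) ps.
move=> [p [/= ep Dp ps]].
pose M := `|y.1 - p.1.1| + `|y.2 - p.1.2| : R.
have M0 : 0 <= M by rewrite addr_ge0.
(* Passing from the cost to [ucost] costs at most 4 e |a - b| + 4 e per coordinate when the box has
   half-side e <= 1, that is e (4 M + 8) in total. *)
have e0 : 0 < (s - cost y p) / (4 * M + 8) by rewrite divr_gt0 ?subr_gt0//; lra.
have [n ne] := inv_succ_lt e0.
have n0 : 0 < n.+1%:R^-1 :> R by rewrite invr_gt0 ltr0n.
have n1 : n.+1%:R^-1 <= 1 :> R by rewrite invf_le1 ?ltr0n// ler1n.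
have [i yi] := rat_near (y.1 : R) n0; have [j yj] := rat_near (y.2 : R) n0.
exists i => //; exists j => //; exists n => //; split => //=.
exists p => //; split => //=; rewrite /ucost.
move: ne; rewrite ltr_pdivlMr ?subr_gt0; last by lra.
rewrite /cost; move: n0 n1 yi yj M0; rewrite /M.
have sq (a q e b : R) : 0 < e -> e <= 1 -> `|a - q| < e ->
    (`|q - b| + e) ^+ 2 <= (a - b) ^+ 2 + 4 * e * (`|a - b|) + 4 * e.
  move=> e0' e1 h; apply: (@le_trans _ _ ((`|a - b| + 2 * e) ^+ 2)).
    have e2 : 0 <= 2 * e by rewrite mulr_ge0// ltW.
    rewrite ler_pXn2r// ?nnegrE; [|exact: addr_ge0 (normr_ge0 _) (ltW e0')|exact: addr_ge0].
    have := ler_distD a q b; rewrite (distrC q a); lra.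
  have -> : (a - b) ^+ 2 = `|a - b| ^+ 2 by rewrite real_normK ?num_real.
  rewrite -subr_ge0.
  have -> : `|a - b| ^+ 2 + 4 * e * `|a - b| + 4 * e - (`|a - b| + 2 * e) ^+ 2 = 4 * (e * (1 - e)).
    by ring.
  by apply: mulr_ge0 => //; apply: mulr_ge0; [exact: ltW|rewrite subr_ge0].
move: (n.+1%:R^-1 : R) => e e00 e1 yi yj _ H.
have := sq _ _ _ (p.1.1) e00 e1 yi; have := sq _ _ _ (p.1.2) e00 e1 yj.
move: H; rewrite mulrDr mulrCA mulrDr !mulrDr !mulrA.
move: (_ ^+ 2) (_ ^+ 2) (_ ^+ 2) (_ ^+ 2) (4 * e * _) (4 * e * _) => *; lra.
Qed.

Definition nearest_set D : set (Omega * (mR * mR)) :=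
  [set z | nearest z.2 D (eta z.1)].

(** The least cost in D equals the overall least cost exactly when D is hit and no rational
    threshold lies above the latter without lying above the former. Strict sublevels at rational
    thresholds suffice, as configurations are locally finite and minima are attained. *)
Lemma measurable_nearest_set D : measurable D -> measurable (nearest_set D).
Proof.
move=> mD.
rewrite (_ : nearest_set D = (hit eta D `*` setT) `&`
    ~` \bigcup_(q : rat) (close setT (ratr q) `\` close D (ratr q))).
  apply: measurableI; first by apply: measurableX => //; exact: mhit.
  apply: measurableC; apply: bigcupT_measurable_rat => q.
  by apply: measurableD; exact: measurable_close.
apply/seteqP; split => -[w y].
  move=> [p [/= ep Dp pmin]]; split; first by split => //; exists p.
  move=> [q _ [[r [/= er _ rq]] nq]]; apply: nq; exists p; split => //=.
  by apply: le_lt_trans rq; exact: pmin.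
move=> [[[p0 /= ep0 Dp0] _] H].
have fin : finite_set (eta w `&` D `&` [set p | cost y p <= cost y p0]).
  by apply: sub_finite_set (finite_par (conf w) y (cost y p0)) => p [[ep _] pp]; split.
have [|p [[ep Dp] pp0] pmin] := finite_argmin (cost y) fin.
  by exists p0; split => //=.
exists p; split => //= r er; rewrite leNgt; apply/negP => rp.
have [q] := @rat_in_itvoo R (cost y r) (cost y p) rp.
rewrite in_itv/= => /andP[rq qp]; apply: H; exists q => //; split; first by exists r.
move=> [p' [/= ep' Dp' p'q]].
have := lt_trans p'q qp; rewrite ltNge => /negP; apply; apply: pmin; split => //.
exact: le_trans (ltW (lt_trans p'q qp)) pp0.
Qed.

End joint_measurability.

(** * Variance of the total cell area *)

Section random_sections.
Local Open Scope ereal_scope.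
Context d d' (Omega : measurableType d) (Y : measurableType d') (R : realType).
Variables (P : probability Omega R) (mu : {sigma_finite_measure set Y -> \bar R}).
Implicit Types A : set (Omega * Y).

Lemma expectation_section A : measurable A ->
  \int[P]_w mu (xsection A w) = \int[mu]_y P (ysection A y).
Proof.
move=> mA; rewrite -[LHS]/((P \x mu) A) -[RHS]/((P \x^ mu) A).
by apply: product_measure_unique => // B C mB mC; exact: product_measure2E.
Qed.

Let vol_indic A (u : Omega * Y) : \bar R := mu (xsection A u.1) * (\1_A u)%:E.

Let vol_indic_ge0 A u : 0 <= vol_indic A u.
Proof. by rewrite mule_ge0// lee_fin. Qed.

Let measurable_indicE A : measurable A ->
  measurable_fun setT (fun u => (\1_A u)%:E : \bar R).
Proof. by move=> mA; exact/measurable_EFinP/measurable_indic. Qed.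

Let measurable_vol_indic A : measurable A -> measurable_fun setT (vol_indic A).
Proof.
move=> mA; apply: emeasurable_funM; last exact: measurable_indicE.
have mX : measurable_fun setT (fun w => mu (xsection A w)).
  exact: measurable_fun_xsection.
exact: (measurableT_comp mX (@measurable_fst _ _ Omega Y)).
Qed.

Let cylinderE A y z :
  ysection A y `&` ysection A z = ysection (A `&` (ysection A y `*` setT)) z.
Proof.
apply/seteqP; split => w.
  by move=> [/ysectionP Awy /ysectionP Awz]; apply/ysectionP; split => //; split => //; exact/ysectionP.
by move=> /ysectionP[Awz [/ysectionP Awy _]]; split; exact/ysectionP.
Qed.

Let measurable_cylinder A y : measurable A -> measurable (A `&` (ysection A y `*` setT)).
Proof.
by move=> mA; apply: measurableI => //; apply: measurableX => //; exact: measurable_ysection.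
Qed.

Lemma measurable_pair_section A y : measurable A ->
  measurable_fun setT (fun z => P (ysection A y `&` ysection A z)).
Proof.
move=> mA; under eq_fun do rewrite cylinderE.
exact: (measurable_fun_ysection P (measurable_cylinder y mA)).
Qed.

Let pair_sectionE A y : measurable A ->
  \int[mu]_z P (ysection A y `&` ysection A z) = \int[P]_w vol_indic A (w, y).
Proof.
move=> mA; under eq_integral do rewrite cylinderE.
rewrite -expectation_section; last exact: measurable_cylinder.
apply: eq_integral => w _; rewrite /vol_indic/= indicE.
have [Awy|Awy] := boolP ((w, y) \in A); rewrite ?mule1 ?mule0.
  have hy : ysection A y w by apply/ysectionP; exact: set_mem.
  congr (mu _); apply/seteqP; split => z /xsectionP.
    by move=> [Awz _]; exact/xsectionP.
  by move=> Awz; apply/xsectionP; split.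
rewrite [X in mu X](_ : _ = set0) ?measure0// -subset0 => z /xsectionP[_ [/ysectionP h _]].
by move: Awy; rewrite notin_setE.
Qed.

Lemma measurable_integral_pair_section A : measurable A ->
  measurable_fun setT (fun y => \int[mu]_z P (ysection A y `&` ysection A z)).
Proof.
move=> mA; under eq_fun do rewrite pair_sectionE//.
exact: (measurable_fun_fubini_tonelli_G (m1 := P) (vol_indic A) (measurable_vol_indic mA) (vol_indic_ge0 A)).
Qed.

(** Robbins's formula for the second moment of a random area. One of the two factors is kept as the
    weight in [vol_indic], so that two applications of Fubini on Omega x Y suffice. *)
Lemma expectation_section_sq A : measurable A ->
  \int[P]_w (mu (xsection A w) * mu (xsection A w)) =
  \int[mu]_y \int[mu]_z P (ysection A y `&` ysection A z).
Proof.
move=> mA; transitivity (\int[P]_w \int[mu]_y vol_indic A (w, y)).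
  apply: eq_integral => w _; rewrite /vol_indic/= ge0_integralZl//; last first.
    exact: (measurableT_comp (measurable_indicE mA) (measurable_pair1 w)).
  congr (_ * _); rewrite -[in LHS](setIT (xsection A w)) -integral_indic//.
    apply: eq_integral => y _; rewrite !indicE; congr ((_ : bool)%:R%:E).
    by apply/idP/idP; rewrite !inE => /xsectionP.
  exact: measurable_xsection.
rewrite fubini_tonelli//; last exact: measurable_vol_indic.
by apply: eq_integral => y _; rewrite pair_sectionE.
Qed.

End random_sections.

Section second_moment.
Local Open Scope ereal_scope.
Context d (Omega : measurableType d) (R : realType) (P : probability Omega R).

Lemma sqdist_second_moment (S : Omega -> \bar R) (V c K : R) : (0 < V)%R -> (0 <= c)%R ->
  measurable_fun setT S -> (forall w, 0 <= S w) ->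
  \int[P]_w S w = (c * V)%:E -> \int[P]_w (S w * S w) <= ((c * V) ^+ 2 + K * V)%:E ->
  \int[P]_w sqdist (S w * V^-1%:E) c <= (K / V)%:E.
Proof.
move=> V0 c0 mS S0 ES ES2; set a := (c * V)%R in ES ES2.
have a0 : (0 <= a)%R by rewrite mulr_ge0// ltW.
have mSS : measurable_fun setT (fun w => S w * S w) by exact: emeasurable_funM.
have msq : measurable_fun setT (fun w => sqdist (S w) a) by exact: measurable_sqdist.
(* The square is expanded without subtraction, so that the identity holds also where [S] is infinite
   and can be integrated term by term. *)
have id w : sqdist (S w) a + (2 * a)%:E * S w = S w * S w + (a ^+ 2)%:E.
  have := S0 w; rewrite /sqdist; case: (S w) => [r _| _|//]/=.
    by rewrite -EFinB -!EFinM -!EFinD; congr _%:E; ring.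
  have [a1|a1] := eqVneq a 0%R; first by rewrite a1 mulr0 mul0e expr0n/= !adde0.
  have a2 : 0 < (2 * a)%:E by rewrite lte_fin mulr_gt0// lt0r a1.
  by rewrite (gt0_muley a2) mulyy.
have ic : \int[P]_w (a ^+ 2)%:E = (a ^+ 2)%:E.
  by rewrite integral_cst// -[RHS]mule1 -(probability_setT P).
have H : \int[P]_w sqdist (S w) a + (2 * a)%:E * a%:E = \int[P]_w (S w * S w) + (a ^+ 2)%:E.
  rewrite -ES -ge0_integralZl//; last by rewrite lee_fin mulr_ge0.
  rewrite -ge0_integralD//.
  - under eq_integral do rewrite id.
    rewrite ge0_integralD//.
    + by rewrite ic.
    + by move=> w _; rewrite mule_ge0.
    + by move=> w _; rewrite lee_fin sqr_ge0.
  - by move=> w _; exact: sqdist_ge0.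
  - by move=> w _; rewrite mule_ge0// lee_fin mulr_ge0.
  - exact: measurable_funeM.
have {}H : \int[P]_w sqdist (S w) a <= (K * V)%:E.
  move: H ES2; have : 0 <= \int[P]_w sqdist (S w) a by apply: integral_ge0 => w _; exact: sqdist_ge0.
  have : 0 <= \int[P]_w (S w * S w) by apply: integral_ge0 => w _; rewrite mule_ge0.
  case: (\int[P]_w sqdist (S w) a) => [r||//] _; case: (\int[P]_w (S w * S w)) => [s||]//= _.
  rewrite -EFinM -!EFinD => -[H]; rewrite !lee_fin; move: H; rewrite expr2; lra.
have sc w : sqdist (S w * V^-1%:E) c = (V ^- 2)%:E * sqdist (S w) a.
  have := S0 w; rewrite /sqdist; case: (S w) => [r _| _|//]/=.
    by rewrite -!EFinB -!EFinM; congr _%:E; rewrite /a; field; exact: lt0r_neq0.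
  by rewrite gt0_mulye ?lte_fin ?invr_gt0//= mulyy gt0_muley// lte_fin invr_gt0 exprn_gt0.
under eq_integral do rewrite sc.
rewrite ge0_integralZl//; last 2 first.
- by move=> w _; exact: sqdist_ge0.
- by rewrite lee_fin invr_ge0 exprn_ge0// ltW.
apply: (@le_trans _ _ ((V ^- 2)%:E * (K * V)%:E)).
  by apply: lee_wpmul2l => //; rewrite lee_fin invr_ge0 exprn_ge0// ltW.
by rewrite -EFinM lee_fin le_eqVlt; apply/orP; left; apply/eqP; field; exact: lt0r_neq0.
Qed.

End second_moment.

Lemma stieltjes_tail_total (R : realType) (mu : {measure set (measurableTypeR R) -> \bar R})
    (F : R -> R) (t0 : R) : locally_finite_pos mu -> distr_fun mu = F -> 0 <= t0 -> 0 < F t0 ->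
  (\int[mu]_(h in `]0%R, +oo[) (pi * (exprim_total F - prim (exprim F) h))%:E = 1)%E.
Proof.
move=> lfmu FE t00 Ft0.
have F_nd : {homo F : x y / x <= y} by rewrite -FE; exact: distr_fun_nd.
have F_ge0 x : 0 <= F x by rewrite -FE; exact: distr_fun_ge0.
have ie := integrable_exprim F_nd F_ge0 t00 Ft0.
pose G h := pi * (exprim_total F - prim (exprim F) h).
have e0 := exprim_ge0 F.
have rE : regular (exprim F).
  by apply: regular_exprim => //; exact: regular_nondecreasing.
have rG : regular G.
  apply: (regularM (regular_cst pi)); apply: (regularB (regular_cst _)).
  by apply: regular_nondecreasing => x y xy; exact: le_prim rE (fun u _ => e0 u) xy.
have G0 h : 0 < h -> 0 <= G h.
  by move=> h0; rewrite mulr_ge0 ?pi_ge0// ltW//; exact: exprim_tail_gt0 (regular_nondecreasing F_nd) F_ge0 ie (ltW h0).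
have U : `]0%R, +oo[%classic = \bigcup_n `]0%R, n%:R]%classic :> set R.
  apply/seteqP; split => x /=.
    rewrite in_itv/= andbT => x0; exists (Num.truncn x).+1 => //=.
    by rewrite in_itv/= x0 ltW// truncnS_gt.
  by move=> [n _]; rewrite /= !in_itv/= andbT => /andP[].
have c1 : (\int[mu]_(h in `]0%R, n%:R%R]) (G h)%:E)%E @[n --> \oo] -->
    (\int[mu]_(h in \bigcup_n `]0%R, n%:R%R]%classic) (G h)%:E)%E.
  apply: ge0_nondecreasing_set_cvg_integral => //.
  - move=> n m nm; apply/subsetPset => x; rewrite /= !in_itv/= => /andP[-> xn].
    by rewrite (le_trans xn)// ler_nat.
  - by move=> n; apply: measurable_funTS; apply/measurable_EFinP; exact: rG.1.
  - by move=> n x; rewrite /= in_itv/= => /andP[x0 _]; rewrite lee_fin G0.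
rewrite U; apply: (cvg_unique _ c1) => //.
have : (stieltjes mu G n%:R)%:E @[n --> \oo] --> 1%:E.
  have c := stieltjes_tail_cvg1 lfmu FE t00 Ft0.
  by apply: cvg_EFin => //; exact: nearW.
apply: cvg_trans; apply: near_eq_cvg; apply: nearW => n.
rewrite stieltjes.unlock /Rintegral fineK//.
by apply: integrable_fin_num => //; exact: stieltjes_integrable.
Qed.

Section plane_average.
Variable R : realType.
Notation mR := (measurableTypeR R).
Variable FF : {sigma_finite_measure set mR -> \bar R}.
Variable g : R -> R.
Hypothesis g_ni : {homo g : x y /~ x <= y}.
Hypothesis g_ge0 : forall x, 0 <= g x.
Hypothesis g_int : (@lebesgue_measure R).-integrable `[0, +oo[ (EFin \o g).
Variables (W : set (mR * mR)) (J : set mR).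
Hypotheses (mW : measurable W) (mJ : measurable J) (J0 : forall h : R, J h -> 0 < h).
Local Open Scope ereal_scope.

Let mg : measurable_fun setT (fun u : mR => (g u)%:E).
Proof. by apply/measurable_EFinP; exact: (regular_nonincreasing g_ni).1. Qed.

(** With g = e this is the probability that y lies in the cell of a point of W x J; with the slower
    [e2] it dominates the influence of distant points. *)
Definition attraction (y : mR * mR) :=
  \int[intensity FF]_(p in W `*` J) (g (cost y p))%:E.

Let f (z : (mR * mR) * (mR * mR * mR)) : \bar R := (g (cost z.1 z.2) * \1_(W `*` J) z.2)%:E.

Let mf : measurable_fun setT f.
Proof.
apply/measurable_EFinP; apply: measurable_funM.
  apply: (measurableT_comp _ (@measurable_cost R)).
  exact: (regular_nonincreasing g_ni).1.
apply: (measurableT_comp _ (@measurable_snd _ _ (mR * mR)%type (mR * mR * mR)%type)).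
by apply: measurable_indic; exact: measurableX.
Qed.

Let f0 z : 0 <= f z. Proof. by rewrite lee_fin mulr_ge0. Qed.

Let attractionE y : attraction y = \int[intensity FF]_p f (y, p).
Proof.
rewrite /attraction integral_mkcond; apply: eq_integral => p _.
by rewrite patchE /f/= indicE; case: ifPn => _; rewrite ?mulr1 ?mulr0.
Qed.

Lemma measurable_attraction : measurable_fun setT attraction.
Proof.
rewrite (_ : attraction = fubini_F (intensity FF) f); last by apply/funext => y; exact: attractionE.
exact: measurable_fun_fubini_tonelli_F.
Qed.

Lemma attraction_ge0 y : 0 <= attraction y.
Proof. by apply: integral_ge0 => p _; rewrite lee_fin. Qed.

(** The order of integration is exchanged: each point of W x J is integrated over all locations by
    [plane_integral], and the result depends on its weight only. *)
Lemma plane_average : \int[@nu2 R]_y attraction y =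
  nu2 W * \int[FF]_(h in J) (pi * (\int[@lebesgue_measure R]_(u in `[0%R, +oo[) g u - prim g h))%:E.
Proof.
under eq_integral do rewrite attractionE.
rewrite (fubini_tonelli (m1 := @nu2 R) (m2 := intensity FF) f)//.
pose G (h : R) : R := (pi * (\int[@lebesgue_measure R]_(u in `[0%R, +oo[) g u - prim g h))%R.
have inner (p : mR * mR * mR) : (\int[@nu2 R]_y f (y, p)) = (\1_(W `*` J) p)%:E * (G p.2)%:E.
  rewrite /f/= indicE; case: (boolP (p \in W `*` J)) => [|_]; last first.
    by rewrite mul0e; apply: integral0_eq => y _; rewrite mulr0.
  rewrite inE => -[_ Jp]; rewrite mul1e; under eq_integral do rewrite mulr1.
  by rewrite plane_integral//; exact: (ltW (J0 Jp)).
under eq_integral do rewrite inner.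
have mG : measurable_fun setT (fun h : mR => (G h)%:E).
  apply/measurable_EFinP; apply: measurable_funM => //; apply: measurable_funB => //.
  by apply: (regular_nondecreasing _).1 => x y xy; exact: le_prim (regular_nonincreasing g_ni) (fun u _ => g_ge0 u) xy.
have G0 h : J h -> 0 <= (G h)%:E.
  move=> Jh; rewrite -(plane_integral (p := ((0%R, 0%R), h)) _ g_ni)//; last exact: (ltW (J0 Jh)).
  by apply: integral_ge0 => y _; rewrite lee_fin.
rewrite integral_intensity.
- rewrite [in RHS]integral_mkcond -ge0_integralZl//.
  + apply: eq_integral => h _.
    transitivity (\int[@nu2 R]_x ((\1_J h)%:E * (G h)%:E * (\1_W x)%:E)).
      apply: eq_integral => x _ /=; rewrite muleC -muleA muleCA; congr (_ * _).
      by rewrite -EFinM !indicE in_setX/= -natrM mulnb andbC.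
    rewrite ge0_integralZl//.
    * rewrite integral_indic// setIT muleC patchE indicE; case: ifPn => _.
        by rewrite mul1e.
      by rewrite mul0e.
    * exact/measurable_EFinP/measurable_indic.
    * rewrite indicE; case: (boolP (h \in J)); last by rewrite mul0e.
      by rewrite inE mul1e => /G0.
  + exact/(measurable_restrictT _ mJ)/measurable_funTS.
  + by move=> h _; rewrite patchE; case: ifPn => //; rewrite inE => /G0.
- apply: emeasurable_funM.
    by apply/measurable_EFinP/measurable_indic; exact: measurableX.
  exact: (measurableT_comp mG (@measurable_snd _ _ (mR * mR)%type mR)).
- move=> p; rewrite indicE; case: (boolP (p \in W `*` J)); last by rewrite mul0e.
  by rewrite inE mul1e => -[_ /G0].
Qed.

End plane_average.

Section cell_volume.
Context (R : realType) d (Omega : measurableType d).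
Notation mR := (measurableTypeR R).
Variables (P : probability Omega R) (FF : {sigma_finite_measure set mR -> \bar R}).
Variable eta : Omega -> set (R * R * R).
Hypothesis lfF : locally_finite_pos FF.
Hypothesis conf : forall w, configuration (eta w).
Hypothesis hP : poisson_process P (intensity FF) eta.
Variable t0 : R.
Notation Lam := (intensity FF).
Notation F := (distr_fun FF).
Hypotheses (t00 : 0 <= t0) (Ft0 : 0 < F t0).

Let F_nd : {homo F : x y / x <= y} := distr_fun_nd lfF.
Let F_ge0 : forall x, 0 <= F x := distr_fun_ge0 FF.
Let rF : regular F := regular_nondecreasing F_nd.

(* Halving the intensity yields [e2] with [exprim F = e2 ^ 2]; one factor [e2]
   is spent on the decay in [|y - z|], the other one remains integrable. *)
Let half : {nonneg R} := (2^-1 : R)%:nng.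
Let mu2 : {measure set mR -> \bar R} :=
  measure_function_mscale__canonical__measure_function_Measure half FF.
Let F2 (t : R) := 2^-1 * F t.

Let lfmu2 : locally_finite_pos mu2.
Proof.
case: lfF => F0 Fb; split; first by rewrite /= /mscale/= F0 mule0.
by move=> B mB bB; rewrite /= /mscale/= lte_mul_pinfty ?lee_fin ?invr_ge0//; exact: Fb.
Qed.

Let F2E : distr_fun mu2 = F2.
Proof.
apply/funext => z; rewrite /distr_fun /F2 /= /mscale/= fineM//.
by rewrite ge0_fin_numE//; exact: locally_finite_itv.
Qed.

Let F2_nd : {homo F2 : x y / x <= y}.
Proof. by rewrite -F2E; exact: distr_fun_nd. Qed.
Let F2_ge0 x : 0 <= F2 x.
Proof. by rewrite -F2E; exact: distr_fun_ge0. Qed.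
Let F2t0 : 0 < F2 t0. Proof. by rewrite mulr_gt0. Qed.
Let rF2 : regular F2 := regular_nondecreasing F2_nd.
Let e2 := exprim F2.

Let exprim_sq u : exprim F u = e2 u * e2 u.
Proof. by rewrite /e2 !exprimE -expRD primZ//; congr expR; field. Qed.

Let exprim_noninc (f : R -> R) : {homo f : x y / x <= y} -> (forall x, 0 <= f x) ->
  {homo exprim f : x y /~ x <= y}.
Proof.
move=> fnd f0 x y; apply: exprim_ni => //; exact: regular_nondecreasing.
Qed.

Let e2_ni := exprim_noninc F2_nd F2_ge0.
Let e2_ge0 : forall x, 0 <= e2 x := exprim_ge0 F2.
Let e2_int := integrable_exprim F2_nd F2_ge0 t00 F2t0.

(** At u = |y - z|^2 this is [e2] at the common height up to which the paraboloids with apexes over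
    y and z are disjoint. *)
Let g2 (u : R) := e2 (u / 4).

Let g2_ni : {homo g2 : x y /~ x <= y}.
Proof. by move=> x y xy; apply: e2_ni; rewrite ler_wpM2r// invr_ge0. Qed.

Let g2_int : (@lebesgue_measure R).-integrable `[0, +oo[ (EFin \o g2).
Proof.
have p0 : 0 < pi :> R := pi_gt0 R.
have k0 : 0 < pi * F2 t0 / 4 by rewrite divr_gt0// mulr_gt0.
have mpos : measurable (`[(0 : R), +oo[%classic : set mR) by exact: measurable_itv.
apply: (le_integrable mpos _ _ (integrableZl mpos (expR (pi * F2 t0 * t0)) (integrable_expRN k0))).
  apply/measurable_EFinP/measurable_funTS; exact: (regular_nonincreasing g2_ni).1.
move=> u; rewrite /= in_itv/= andbT => u0.
rewrite lee_fin !ger0_norm ?mulr_ge0 ?expR_ge0//=; last exact: e2_ge0.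
apply: le_trans (exprim_bound F2_nd F2_ge0 t00 (ltW F2t0) (lexx _) _) _.
  by rewrite divr_ge0.
rewrite (_ : - (pi * F2 t0) * (u / 4) = - (pi * F2 t0 / 4) * u)//; ring.
Qed.

Local Open Scope ereal_scope.

Section window.
Variables (W : set (mR * mR)) (J : set mR).
Hypotheses (mW : measurable W) (mJ : measurable J) (J0 : forall h : R, J h -> (0 < h)%R).

Let D : set (mR * mR * mR) := W `*` J.
Let mD : measurable D. Proof. exact: measurableX. Qed.
Let D0 p : D p -> (0 < p.2)%R. Proof. by move=> [_ /J0]. Qed.

(** The area of the union of the cells rather than the sum of their areas; the two agree by
    [esum_cell], and this form is open to Fubini. *)
Definition cell_volume (w : Omega) := nu2 (xsection (nearest_set eta D) w).

Let mN : measurable (nearest_set eta D).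
Proof. by apply: measurable_nearest_set => // B; exact: measurable_hit hP B. Qed.

Let sectionE y : ysection (nearest_set eta D) y = nearest_ev eta y D.
Proof.
by apply/seteqP; split => w; [move=> /ysectionP|move=> h; apply/ysectionP].
Qed.

Lemma measurable_cell_volume : measurable_fun setT cell_volume.
Proof. exact: measurable_fun_xsection. Qed.

Lemma cell_volume_expectation : \int[P]_w cell_volume w =
  nu2 W * \int[FF]_(h in J) (pi * (exprim_total F - prim (exprim F) h))%:E.
Proof.
rewrite expectation_section//.
have iF := integrable_exprim F_nd F_ge0 t00 Ft0.
rewrite -(plane_average FF (exprim_noninc F_nd F_ge0) (exprim_ge0 F) iF mW mJ J0).
by apply: eq_integral => y _; rewrite sectionE (nearest_prob lfF conf hP).
Qed.

Let k := attraction FF e2 W J.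
Let k_ge0 y : 0 <= k y. Proof. exact: attraction_ge0. Qed.
Let mk : measurable_fun setT k. Proof. exact: measurable_attraction. Qed.

(** For the halved measure the tail integral is 1 by [stieltjes_tail_total], so for the original
    measure it is 2; restricting to J only decreases it. *)
Let k_integral : \int[@nu2 R]_y k y <= nu2 W * 2%:E.
Proof.
rewrite /k (plane_average FF e2_ni e2_ge0 e2_int mW mJ J0) lee_wpmul2l//.
pose G h := (pi * (exprim_total F2 - prim e2 h))%R.
have G0 h : (0 < h)%R -> (0 <= G h)%R.
  by move=> h0; rewrite mulr_ge0 ?pi_ge0// ltW//; exact: exprim_tail_gt0 rF2 F2_ge0 e2_int (ltW h0).
have mG : measurable_fun setT (fun h : mR => (G h)%:E).
  apply/measurable_EFinP; apply: measurable_funM => //; apply: measurable_funB => //.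
  apply: (regular_nondecreasing _).1 => x y xy.
  exact: le_prim (regular_nonincreasing e2_ni) (fun u _ => e2_ge0 u) xy.
apply: (@le_trans _ _ (\int[FF]_(h in `]0%R, +oo[) (G h)%:E)).
  apply: ge0_subset_integral => //.
  - exact: measurable_funTS.
  - by move=> h; rewrite /= in_itv/= andbT => h0; rewrite lee_fin G0.
  - by move=> h /J0; rewrite /= in_itv/= andbT.
have H := stieltjes_tail_total lfmu2 F2E t00 F2t0.
have H2 := @ge0_integral_mscale _ _ R FF `]0%R, +oo[%classic (measurable_itv _) half (fun h => (G h)%:E).
move: H; rewrite -/e2 H2; last 2 first.
- exact: measurable_funTS.
- by move=> h; rewrite /= in_itv/= andbT => h0; rewrite lee_fin G0.
case: (\int[FF]_(h in _) _) => [r||] /=.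
- by rewrite -EFinM => -[H]; rewrite lee_fin; lra.
- by rewrite gt0_muley// lte_fin.
- by rewrite gt0_muleNy// lte_fin.
Qed.

Let q (y z : R * R) : \bar R := (g2 (cost y (z, 0%R)))%:E.

(** A point of cost above s carries e = e2^2, of which one factor is at most e2 s and the other one
    is integrated. *)
Let far y (s : R) : (0 <= s)%R ->
  P (nearest_ev eta y (D `\` par y s)) <= (e2 s)%:E * k y.
Proof.
move=> s0; have mDs : measurable (D `\` par y s).
  by apply: measurableD => //; exact: measurable_par.
have me2 : measurable_fun setT (fun p : mR * mR * mR => (e2 (cost y p))%:E).
  apply/measurable_EFinP; apply: (measurableT_comp _ (measurable_cost2 y)).
  exact: (regular_nonincreasing e2_ni).1.
rewrite (nearest_prob lfF conf hP)//; last by move=> p [/D0].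
apply: (@le_trans _ _ (\int[Lam]_(p in D `\` par y s) ((e2 s)%:E * (e2 (cost y p))%:E))).
  apply: ge0_le_integral => //.
  - by move=> p _; rewrite lee_fin exprim_ge0.
  - apply: measurable_funTS; apply/measurable_EFinP; apply: (measurableT_comp _ (measurable_cost2 y)).
    by have [] : regular (exprim F) by exact: regular_exprim.
  - by apply: measurable_funTS; exact: measurable_funeM.
  - move=> p [Dp np]; rewrite -EFinM lee_fin exprim_sq ler_wpM2r//.
    apply: e2_ni; rewrite leNgt; apply/negP => ps; apply: np; split; first exact: D0.
    exact: ltW.
rewrite ge0_integralZl//; last 3 first.
- exact: measurable_funTS.
- by move=> p _; rewrite lee_fin.
- by rewrite lee_fin.
apply: lee_wpmul2l; first by rewrite lee_fin.
apply: ge0_subset_integral => //.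
- exact: measurable_funTS.
- by move=> p _; rewrite lee_fin.
Qed.

(* The sets [par y s] and [par z s] are disjoint for [s = |y - z|^2 / 4]. *)
Let pair_bound y z : P (nearest_ev eta y D `&` nearest_ev eta z D) <=
  P (nearest_ev eta y D) * P (nearest_ev eta z D) + (q y z * k y + q y z * k z).
Proof.
pose s := (cost y (z, 0%R) / 4)%R.
have s0 : (0 <= s)%R by rewrite divr_ge0// /cost/= addr0 addr_ge0// sqr_ge0.
have mpar x : measurable (par x s) by exact: measurable_par.
have mI x : measurable (D `&` par x s) by exact: measurableI.
have mDf x : measurable (D `\` par x s) by exact: measurableD.
have ev1 x : measurable (nearest_ev eta x (D `&` par x s)).
  exact: (measurable_nearest_ev conf hP).
have ev2 x : measurable (nearest_ev eta x (D `\` par x s)).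
  exact: (measurable_nearest_ev conf hP).
have evD x : measurable (nearest_ev eta x D).
  exact: (measurable_nearest_ev conf hP).
have split_ev x : nearest_ev eta x D `<=`
    nearest_ev eta x (D `&` par x s) `|` nearest_ev eta x (D `\` par x s).
  move=> w [p [ep Dp pmin]]; have [px|px] := pselect (par x s p).
    by left; exists p.
  by right; exists p.
(* Parallelogram identity: the squared distances of a location to y and z add up to at least |y -
   z|^2 / 2 = 2 s, but both would be below s for a point of positive weight. *)
have dis : par y s `&` par z s = set0.
  rewrite -subset0 => p [[p0 yp] [_ zp]].
  have : (0 < p.2)%R := p0; move: yp zp; rewrite /s /cost/=.
  move: (p.1.1 : R) (p.1.2 : R) (p.2 : R) => x1 x2 h h1 h2 h0.
  have := sqr_ge0 (y.1 + z.1 - 2 * x1)%R; have := sqr_ge0 (y.2 + z.2 - 2 * x2)%R.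
  by move: h1 h2; rewrite !expr2; lra.
apply: (@le_trans _ _ (P ((nearest_ev eta y (D `&` par y s) `&` nearest_ev eta z (D `&` par z s))
    `|` (nearest_ev eta y (D `\` par y s) `|` nearest_ev eta z (D `\` par z s))))).
  apply: le_measure; rewrite ?inE.
  - exact: measurableI.
  - by apply: measurableU; [exact: measurableI|exact: measurableU].
  - move=> w [/split_ev[ey|ey] /split_ev[ez|ez]]; by [left|right; left|right; right].
apply: (le_trans (measureU2 _ _ _)); [exact: measurableI|exact: measurableU|].
apply: leeD.
  have sub x : D `&` par x s `<=` par x s by move=> p [].
  rewrite [leLHS](nearest_indep conf hP (mI y) (mI z) (sub y) (sub z) dis).
  apply: lee_pmul => //; apply: le_measure; rewrite ?inE// => w [p [ep [Dp _] pmin]];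
    by exists p.
apply: (le_trans (measureU2 _ _ _)) => //.
by apply: leeD; exact: far.
Qed.

Let mq : measurable_fun setT (fun u : (mR * mR) * (mR * mR) => q u.1 u.2).
Proof.
apply/measurable_EFinP.
have m1 := @measurable_fst _ _ (mR * mR)%type (mR * mR)%type.
have m2 := @measurable_snd _ _ (mR * mR)%type (mR * mR)%type.
have m2' : measurable_fun setT (fun u : (mR * mR) * (mR * mR) => (u.2, 0%R : mR)).
  by apply: measurable_fun_pair.
apply: (measurableT_comp (regular_nonincreasing g2_ni).1).
exact: (measurableT_comp (@measurable_cost R) (measurable_fun_pair m1 m2')).
Qed.

Definition interaction : R := (pi * \int[@lebesgue_measure R]_(u in `[0%R, +oo[) g2 u)%R.

Let q_integral (y : R * R) : \int[@nu2 R]_z q z y = interaction%:E.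
Proof.
rewrite (@plane_integral _ (y, 0%R) (lexx _) g2 g2_ni (fun u => e2_ge0 (u / 4)%R) g2_int).
by rewrite prim0 subr0.
Qed.

Let q_sym y z : q y z = q z y. Proof. by rewrite /q cost_sym. Qed.

Let q_ge0 y z : 0 <= q y z. Proof. by rewrite lee_fin; exact: e2_ge0. Qed.

Let mqr (y : mR * mR) : measurable_fun setT (fun z : mR * mR => q z y).
Proof. exact: (measurableT_comp mq (measurable_pair2 y)). Qed.

Lemma interaction_ge0 : (0 <= interaction)%R.
Proof. by rewrite -lee_fin -(q_integral (0%R, 0%R)) integral_ge0. Qed.

Let interaction_integral :
  \int[@nu2 R]_y \int[@nu2 R]_z (q y z * k z) = interaction%:E * \int[@nu2 R]_y k y.
Proof.
rewrite (fubini_tonelli (m1 := @nu2 R) (m2 := @nu2 R) (fun u => q u.1 u.2 * k u.2)); last 2 first.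
- apply: emeasurable_funM => //.
  exact: (measurableT_comp mk (@measurable_snd _ _ (mR * mR)%type (mR * mR)%type)).
- by move=> u; rewrite mule_ge0.
rewrite -ge0_integralZl//; last by rewrite -(q_integral (0%R, 0%R)) integral_ge0.
apply: eq_integral => z _ /=.
under eq_integral do rewrite muleC.
by rewrite ge0_integralZl// q_integral muleC.
Qed.

(** [pair_bound] is integrated over both locations. The product of probabilities gives the squared
    mean; each of the two other terms gives [interaction] times the integral of k, which is at most
    2 |W|, whence the factor 4. *)
Lemma cell_volume_second_moment :
  \int[P]_w (cell_volume w * cell_volume w) <=
  (\int[P]_w cell_volume w) * (\int[P]_w cell_volume w) +
  nu2 W * (4 * interaction)%:E.
Proof.
have evD x : measurable (nearest_ev eta x D).
  exact: (measurable_nearest_ev conf hP).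
have I0 := interaction_ge0.
have mp : measurable_fun setT (fun y : mR * mR => P (nearest_ev eta y D)).
  by rewrite (_ : (fun _ => _) = P \o ysection (nearest_set eta D));
    [exact: measurable_fun_ysection|apply/funext => y; rewrite /= sectionE].
have EV : \int[P]_w cell_volume w = \int[@nu2 R]_y P (nearest_ev eta y D).
  by rewrite expectation_section//; apply: eq_integral => y _; rewrite sectionE.
rewrite expectation_section_sq//.
have mqk : measurable_fun setT (fun u : (mR * mR) * (mR * mR) => q u.1 u.2 * k u.1 + q u.1 u.2 * k u.2).
  apply: emeasurable_funD; apply: emeasurable_funM => //.
    exact: (measurableT_comp mk (@measurable_fst _ _ (mR * mR)%type (mR * mR)%type)).
  exact: (measurableT_comp mk (@measurable_snd _ _ (mR * mR)%type (mR * mR)%type)).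
have mqk2 (y : mR * mR) : measurable_fun setT (fun z : mR * mR => q y z * k y + q y z * k z).
  exact: (measurableT_comp mqk (measurable_pair1 y)).
have qk0 y z : 0 <= q y z * k y + q y z * k z by rewrite adde_ge0// mule_ge0.
have mqy (y : mR * mR) : measurable_fun setT (fun z : mR * mR => q y z).
  exact: (measurableT_comp mq (measurable_pair1 y)).
pose inner y := P (nearest_ev eta y D) * (\int[@nu2 R]_z P (nearest_ev eta z D)) +
  (k y * interaction%:E + \int[@nu2 R]_z (q y z * k z)).
have minner : measurable_fun setT (fun y : mR * mR => \int[@nu2 R]_z (q y z * k z)).
  apply: (@measurable_fun_fubini_tonelli_F _ _ _ _ _ (@nu2 R) (fun u => q u.1 u.2 * k u.2)).
    apply: emeasurable_funM => //.
    exact: (measurableT_comp mk (@measurable_snd _ _ (mR * mR)%type (mR * mR)%type)).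
  by move=> u; rewrite mule_ge0.
have Pint0 : 0 <= \int[@nu2 R]_z P (nearest_ev eta z D) by exact: integral_ge0.
have kI0 y : 0 <= k y * interaction%:E by rewrite mule_ge0// lee_fin.
have mkI : measurable_fun setT (fun y => k y * interaction%:E).
  by under eq_fun do rewrite muleC; exact: measurable_funeM.
have qki0 y : 0 <= \int[@nu2 R]_z (q y z * k z).
  by apply: integral_ge0 => z _; rewrite mule_ge0.
apply: (@le_trans _ _ (\int[@nu2 R]_y inner y)).
  apply: ge0_le_integral => //.
  - by move=> y _; exact: integral_ge0.
  - exact: measurable_integral_pair_section.
  - apply: emeasurable_funD; last exact: emeasurable_funD.
    by under eq_fun do rewrite muleC; exact: measurable_funeM.
  - move=> y _; rewrite /inner -ge0_integralZl//.
    rewrite -[k y * _](_ : \int[@nu2 R]_z (q y z * k y) = _); last first.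
      under eq_integral do rewrite muleC q_sym.
      by rewrite ge0_integralZl// q_integral.
    rewrite -ge0_integralD//; last 4 first.
    + by move=> z _; rewrite mule_ge0.
    + by under eq_fun do rewrite muleC; exact: measurable_funeM.
    + by move=> z _; rewrite mule_ge0.
    + exact: emeasurable_funM.
    rewrite -ge0_integralD//; last 2 first.
    + by move=> z _; rewrite mule_ge0.
    + exact: measurable_funeM.
    apply: ge0_le_integral => //.
    + exact: measurable_pair_section.
    + by apply: emeasurable_funD => //; exact: measurable_funeM.
    + by move=> z _; rewrite !sectionE; exact: pair_bound.
rewrite /inner ge0_integralD//; last 4 first.
- by move=> y _; rewrite mule_ge0.
- by under eq_fun do rewrite muleC; exact: measurable_funeM.
- by move=> y _; rewrite adde_ge0.
- exact: emeasurable_funD.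
rewrite ge0_integralD// interaction_integral EV; apply: leeD.
  rewrite le_eqVlt; apply/orP; left; apply/eqP.
  under eq_integral do rewrite muleC.
  by rewrite ge0_integralZl.
under eq_integral do rewrite muleC.
rewrite ge0_integralZl// -ge0_muleDl ?lee_fin//.
have -> : (4 * interaction)%:E = 2%:E * (interaction%:E + interaction%:E).
  by rewrite -EFinD -EFinM; congr _%:E; ring.
by rewrite muleA muleC lee_wpmul2r// -EFinD lee_fin addr_ge0.
Qed.

Lemma cell_volume_sqdist (V c : R) : nu2 W = V%:E -> (0 < V)%R -> (0 <= c)%R ->
  \int[FF]_(h in J) (pi * (exprim_total F - prim (exprim F) h))%:E = c%:E ->
  \int[P]_w sqdist (cell_volume w * V^-1%:E) c <= (4 * interaction / V)%:E.
Proof.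
move=> WV V0 c0 Jc; have EV : \int[P]_w cell_volume w = (c * V)%:E.
  by rewrite cell_volume_expectation WV Jc -EFinM mulrC.
apply: sqdist_second_moment => //; first exact: measurable_cell_volume.
apply: (le_trans cell_volume_second_moment).
by rewrite EV WV -!EFinM -EFinD lee_fin expr2 (mulrC V).
Qed.

End window.
End cell_volume.

(** * Sums of cell areas as areas of unions *)

Section cells.
Variable R : realType.
Notation mR := (measurableTypeR R).
Notation point := (R * R * R)%type.
Local Open Scope ereal_scope.

Lemma measurable_bisector (p q : point) : measurable [set y : mR * mR | cost y p = cost y q].
Proof.
have mB (r s : point) : measurable [set y : mR * mR | cost y r <= cost y s]%R.
  rewrite (_ : [set _ | _] = [set y : mR * mR | cost y r - cost y s <= 0]%R).
    apply: measurable_sublevel.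
    by apply: measurable_funB; exact: measurable_cost1.
  by apply/seteqP; split => y /=; rewrite subr_le0.
rewrite (_ : [set _ | _] = [set y : mR * mR | cost y p <= cost y q]%R `&`
  [set y : mR * mR | cost y q <= cost y p]%R); first exact: measurableI.
apply/seteqP; split => y /=; first by move=> ->.
by move=> [h1 h2]; apply/le_anti/andP.
Qed.

(** The quadratic terms cancel and leave a y1 + b y2 = c. For b nonzero every vertical section is a
    single point; for b = 0 the set is a vertical line, or empty when the two points differ only in
    weight. *)
Lemma bisector_null (p q : point) : p <> q ->
  nu2 [set y : mR * mR | cost y p = cost y q] = 0.
Proof.
move=> pq.
pose a := (2 * (q.1.1 - p.1.1))%R; pose b := (2 * (q.1.2 - p.1.2))%R.
pose c := (q.1.1 ^+ 2 + q.1.2 ^+ 2 + q.2 - (p.1.1 ^+ 2 + p.1.2 ^+ 2 + p.2))%R.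
have E (y : mR * mR) : cost y p = cost y q <-> (a * y.1 + b * y.2 = c)%R.
  by rewrite /cost /a /b /c; split=> h; [|]; move: h; rewrite !expr2;
    move: (y.1 : R) (y.2 : R) (p.1.1 : R) (p.1.2 : R) (p.2 : R) (q.1.1 : R) (q.1.2 : R) (q.2 : R) => *; lra.
have [b0|b0] := eqVneq b 0%R; last first.
  rewrite /nu2 /product_measure1; apply: integral0_eq => x _ /=.
  apply/eqP; rewrite eq_le measure_ge0 andbT.
  rewrite -(lebesgue_measure_set1 ((c - a * x) / b)%R); apply: le_measure; rewrite ?inE.
  - apply: measurable_xsection; exact: measurable_bisector.
  - exact: measurable_set1.
  - move=> y /xsectionP /E /= h; rewrite /= -h; field; exact: b0.
have [a0|a0] := eqVneq a 0%R.
  rewrite [X in nu2 X](_ : _ = set0) ?measure0// -subset0 => y /E.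
  rewrite a0 b0 !mul0r addr0 => c0; apply: pq; move: a0 b0 c0; rewrite /a /b /c.
  case: p {E c a b} => [[p1 p2] p3]; case: q => [[q1 q2] q3] /= h1 h2 h3.
  have -> : p1 = q1 by lra.
  have e2 : p2 = q2 by lra.
  have e1 : p1 = q1 by lra.
  by move: h3; rewrite e1 e2 => h3; congr (_, _, _); lra.
have mline : measurable [set (c / a : mR)%R] by exact: measurable_set1.
apply/eqP; rewrite eq_le measure_ge0 andbT.
rewrite [leRHS](_ : 0 = nu2 ([set (c / a : mR)%R] `*` [set: mR])); last first.
  by rewrite nu2_setX// lebesgue_measure_set1 mul0e.
apply: le_measure; rewrite ?inE.
- exact: measurable_bisector.
- exact: measurableX.
- move=> y /E; rewrite b0 mul0r addr0 => h; split => //=.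
  by rewrite -h mulrC mulKf.
Qed.

Lemma cellE (e : set point) (p : point) : e p ->
  laguerre_cell p e = [set y | nearest y [set p] e].
Proof.
move=> ep; apply/seteqP; split => y.
  by move=> h; exists p; split => // q /h; rewrite !costE.
by move=> [r [er -> h]] q /h; rewrite !costE.
Qed.

Section configuration.
Variable e : set point.
Hypothesis he : configuration e.

Lemma measurable_nearest (D : set (mR * mR * mR)) : measurable D ->
  measurable ([set y | nearest y D e] : set (mR * mR)).
Proof.
(* The fixed configuration is seen as a random one on a dummy space, where a hitting event is
   everything or nothing. *)
move=> mD; have mhit (B : set (mR * mR * mR)) : measurable B ->
    measurable (hit (fun _ : mR => e) B).
  move=> _; have [h|h] := pselect (exists2 p, e p & B p).
    by rewrite (_ : hit _ _ = setT)//; apply/seteqP; split.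
  by rewrite (_ : hit _ _ = set0)// -subset0.
have mN := measurable_nearest_set (fun _ => he) mhit mD.
have := measurable_xsection (0%R : mR) mN; congr measurable.
by apply/seteqP; split => y; [move=> /xsectionP|move=> h; apply/xsectionP].
Qed.

Let measurable_point (p : mR * mR * mR) : measurable [set p].
Proof.
rewrite (_ : [set p] = [set p.1.1] `*` [set p.1.2] `*` [set p.2]).
  by apply: measurableX; [apply: measurableX|]; exact: measurable_set1.
apply/seteqP; split => q; first by move=> ->.
by case: p q => [[p1 p2] p3] [[q1 q2] q3] [[/= -> ->] ->].
Qed.

Lemma measurable_cell p : e p -> measurable (laguerre_cell p e : set (mR * mR)).
Proof. by move=> ep; rewrite cellE//; apply: measurable_nearest; exact: measurable_point. Qed.

Let measurable_list (s : seq point) : measurable ([set` s] : set (mR * mR * mR)).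
Proof.
elim: s => [|p s IH]; first by rewrite set_nil.
rewrite (_ : [set` p :: s] = [set p] `|` [set` s]); last first.
  by apply/seteqP; split => q /=; rewrite inE => /predU1P.
by apply: measurableU => //; exact: measurable_point.
Qed.

(** By induction: the cell of a new point meets the union of the other cells only on finitely many
    bisectors, which are null sets. *)
Lemma nearest_list (s : seq point) : uniq s -> {in s, forall p, e p} ->
  nu2 ([set y | nearest y [set` s] e] : set (mR * mR)) = \sum_(p <- s) nu2 (laguerre_cell p e).
Proof.
elim: s => [_ _|p s IH /= /andP[ps us] se].
  rewrite big_nil [X in nu2 X](_ : _ = set0) ?measure0// -subset0 => y [p []].
  by rewrite set_nil.
have ep : e p by apply: se; rewrite inE eqxx.
have es : {in s, forall q, e q} by move=> q qs; apply: se; rewrite inE qs orbT.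
rewrite big_cons -IH//; set N := [set y | nearest y [set` s] e].
have mN : measurable (N : set (mR * mR)) by apply: measurable_nearest; exact: measurable_list.
have mp := measurable_cell ep.
have -> : [set y | nearest y [set` p :: s] e] = laguerre_cell p e `|` (N `\` laguerre_cell p e).
  rewrite cellE//; apply/seteqP; split => y.
    have [hp _|hp] := pselect (nearest y [set p] e); first by left.
    move=> [q [eq]]; rewrite /= inE => /predU1P[->|qs] h.
      by left; exists p.
    by right; split => //; exists q.
  by move=> [[q [eq -> h]]|[[q [eq qs h]] _]]; [exists p|exists q]; split => //=; rewrite inE ?eqxx// qs orbT.
rewrite (measureU _ mp (measurableD mN mp)); last by rewrite setDE setICA setICr setI0.
congr (_ + _); rewrite [RHS](measureDI _ mN mp) [X in _ = _ + X](_ : _ = 0) ?adde0//.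
pose B := \big[setU/set0]_(q <- s) [set y : mR * mR | cost y p = cost y q].
apply: (@subset_measure0 _ _ _ _ _ B) => //.
- exact: measurableI.
- by apply: bigsetU_measurable => q _; exact: measurable_bisector.
- move=> y [[q [eq qs h]] hp]; rewrite /B -bigcup_seq; exists q => //=.
  by apply/le_anti/andP; split; [have := hp _ eq; rewrite !costE|exact: h].
- rewrite /B; elim: s {us IH N mN B} ps se es => [|q s IH].
    by rewrite big_nil measure0.
  rewrite inE negb_or => /andP[/eqP pq ps] se es; rewrite big_cons.
  apply/eqP; rewrite eq_le measure_ge0 andbT.
  apply: (le_trans (measureU2 _ _ _)); first exact: measurable_bisector.
    by apply: bigsetU_measurable => r _; exact: measurable_bisector.
  rewrite [X in X + _]bisector_null// add0e IH//.
    move=> r; rewrite inE => /predU1P[->//|rs]; apply: se; rewrite !inE rs !orbT//.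
  by move=> r rs; apply: es; rewrite inE rs orbT.
Qed.

(** Identifies the sums in [FhatV] with areas of sections of [nearest_set]. Finite subsets are
    handled by [nearest_list]; for the reverse inequality D is exhausted by bounded parts, each
    containing finitely many points of the configuration. *)
Lemma esum_cell (D : set (mR * mR * mR)) : measurable D ->
  \esum_(p in e) ((\1_D p)%:E * nu2 (laguerre_cell p e)) =
  nu2 ([set y | nearest y D e] : set (mR * mR)).
Proof.
move=> mD; have mN E : measurable E -> measurable ([set y | nearest y E e] : set (mR * mR)).
  exact: measurable_nearest.
have -> : \esum_(p in e) ((\1_D p)%:E * nu2 (laguerre_cell p e)) =
    \esum_(p in e `&` D) nu2 (laguerre_cell p e).
  rewrite esum_mkcondr; apply: eq_esum => p _; rewrite indicE.
  by case: ifPn => _; rewrite ?mul1e ?mul0e.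
have fin_sum A : finite_set A -> A `<=` e `&` D ->
    \sum_(p \in A) nu2 (laguerre_cell p e) = nu2 ([set y | nearest y A e] : set (mR * mR)).
  move=> fA Ae; rewrite (fsbig_finite _ _ fA) -nearest_list; last 2 first.
  - exact: finmap.fset_uniq.
  - by move=> p; rewrite in_fset_set// inE => /Ae[].
  by congr nu2; apply/seteqP; split => y [p [ep Ap h]]; exists p; split => //;
    move: Ap; rewrite /= in_fset_set// inE.
apply/eqP; rewrite eq_le; apply/andP; split.
  apply: ub_ereal_sup => _ [A [fA Ae] <-]; rewrite fin_sum//.
  apply: le_measure; rewrite ?inE.
  - rewrite -[A](fset_setK fA); apply: mN; exact: measurable_list.
  - exact: mN.
  - by move=> y [p [ep /Ae[_ Dp] h]]; exists p.
pose Dn (n : nat) := D `&` par (0%R, 0%R) n%:R.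
have mDn n : measurable (Dn n) by apply: measurableI => //; exact: measurable_par.
have cv : nu2 [set y | nearest y (Dn n) e] @[n --> \oo] --> nu2 [set y | nearest y D e].
  have -> : [set y | nearest y D e] = \bigcup_n [set y | nearest y (Dn n) e].
    apply/seteqP; split => y; last by move=> [n _ [p [ep [Dp _] h]]]; exists p.
    move=> [p [ep Dp h]]; exists (Num.truncn (cost (0%R, 0%R) p)).+1 => //.
    exists p; split => //; split => //; split; first exact: he.1.
    exact/ltW/truncnS_gt.
  apply: nondecreasing_cvg_mu.
  - by move=> n; exact: (mN _ (mDn n)).
  - by apply: bigcup_measurable => n _; exact: (mN _ (mDn n)).
  - move=> n m nm; apply/subsetPset => y [p [ep [Dp [p0 pn]] h]].
    by exists p; split => //; split => //; split => //; rewrite (le_trans pn)// ler_nat.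
have bd n : nu2 [set y | nearest y (Dn n) e] <= \esum_(p in e `&` D) nu2 (laguerre_cell p e).
  have fA : finite_set (e `&` Dn n).
    by apply: sub_finite_set (finite_par he (0%R, 0%R) n%:R) => p [ep [_ [_ h]]]; split.
  apply: esum_ge; exists (e `&` Dn n); first by split => // p [ep [Dp _]].
  rewrite fin_sum//; last by move=> p [ep [Dp _]].
  rewrite le_eqVlt; apply/orP; left; apply/eqP; congr nu2.
  by apply/seteqP; split => y [p [ep Dp h]]; exists p; split => //; case: Dp.
by apply: (cvge_le _ cv); exact: nearW.
Qed.

End configuration.
End cells.

(** * Variance of the number of points in their own cell *)

Section grid.
Context (R : realType) d (Omega : measurableType d).
Notation mR := (measurableTypeR R).
Variables (P : probability Omega R) (FF : {sigma_finite_measure set mR -> \bar R}).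
Variable eta : Omega -> set (R * R * R).
Hypothesis lfF : locally_finite_pos FF.
Hypothesis hP : poisson_process P (intensity FF) eta.
Notation Lam := (intensity FF).
Notation F := (distr_fun FF).
Let F_nd : {homo F : x y / x <= y} := distr_fun_nd lfF.
Let F_ge0 : forall x, 0 <= F x := distr_fun_ge0 FF.
Let rF : regular F := regular_nondecreasing F_nd.

Variables (W : set (mR * mR)) (z V : R).
Hypotheses (mW : measurable W) (z0 : 0 <= z) (WV : nu2 W = V%:E).
Let V0 : 0 <= V. Proof. by rewrite -lee_fin -WV. Qed.
Let D : set (mR * mR * mR) := W `*` `]0, z]%classic.
Let mD : measurable D. Proof. by apply: measurableX => //; exact: measurable_itv. Qed.

Variables (I : finType) (cI : I -> R * R) (aI : I -> R) (dl : R).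
Hypotheses (dl0 : 0 < dl) (dl1 : dl <= 1) (aI0 : forall i, 0 <= aI i).

Definition cube i : set (mR * mR * mR) :=
  (`[(cI i).1, (cI i).1 + dl[%classic `*` `[(cI i).2, (cI i).2 + dl[%classic) `*`
  `[aI i, aI i + dl[%classic.

Hypothesis cover : forall p, D p -> exists i, cube i p.
Hypothesis disjoint : forall i j p, cube i p -> cube j p -> i = j.

(* The margin makes the paraboloid [gap i] lie below every point of [cube i],
   so that a point of [cube i] lying in its own cell forces [gap i] to be empty. *)
Definition margin : R := dl * (4 * z + 7).
Let margin_gt0 : 0 < margin. Proof. by rewrite mulr_gt0//; move: z0; lra. Qed.

Definition piece i := D `&` cube i.
Definition gap i : set (mR * mR * mR) := par (cI i) (aI i - margin).
(** A discrete substitute for the event that the cube holds a point lying in its own cell. It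
    involves two disjoint sets, one hit and one empty, so its probability is explicit. *)
Definition grid_ev i := hit eta (piece i) `&` ~` hit eta (gap i).
Definition grid_count (w : Omega) : R := \sum_i \1_(grid_ev i) w.

Lemma norm_le_sqr (t s : R) : 0 <= s -> t ^+ 2 <= s -> `|t| <= s + 1.
Proof.
move=> s0 ts; have ts' : `|t| ^+ 2 <= s by rewrite real_normK ?num_real.
rewrite -(ler_pXn2r (n := 2)) ?nnegrE ?addr_ge0//; apply: (le_trans ts').
by rewrite sqrrD expr1n; have := sqr_ge0 s; lra.
Qed.

(** Coordinate distances are at most s + 1, so a shift by [dl] changes each square by at most dl (2
    s + 3). The definition of [margin] adds one further [dl] to the sum of the two changes, for the
    height of the cube. *)
Lemma cost_move (x c : R * R) (q : R * R * R) s : 0 <= s -> 0 <= q.2 -> cost x q <= s ->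
  `|x.1 - c.1| <= dl -> `|x.2 - c.2| <= dl -> cost c q <= cost x q + dl * (4 * s + 6).
Proof.
move=> s0 q0; rewrite /cost => cs x1 x2.
have st (t u : R) : 0 <= u -> t ^+ 2 + u + q.2 <= s -> `|t| <= s + 1.
  by move=> u0 ts; apply: norm_le_sqr => //; lra.
have mv (a b t : R) : `|a - b| <= dl -> `|a - t| <= s + 1 ->
    (b - t) ^+ 2 <= (a - t) ^+ 2 + dl * (2 * s + 3).
  move=> ab at_.
  have -> : (b - t) ^+ 2 = (a - t) ^+ 2 + (- 2 * (a - b) * (a - t) + (a - b) ^+ 2) by ring.
  rewrite lerD2l.
  have h1 : - 2 * (a - b) * (a - t) <= 2 * (dl * (s + 1)).
    have : `|(a - b) * (a - t)| <= dl * (s + 1) by rewrite normrM; exact: ler_pM.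
    by rewrite ler_norml -mulrA; move: ((a - b) * (a - t)) (dl * (s + 1)) => u v /andP[]; lra.
  have h2 : (a - b) ^+ 2 <= dl * 1.
    rewrite -real_normK ?num_real// expr2; apply: ler_pM => //; exact: le_trans dl1.
  by move: h1 h2; rewrite !mulrDr !mulr1; lra.
have := mv _ _ q.1.1 x1 (st _ _ (sqr_ge0 (x.2 - q.1.2)) cs).
have h : (x.2 - q.1.2) ^+ 2 + (x.1 - q.1.1) ^+ 2 + q.2 <= s by move: cs; lra.
have := mv _ _ q.1.2 x2 (st _ _ (sqr_ge0 (x.1 - q.1.1)) h).
by rewrite !mulrDr; lra.
Qed.

Lemma cube_near i (p : mR * mR * mR) : cube i p -> [/\ `|(cI i).1 - p.1.1| <= dl,
  `|(cI i).2 - p.1.2| <= dl, aI i <= p.2 & p.2 <= aI i + dl].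
Proof.
move=> [[/= + +] /=]; rewrite !in_itv/= => /andP[h1 h2] /andP[h3 h4] /andP[h5 h6].
by split; [rewrite ler_norml; apply/andP; split; lra|rewrite ler_norml; apply/andP; split; lra|
  exact: h5|exact: ltW].
Qed.

Let mcube i : measurable (cube i).
Proof. by apply: measurableX; [apply: measurableX|]; exact: measurable_itv. Qed.
Let mpiece i : measurable (piece i). Proof. exact: measurableI. Qed.
Let mgap i : measurable (gap i). Proof. exact: measurable_par. Qed.
Let mev i : measurable (grid_ev i).
Proof. by apply: measurableI; [|apply: measurableC]; exact: (measurable_hit hP). Qed.

Let piece_gap i : piece i `&` gap i = set0.
Proof.
rewrite -subset0 => p [[_ /cube_near[_ _ h _]] [_ ps]].
by have := le_trans (cost_ge_weight (cI i) p) ps; move: margin_gt0 h; lra.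
Qed.

Let FFz : FF `]0, z]%classic = (F z)%:E.
Proof. by rewrite /distr_fun fineK// ge0_fin_numE//; exact: locally_finite_itv. Qed.

Let LamD : Lam D = (V * F z)%:E.
Proof. by rewrite intensity_setX// WV EFinM -FFz. Qed.

Let square (c : R * R) (r : R) : set (mR * mR) :=
  `[c.1 - r, c.1 + r]%classic `*` `[c.2 - r, c.2 + r]%classic.

Let msquare c r : measurable (square c r).
Proof. by apply: measurableX; exact: measurable_itv. Qed.

Let mslab c r : measurable (D `&` (square c r `*` setT)).
Proof. by apply: measurableI => //; apply: measurableX. Qed.

Let Lam_square c r : 0 <= r ->
  (Lam (D `&` (square c r `*` setT)) <= ((2 * r) ^+ 2 * F z)%:E)%E.
Proof.
move=> r0.
have lI (x : R) : lebesgue_measure (`[x - r, x + r]%classic : set mR) = (2 * r)%:E.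
  rewrite lebesgue_measure_itv/= lte_fin; case: ltP => h.
    by rewrite -EFinB; congr _%:E; ring.
  by rewrite (_ : r = 0) ?mulr0//; move: h r0; lra.
apply: (@le_trans _ _ (Lam (square c r `*` `]0, z]%classic))).
  apply: le_measure; rewrite ?inE//.
  - by apply: measurableX => //; exact: measurable_itv.
  - by move=> p [[_ h1] [h2 _]]; split.
rewrite (intensity_setX FF (msquare c r) (measurable_itv _)).
by rewrite /square nu2_setX// (lI c.1) (lI c.2) [X in (_ * X)%E]FFz -!EFinM lee_fin expr2.
Qed.

Let lam i := fine (Lam (piece i)).
Let LamE i : Lam (piece i) = (lam i)%:E.
Proof.
rewrite /lam fineK// ge0_fin_numE//; apply: (@le_lt_trans _ _ (Lam D)).
  by apply: le_measure; rewrite ?inE// => p [].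
by rewrite LamD ltry.
Qed.
Let lam_ge0 i : 0 <= lam i. Proof. exact: fine_ge0. Qed.

Let lam_le i : lam i <= 4 * dl * F z.
Proof.
rewrite -lee_fin -LamE; apply: (@le_trans _ _ (Lam (D `&` (square (cI i) dl `*` setT)))).
  apply: le_measure; rewrite ?inE//.
  move=> p [Dp /cube_near[h1 h2 _ _]]; split => //; split => //.
  by split => /=; rewrite in_itv/= -ler_distl distrC.
apply: (le_trans (Lam_square (cI i) (ltW dl0))).
rewrite lee_fin ler_wpM2r//.
have : dl * dl <= dl * 1 by rewrite ler_wpM2l// ltW.
by rewrite exprMn !expr2; move: (dl * dl) => u; lra.
Qed.

(** The first term bounds the change of pi times the primitive of F from the apex of the gap to the
    top of the cube, a height difference of dl + margin; the second bounds the mean number of points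
    in a cube, which measures how far 1 - exp(-a) is from a. *)
Definition grid_error : R := pi * F (z + 1) * (dl + margin) + 4 * dl * F z.

Let decay i := (\int[Lam]_(p in piece i) (exprim F p.2)%:E)%E.

Let exprim_noninc x y : x <= y -> exprim F y <= exprim F x.
Proof. by move=> xy; exact: exprim_ni. Qed.

Let ev_prob i : P (grid_ev i) = ((1 - expR (- lam i)) * exprim F (aI i - margin))%:E.
Proof.
have Lg : (Lam (gap i) < +oo)%E by rewrite /gap intensity_par// ltry.
have Lp : (Lam (piece i) < +oo)%E by rewrite LamE ltry.
rewrite (hit_void_indep hP (mpiece i) (mgap i) (piece_gap i)).
rewrite (poisson_hit hP (mpiece i) Lp) (poisson_void hP (mgap i) Lg).
by have /= -> := intensity_par lfF (cI i) (aI i - margin); rewrite -EFinM exprimE mulNr.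
Qed.

Let mdecay : measurable_fun setT (fun p : mR * mR * mR => (exprim F p.2)%:E).
Proof.
apply/measurable_EFinP; apply: (measurableT_comp _ (@measurable_snd _ _ (mR * mR)%type mR)).
by have [] : regular (exprim F) by exact: regular_exprim.
Qed.

(** As for shells: the probability is (1 - exp(- lam i)) times e at the apex of the gap, the
    integral lies between lam i times the values of e at the top and the bottom of the cube, and
    these values differ by factors controlled by [grid_error]. *)
Let ev_bounds i : exists r, [/\ decay i = r%:E,
  expR (- grid_error) * r <= fine (P (grid_ev i)) & fine (P (grid_ev i)) <= expR grid_error * r].
Proof.
have ppi := pi_ge0 R.
have up : (decay i <= (lam i * exprim F (aI i))%:E)%E.
  rewrite EFinM -LamE muleC -integral_cst//; apply: ge0_le_integral => //.
  - by move=> p _; rewrite lee_fin exprim_ge0.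
  - exact: measurable_funTS.
  - by move=> p [_ /cube_near[_ _ h _]]; rewrite lee_fin; exact: exprim_noninc.
have lo : ((lam i * exprim F (aI i + dl))%:E <= decay i)%E.
  rewrite EFinM -LamE muleC -integral_cst//; apply: ge0_le_integral => //.
  - by move=> p _; rewrite lee_fin exprim_ge0.
  - exact: measurable_funTS.
  - by move=> p [_ /cube_near[_ _ _ h]]; rewrite lee_fin; exact: exprim_noninc.
have [e0|] := eqVneq (piece i) set0.
  exists 0; rewrite !mulr0 /decay e0 integral_set0; split => //.
    exact: fine_ge0.
  by rewrite ev_prob /lam e0 measure0/= oppr0 expR0 subrr mul0r.
move=> /set0P[p [[_ zp] /cube_near[_ _ ap _]]].
have az : aI i <= z by move: zp => /=; rewrite in_itv/= => /andP[_]; exact: le_trans.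
have pb : prim F (aI i + dl) - prim F (aI i - margin) <= F (z + 1) * (dl + margin).
  have Fb x : x <= aI i + dl -> F x <= F (z + 1).
    by move=> xa; apply: F_nd; apply: (le_trans xa); apply: lerD.
  have a1 : 0 <= aI i + dl by rewrite addr_ge0// ltW.
  have [am|am] := leP 0 (aI i - margin).
    have aa : aI i - margin <= aI i + dl by move: margin_gt0 dl0; lra.
    apply: le_trans (prim_ub rF am aa (fun x _ => @Fb x)) _.
    by rewrite (_ : aI i + dl - (aI i - margin) = dl + margin)//; ring.
  have h := prim_ub rF (lexx 0) a1 (fun x _ => @Fb x).
  rewrite (prim_neg F am); move: h; rewrite prim0 => h; apply: (le_trans h).
  by rewrite ler_wpM2l//; move: am; lra.
rewrite ev_prob /=; move: up lo (lam_ge0 i) (lam_le i).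
have := @exprim_noninc (aI i - margin) (aI i) ltac:(move: margin_gt0; lra).
have : exprim F (aI i - margin) <= expR (pi * F (z + 1) * (dl + margin)) * exprim F (aI i + dl).
  by rewrite !exprimE -expRD ler_expR; move: (ler_wpM2l ppi pb); rewrite mulrBr !mulNr !mulrA; lra.
have k1 : 0 <= pi * F (z + 1) * (dl + margin).
  by rewrite !mulr_ge0// addr_ge0// ltW// margin_gt0.
have k2 : 0 <= 4 * dl * F z by rewrite !mulr_ge0// ltW.
have := exprim_ge0 F (aI i + dl); have := exprim_ge0 F (aI i - margin).
move: k1 k2; rewrite /grid_error.
move: (pi * F (z + 1) * _) (4 * dl * F z) (exprim F (aI i - margin)) (exprim F (aI i))
  (exprim F (aI i + dl)) (lam i) (decay i) => k1 k2 x x0 x' l [r||]//= k10 k20 xx0 x'0 xx' x0x.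
rewrite !lee_fin => up lo l0 lk; exists r; split => //.
  apply: (@le_trans _ _ (expR (- l) * (l * x))).
    apply: ler_pM; [exact: expR_ge0|by apply: le_trans lo; exact: mulr_ge0| |].
      by rewrite ler_expR lerN2; move: k10 lk; lra.
    by apply: (le_trans up); exact: ler_wpM2l.
  rewrite mulrA ler_wpM2r//.
  have h : expR (- l) * expR l = 1 by rewrite -expRD addNr expR0.
  have : expR (- l) * (1 + l) <= expR (- l) * expR l by rewrite ler_wpM2l ?expR_ge0// expR_ge1Dx.
  by rewrite h mulrDr mulr1; lra.
apply: (@le_trans _ _ (l * x)).
  by rewrite ler_wpM2r//; have := expR_ge1Dx (- l); lra.
apply: (@le_trans _ _ (expR k1 * (l * x'))); first by rewrite mulrCA ler_wpM2l.
apply: ler_pM; [exact: expR_ge0|exact: mulr_ge0| |exact: lo].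
by rewrite ler_expR; lra.
Qed.

Let sum_piece (g : I -> R) i p : piece i p -> \sum_j g j * \1_(piece j) p = g i.
Proof.
move=> [Dp ip]; rewrite (bigD1 i)//= big1 => [|j ji].
  by rewrite indicE mem_set// mulr1 addr0.
rewrite indicE memNset ?mulr0// => -[_ jp].
by move: ji; rewrite (disjoint jp ip) eqxx.
Qed.

Let sum_piece0 (g : I -> R) p : ~ D p -> \sum_j g j * \1_(piece j) p = 0.
Proof. by move=> nD; apply: big1 => j _; rewrite indicE memNset ?mulr0// => -[]. Qed.

(** As the cubes are disjoint and cover D, weighted sums over pieces become one integral of a step
    function; the totals and the bound on neighbours all follow from this. *)
Let sum_integral (g : I -> R) (f : mR * mR * mR -> \bar R) : (forall j, 0 <= g j) ->
  measurable_fun setT f -> (forall p, 0 <= f p)%E ->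
  (\sum_j (g j)%:E * \int[Lam]_(p in piece j) f p =
   \int[Lam]_p ((\sum_j g j * \1_(piece j) p)%:E * f p))%E.
Proof.
move=> g0 mf f0.
have mi j : measurable_fun setT (fun p => (\1_(piece j) p)%:E : \bar R).
  exact/measurable_EFinP/measurable_indic.
transitivity (\sum_j \int[Lam]_p ((g j)%:E * ((\1_(piece j) p)%:E * f p)))%E.
  apply: eq_bigr => j _; rewrite integral_mkcond ge0_integralZl ?lee_fin//.
  - congr (_ * _)%E; apply: eq_integral => p _; rewrite patchE indicE.
    by case: ifPn => _; rewrite ?mul1e ?mul0e.
  - exact: emeasurable_funM.
  - by move=> p _; rewrite mule_ge0// lee_fin.
rewrite -ge0_integral_sum//.
- apply: eq_integral => p _; rewrite -sumEFin ge0_sume_distrl.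
    by apply: eq_bigr => j _; rewrite EFinM muleA.
  by move=> j _; rewrite lee_fin mulr_ge0.
- by move=> j; apply: measurable_funeM; exact: emeasurable_funM.
- by move=> j p _; rewrite !mule_ge0// lee_fin.
Qed.

Notation intens := (stieltjes FF (exprim F) z).

Let sum_coveredE (g : mR * mR * mR -> \bar R) p :
  ((\sum_j 1 * \1_(piece j) p)%:E * g p)%E = (g \_ D) p.
Proof.
rewrite patchE; case: ifPn; rewrite ?inE ?notin_setE => Dp.
  have [i ip] := cover Dp; rewrite (@sum_piece _ i)//; exact: mul1e.
by rewrite sum_piece0// mul0e.
Qed.

Let total_decay : (\sum_i decay i = (intens * V)%:E)%E.
Proof.
transitivity (\int[Lam]_(p in D) (exprim F p.2)%:E)%E.
  rewrite [RHS]integral_mkcond -(eq_integral _ _ (fun p _ => sum_coveredE (fun p => (exprim F p.2)%:E) p)).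
  rewrite -(@sum_integral (fun=> 1))//; first by apply: eq_bigr => j _; rewrite mul1e.
  by move=> p; rewrite lee_fin exprim_ge0.
pose J : set mR := `]0, z]%classic.
have mJ : measurable J by exact: measurable_itv.
have mF : measurable_fun setT (fun h : mR => (exprim F h)%:E).
  by apply/measurable_EFinP; have [] : regular (exprim F) by exact: regular_exprim.
have rE : regular (exprim F) by exact: regular_exprim.
rewrite integral_mkcond integral_intensity.
- transitivity (\int[FF]_h (V%:E * ((fun h : mR => (exprim F h)%:E) \_ J) h))%E.
    apply: eq_integral => h _; rewrite -WV -[X in (nu2 X * _)%E](setIT W) -integral_indic// muleC.
    rewrite -ge0_integralZl//; last 2 first.
    + exact/measurable_EFinP/measurable_indic.
    + by rewrite patchE; case: ifPn => _ //; rewrite lee_fin exprim_ge0.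
    apply: eq_integral => x _; rewrite !patchE indicE in_setX/=.
    by case: (x \in W); case: (h \in _) => /=; rewrite ?mule1 ?mule0.
  rewrite ge0_integralZl//.
  + rewrite -integral_mkcond mulrC EFinM; congr (_ * _)%E.
    rewrite stieltjes.unlock /Rintegral fineK//.
    by apply: integrable_fin_num => //; exact: stieltjes_integrable.
  + by apply/(measurable_restrictT _ mJ); exact: measurable_funTS.
  + by move=> h _; rewrite patchE; case: ifPn => _ //; rewrite lee_fin exprim_ge0.
- by apply/(measurable_restrictT _ mD); exact: measurable_funTS.
- by move=> p; rewrite patchE; case: ifPn => _ //; rewrite lee_fin exprim_ge0.
Qed.

Let lam_integral j : (\int[Lam]_(p in piece j) (fun=> 1%:E) p = (lam j)%:E)%E.
Proof. by rewrite integral_cst// mul1e -LamE. Qed.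

Let total_lam : \sum_i lam i = V * F z.
Proof.
apply: EFin_inj; rewrite -LamD -sumEFin.
transitivity (\sum_j 1%:E * \int[Lam]_(p in piece j) (fun=> 1%:E) p)%E.
  by apply: eq_bigr => j _; rewrite lam_integral mul1e.
rewrite (@sum_integral (fun=> 1))//.
rewrite (eq_integral _ _ (fun p _ => sum_coveredE (fun=> 1%:E) p)) -integral_mkcond.
by rewrite integral_cst// mul1e.
Qed.

(** A nonempty piece and its gap lie within z + 1 of the corner in each coordinate, since the gap
    has its apex below z. Pairs further apart than 2 (z + 1) therefore involve disjoint sets. *)
Let near i j := (`|(cI i).1 - (cI j).1| <= 2 * (z + 1)) && (`|(cI i).2 - (cI j).2| <= 2 * (z + 1)).

Let range : R := 2 * (z + 1) + 1.
Let range_ge0 : 0 <= range. Proof. by rewrite /range; move: z0; lra. Qed.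

(** The pieces near i lie over a square of fixed size, the extra 1 in [range] accounting for the
    side of a cube; hence the bound is uniform in the mesh. *)
Let near_sum i : \sum_(j | near i j) lam j <= (2 * range) ^+ 2 * F z.
Proof.
rewrite -lee_fin; apply: le_trans (Lam_square (cI i) range_ge0).
have mS := mslab (cI i) range.
rewrite -[X in (_ <= Lam X)%E]setIT -integral_indic//.
rewrite -sumEFin big_mkcond/=.
rewrite (eq_bigr (fun j => (near i j)%:R%:E * \int[Lam]_(p in piece j) (fun=> 1%:E) p)%E); last first.
  by move=> j _; rewrite lam_integral; case: ifP => _; rewrite ?mul1e ?mul0e.
rewrite (@sum_integral (fun j => (near i j)%:R))//.
apply: ge0_le_integral => //.
- by move=> p _; rewrite mule1 lee_fin sumr_ge0// => j _; rewrite mulr_ge0.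
- apply: emeasurable_funM => //; apply/measurable_EFinP; apply: measurable_sum => j.
  by apply: measurable_funM => //; exact: measurable_indic.
- by apply/measurable_EFinP/measurable_indic; exact: mslab.
- move=> p _; rewrite mule1 lee_fin; have [Dp|Dp] := pselect (D p); last first.
    by rewrite sum_piece0.
  have [j jp] := cover Dp; rewrite (@sum_piece _ j)//.
  case nij: (near i j) => //; rewrite indicE mem_set//; split => //; split => //.
  have [h1 h2 _ _] := cube_near jp; move/andP: nij => [n1 n2].
  have H (a b x : R) : `|a - b| <= 2 * (z + 1) -> `|b - x| <= dl -> `|x - a| <= range.
    move=> ab bx; rewrite distrC; apply: (le_trans (ler_distD b _ _)).
    by rewrite /range; move: dl1; lra.
  by split => /=; rewrite in_itv/= -ler_distl; [exact: H n1 h1|exact: H n2 h2].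
Qed.

Let e i := fine (P (grid_ev i)).
Let PE i : P (grid_ev i) = (e i)%:E.
Proof. by rewrite /e fineK// fin_num_measure. Qed.
Let e_ge0 i : 0 <= e i. Proof. exact: fine_ge0. Qed.

(** Three cases: equal indices give the event itself; for near ones the gaps are dropped and the
    disjoint pieces are independent; for the others all four sets are disjoint and the events are
    independent. *)
Let pair_bound i j : (P (grid_ev i `&` grid_ev j) <=
  ((i == j)%:R * e i + e i * e j + (near i j)%:R * (lam i * lam j))%:E)%E.
Proof.
have rhs0 : 0 <= (i == j)%:R * e i + e i * e j + (near i j)%:R * (lam i * lam j).
  by rewrite !addr_ge0// !mulr_ge0.
have ev0 k : piece k = set0 -> grid_ev k = set0.
  by rewrite /grid_ev => ->; rewrite -subset0 => w [[p]].
have [/ev0 ->|/set0P pi0] := eqVneq (piece i) set0; first by rewrite set0I measure0 lee_fin.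
have [/ev0 ->|/set0P pj0] := eqVneq (piece j) set0; first by rewrite setI0 measure0 lee_fin.
have {rhs0} [<-|ij] := eqVneq i j.
  rewrite setIid PE lee_fin mul1r -addrA lerDl addr_ge0// ?mulr_ge0//.
rewrite mul0r add0r; case nij: (near i j).
  rewrite mul1r; apply: (@le_trans _ _ (P (hit eta (piece i) `&` hit eta (piece j)))).
    apply: le_measure; rewrite ?inE; [exact: measurableI| |by move=> w [[? _] [? _]]].
    by apply: measurableI; exact: (measurable_hit hP).
  have pij : piece i `&` piece j = set0.
    by rewrite -subset0 => p [[_ ip] [_ jp]]; move: ij; rewrite (disjoint ip jp) eqxx.
  have L k : (Lam (piece k) < +oo)%E by rewrite LamE ltry.
  have hk k : (P (hit eta (piece k)) <= (lam k)%:E)%E.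
    rewrite (poisson_hit hP (mpiece k) (L k)) -/(lam k) lee_fin.
    by have := expR_ge1Dx (- lam k); lra.
  rewrite (hit_hit_indep hP (mpiece i) (mpiece j) pij).
  apply: (@le_trans _ _ ((lam i)%:E * (lam j)%:E)%E); first by apply: lee_pmul; [exact: measure_ge0|exact: measure_ge0|exact: hk|exact: hk].
  by rewrite -EFinM lee_fin lerDr mulr_ge0.
rewrite mul0r addr0 EFinM -!PE.
rewrite (hit_void_indep2 hP (mpiece i) (mgap i) (mpiece j) (mgap j) (piece_gap i) (piece_gap j))//.
have H k (p : mR * mR * mR) : piece k !=set0 -> (piece k `|` gap k) p ->
    `|(cI k).1 - p.1.1| <= z + 1 /\ `|(cI k).2 - p.1.2| <= z + 1.
  move=> [r [[_ zr] /cube_near[_ _ ar _]]].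
  have az : aI k <= z by move: zr => /=; rewrite in_itv/= => /andP[_]; exact: le_trans.
  have dz : dl <= z + 1 by apply: (le_trans dl1); rewrite lerDr.
  move=> [[_ /cube_near[h1 h2 _ _]]|[p0]]; first by split; exact: le_trans dz.
  rewrite /cost; move: margin_gt0 (sqr_ge0 ((cI k).1 - p.1.1)) (sqr_ge0 ((cI k).2 - p.1.2)) => m0 s1 s2 cs.
  have p0' : 0 < (p.2 : R) := p0.
  by split; apply: norm_le_sqr => //; move: az m0 s1 s2 cs p0';
    move: (_ ^+ 2) (_ ^+ 2) (p.2 : R) => *; lra.
rewrite -subset0 => p [/(H _ _ pi0)[i1 i2] /(H _ _ pj0)[j1 j2]].
have T (a b x : R) : `|a - x| <= z + 1 -> `|b - x| <= z + 1 -> `|a - b| <= 2 * (z + 1).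
  by move=> ax bx; apply: (le_trans (ler_distD x _ _)); rewrite (distrC x); lra.
by move: nij; rewrite /near (T _ _ _ i1 j1) (T _ _ _ i2 j2).
Qed.

Definition grid_mean : R := \sum_i e i.

Lemma grid_mean_bounds : expR (- grid_error) * (intens * V) <= grid_mean /\
  grid_mean <= expR grid_error * (intens * V).
Proof.
have H i : exists r, [/\ decay i = r%:E,
  expR (- grid_error) * r <= e i & e i <= expR grid_error * r] := ev_bounds i.
pose r i := fine (decay i).
have rE i : decay i = (r i)%:E by rewrite /r; have [s [-> _ _]] := H i.
have tr : \sum_i r i = intens * V.
  by apply: EFin_inj; rewrite -total_decay -sumEFin; apply: eq_bigr => i _; rewrite rE.
rewrite -tr /grid_mean !mulr_sumr; split; apply: ler_sum => i _;
  by have [s [+ h1 h2]] := H i; rewrite rE => -[->].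
Qed.

Lemma measurable_grid_count : measurable_fun setT grid_count.
Proof. by apply: measurable_sum => i; exact: measurable_indic. Qed.

Lemma grid_count_ge0 w : 0 <= grid_count w.
Proof. by apply: sumr_ge0. Qed.

Lemma grid_expectation : (\int[P]_w (grid_count w)%:E = grid_mean%:E)%E.
Proof.
under eq_integral do rewrite /grid_count -sumEFin.
rewrite ge0_integral_sum//.
- rewrite /grid_mean -sumEFin; apply: eq_bigr => i _.
  by rewrite integral_indic// setIT -PE.
- by move=> i; exact/measurable_EFinP/measurable_indic.
Qed.

Lemma grid_second_moment : (\int[P]_w ((grid_count w)%:E * (grid_count w)%:E) <=
  (grid_mean ^+ 2 + (grid_mean + (2 * range) ^+ 2 * F z * (V * F z)))%:E)%E.
Proof.
have -> : (\int[P]_w ((grid_count w)%:E * (grid_count w)%:E) =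
    \sum_i \sum_j P (grid_ev i `&` grid_ev j))%E.
  transitivity (\int[P]_w \sum_i \sum_j (\1_(grid_ev i `&` grid_ev j) w)%:E)%E.
    apply: eq_integral => w _; rewrite -EFinM /grid_count big_distrlr/= -sumEFin.
    by apply: eq_bigr => i _; rewrite -sumEFin; apply: eq_bigr => j _; rewrite indicI.
  have mij i j : measurable_fun setT (fun w => (\1_(grid_ev i `&` grid_ev j) w)%:E : \bar R).
    by apply/measurable_EFinP/measurable_indic; exact: measurableI.
  rewrite ge0_integral_sum//.
  - apply: eq_bigr => i _; rewrite ge0_integral_sum//.
    by apply: eq_bigr => j _; rewrite integral_indic ?setIT//; exact: measurableI.
  - by move=> i; apply: emeasurable_sum => j.
  - by move=> i w _; apply: sume_ge0 => j _; rewrite lee_fin.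
apply: (@le_trans _ _ (\sum_i \sum_j
    ((i == j)%:R * e i + e i * e j + (near i j)%:R * (lam i * lam j))%:E)%E).
  by apply: lee_sum => i _; apply: lee_sum => j _; exact: pair_bound.
under eq_bigr do rewrite sumEFin.
rewrite sumEFin lee_fin.
under eq_bigr do rewrite 2!big_split/=.
rewrite 2!big_split/= addrC addrA addrAC -addrA addrC [leLHS]addrC.
have -> : \sum_i \sum_j (i == j)%:R * e i = grid_mean.
  apply: eq_bigr => i _; rewrite (bigD1 i)//= eqxx mul1r big1 ?addr0// => j ji.
  by rewrite eq_sym (negPf ji) mul0r.
have -> : \sum_i \sum_j e i * e j = grid_mean ^+ 2 by rewrite expr2 /grid_mean big_distrlr.
have : \sum_i \sum_j (near i j)%:R * (lam i * lam j) <= (2 * range) ^+ 2 * F z * (V * F z).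
  rewrite -total_lam mulr_sumr; apply: ler_sum => i _.
  apply: le_trans (ler_wpM2r (lam_ge0 i) (near_sum i)).
  rewrite mulr_suml [leRHS]big_mkcond/=; apply: ler_sum => j _.
  by case: (near i j); rewrite ?mul0r// mul1r mulrC.
by lra.
Qed.

End grid.

Lemma near_all_seq (T : eqType) (s : seq T) (Q : nat -> T -> Prop) :
  (forall x, x \in s -> \forall n \near \oo, Q n x) ->
  \forall n \near \oo, forall x, x \in s -> Q n x.
Proof.
elim: s => [_|x s IH H]; first exact: nearW.
have hx : \forall n \near \oo, Q n x by apply: H; rewrite inE eqxx.
have hs : \forall n \near \oo, forall y, y \in s -> Q n y.
  by apply: IH => y ys; apply: H; rewrite inE ys orbT.
by apply: filterS2 hx hs => n qx qs y; rewrite inE => /predU1P[->|/qs].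
Qed.

Lemma near_inv_succ_le (R : realType) (t : R) : 0 < t -> \forall m \near \oo, m.+1%:R^-1 <= t.
Proof.
move=> t0; have := near_infty_natSinv_lt (PosNum t0).
by apply: filterS => m /=; exact: ltW.
Qed.

Lemma limn_einf_ub (R : realType) (u : nat -> \bar R) (B : \bar R) :
  (forall n, (u n <= B)%E) -> (limn_einf u <= B)%E.
Proof.
move=> uB; rewrite limn_einf_lim; apply: lime_le; first exact: is_cvg_einfs.
by apply: nearW => n; apply: le_trans (uB n); apply: ereal_inf_lbound; exists n => //=.
Qed.

Section own_count.
Context (R : realType) d (Omega : measurableType d).
Notation mR := (measurableTypeR R).
Variables (P : probability Omega R) (FF : {sigma_finite_measure set mR -> \bar R}).
Variable eta : Omega -> set (R * R * R).
Hypothesis lfF : locally_finite_pos FF.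
Hypothesis conf : forall w, configuration (eta w).
Hypothesis hP : poisson_process P (intensity FF) eta.
Notation F := (distr_fun FF).
Let F_ge0 : forall x, 0 <= F x := distr_fun_ge0 FF.

Variables (W : set (mR * mR)) (z b V : R).
Hypotheses (mW : measurable W) (z0 : 0 <= z) (WV : nu2 W = V%:E) (V0 : 0 < V).
Hypothesis Wb : forall x, W x -> `|x.1| <= b /\ `|x.2| <= b.
Let D : set (mR * mR * mR) := W `*` `]0, z]%classic.

Definition own_count (w : Omega) : \bar R := (\esum_(p in eta w)
  (\1_W p.1 * \1_(`]0%R, z]%classic) p.2 * \1_(laguerre_cell p (eta w)) p.1)%:E)%E.

Let step (m : nat) : R := m.+1%:R^-1.
Let step0 m : 0 < step m. Proof. by rewrite invr_gt0. Qed.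
Let step1 m : step m <= 1. Proof. by rewrite invf_le1 ?ltr0n// ler1n. Qed.
(** For points of D the coordinates shifted by b lie in [0, 2 b] and the weights in (0, z]; the
    bound 2 b + z lets one index range serve all three axes. *)
Let size_ m := (Num.truncn (m.+1%:R * (2 * b + z))).+1.
Let I m : finType := ('I_(size_ m) * 'I_(size_ m) * 'I_(size_ m))%type.
Let cI m (i : I m) : R * R := (i.1.1%:R * step m - b, i.1.2%:R * step m - b).
Let aI m (i : I m) : R := i.2%:R * step m.
Let aI0 m (i : I m) : 0 <= aI i. Proof. by rewrite mulr_ge0// ltW. Qed.

Let coordinate m (x : R) : 0 <= x -> x <= 2 * b + z -> exists2 i : 'I_(size_ m),
  i%:R * step m <= x & x < i%:R * step m + step m.
Proof.
move=> x0 xb; have m0 : 0 < m.+1%:R :> R by [].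
have lt : (Num.truncn (m.+1%:R * x) < size_ m)%N.
  by rewrite ltnS; apply: le_truncn; rewrite ler_wpM2l.
exists (Ordinal lt) => /=.
  by rewrite ler_pdivrMr// mulrC truncn_le mulr_ge0.
rewrite -[X in _ + X]mul1r -mulrDl ltr_pdivlMr// mulrC -[X in _ + X]/(1%:R) -natrD addn1.
exact: truncnS_gt.
Qed.

Let coordinate_eq m (i j : 'I_(size_ m)) (x : R) : i%:R * step m <= x < i%:R * step m + step m ->
  j%:R * step m <= x < j%:R * step m + step m -> i = j.
Proof.
have s0 := step0 m.
have H (k l : nat) : k%:R * step m <= x -> x < l%:R * step m + step m -> (k <= l)%N.
  move=> h1 h2; have := le_lt_trans h1 h2.
  by rewrite -[X in _ + X]mul1r -mulrDl ltr_pM2r// -[X in _ + X]/(1%:R) -natrD addn1 ltr_nat.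
move=> /andP[i1 i2] /andP[j1 j2]; apply/val_inj/eqP.
by rewrite eqn_leq (H _ _ i1 j2) (H _ _ j1 i2).
Qed.

Let cover m p : D p -> exists i : I m, cube (@cI m) (@aI m) (step m) i p.
Proof.
move=> [Wp /=]; rewrite in_itv/= => /andP[p0 pz].
have [/=] := Wb Wp; rewrite !ler_norml => /andP[a1 a2] /andP[b1 b2].
have [|//|i i1 i2] := @coordinate m (p.1.1 + b); [by move: a1; lra|by move: a2 z0; lra|].
have [|//|j j1 j2] := @coordinate m (p.1.2 + b); [by move: b1; lra|by move: b2 z0; lra|].
have [|//|k k1 k2] := @coordinate m p.2; [exact: ltW|by move: pz a1 a2; lra|].
exists (i, j, k); split; last by rewrite /= in_itv/= /aI/=; apply/andP.
by split; rewrite /= in_itv/= /cI/=; apply/andP; split; lra.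
Qed.

Let disjoint m (i j : I m) p : cube (@cI m) (@aI m) (step m) i p ->
  cube (@cI m) (@aI m) (step m) j p -> i = j.
Proof.
case: i j => [[i1 i2] i3] [[j1 j2] j3] [[/= a1 a2] /= a3] [[/= c1 c2] /= c3].
move: a1 a2 a3 c1 c2 c3; rewrite !in_itv/= /cI /aI/= => a1 a2 a3 c1 c2 c3.
have sh (c x s : R) : c - b <= x < c - b + s -> c <= x + b < c + s.
  by move=> /andP[h1 h2]; apply/andP; split; lra.
by rewrite (coordinate_eq (sh _ _ _ a1) (sh _ _ _ c1)) (coordinate_eq (sh _ _ _ a2) (sh _ _ _ c2))
  (coordinate_eq a3 c3).
Qed.

Notation ev m := (grid_ev eta W z (@cI m) (@aI m) (step m)).
Let count m := grid_count eta W z (@cI m) (@aI m) (step m).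
Let mean m := grid_mean P eta W z (@cI m) (@aI m) (step m).

Let own (e : set (R * R * R)) : set (R * R * R) := [set p | laguerre_cell p e p.1].

Let ownP e p : own e p <-> forall q, e q -> p.2 <= cost p.1 q.
Proof.
have c0 : cost p.1 p = p.2 by rewrite /cost !subrr expr0n/= !add0r.
by split=> h q /h; rewrite !costE c0.
Qed.

Let finD w : finite_set (eta w `&` D).
Proof.
apply: sub_finite_set (finite_par (conf w) (0, 0) (2 * b ^+ 2 + z)).
move=> p [ep [Wp /=]]; rewrite in_itv/= => /andP[_ pz]; split => //=.
have [h1 h2] := Wb Wp; rewrite /cost/= !sub0r !sqrrN.
have sq (x : R) : `|x| <= b -> x ^+ 2 <= b ^+ 2.
  by move=> xb; rewrite -real_normK ?num_real// ler_pXn2r ?nnegrE// (le_trans _ xb).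
by have := sq _ h1; have := sq _ h2; move: pz; lra.
Qed.

Let own_countE w : own_count w =
  (\sum_(p <- finmap.enum_fset (fset_set (eta w `&` D))) (\1_(own (eta w)) p)%:E)%E.
Proof.
rewrite /own_count (eq_esum (b := fun p => if p \in D then (\1_(own (eta w)) p)%:E else 0%E)).
  rewrite -esum_mkcondr esum_fset//.
  by rewrite (fsbig_finite _ _ (finD w)).
move=> p _; rewrite !indicE in_setX/=.
by case: (p.1 \in W); case: (p.2 \in _); rewrite /= ?mul0r ?mul1r ?mul0r//;
  congr ((_ : bool)%:R%:E); apply/idP/idP; rewrite !inE.
Qed.

(** Two points in one cube differ by less than the mesh in each of three coordinates, and a
    configuration has finitely many points in D. *)
Let separate w : \forall m \near \oo, forall p q, (eta w `&` D) p -> (eta w `&` D) q -> p <> q ->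
  ~ exists i : I m, cube (@cI m) (@aI m) (step m) i p /\ cube (@cI m) (@aI m) (step m) i q.
Proof.
pose s := finmap.enum_fset (fset_set (eta w `&` D)).
have inS p : (eta w `&` D) p -> p \in s by move=> h; rewrite /s in_fset_set ?inE.
have : \forall m \near \oo, forall p, p \in s -> forall q, q \in s -> p <> q ->
    ~ exists i : I m, cube (@cI m) (@aI m) (step m) i p /\ cube (@cI m) (@aI m) (step m) i q.
  apply: near_all_seq => p _; apply: near_all_seq => q _.
  pose t := `|p.1.1 - q.1.1| + `|p.1.2 - q.1.2| + `|p.2 - q.2|.
  have [pq|/eqP pq] := eqVneq p q; first by apply: nearW.
  have t0 : 0 < t.
    rewrite lt_neqAle !addr_ge0// andbT eq_sym; apply/negP.
    rewrite /t paddr_eq0 ?addr_ge0// paddr_eq0// !normr_eq0 !subr_eq0 => /andP[/andP[/eqP e1 /eqP e2] /eqP e3].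
    by apply: pq; case: p q e1 e2 e3 {t} => [[p1 p2] p3] [[q1 q2] q3] /= -> -> ->.
  have t3 : 0 < t / 3 by rewrite divr_gt0.
  have := near_inv_succ_le t3; apply: filterS => m mt _ [i [[[/= a1 a2] /= a3] [[/= c1 c2] /= c3]]].
  move: a1 a2 a3 c1 c2 c3; rewrite !in_itv/= => a1 a2 a3 c1 c2 c3.
  have H (x y c : R) : c <= x < c + step m -> c <= y < c + step m -> `|x - y| < step m.
    by move: (step m) => st /andP[? ?] /andP[? ?]; rewrite ltr_norml; apply/andP; split; lra.
  have := H _ _ _ a1 c1; have := H _ _ _ a2 c2; have := H _ _ _ a3 c3.
  by move: mt; rewrite /t -/(step m) ler_pdivlMr//; lra.
by apply: filterS => m H p q /inS hp /inS hq; exact: H.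
Qed.

(** A point outside its own cell has a strictly cheaper competitor; with finitely many points the
    gain eventually exceeds the mesh times 8 z + 14, that is twice the margin. The excess puts the
    competitor inside the gap even after the location is moved to the corner of the cube. *)
Let foreign w : \forall m \near \oo, forall p, (eta w `&` D) p -> ~ own (eta w) p ->
  exists q, [/\ eta w q, 0 < q.2 & cost p.1 q + step m * (8 * z + 14) <= p.2].
Proof.
pose s := finmap.enum_fset (fset_set (eta w `&` D)).
have inS p : (eta w `&` D) p -> p \in s by move=> h; rewrite /s in_fset_set ?inE.
have : \forall m \near \oo, forall p, p \in s -> ~ own (eta w) p ->
    exists q, [/\ eta w q, 0 < q.2 & cost p.1 q + step m * (8 * z + 14) <= p.2].
  apply: near_all_seq => p _; have [op|op] := pselect (own (eta w) p); first exact: nearW.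
  have [q eq qp] : exists2 q, eta w q & cost p.1 q < p.2.
    apply: contrapT => h; apply: op; apply/ownP => q eq.
    by rewrite leNgt; apply/negP => qp; apply: h; exists q.
  have z8 : 0 < 8 * z + 14 by move: z0; lra.
  have t0 : 0 < (p.2 - cost p.1 q) / (8 * z + 14) by rewrite divr_gt0// subr_gt0.
  have := near_inv_succ_le t0; apply: filterS => m; rewrite -/(step m) ler_pdivlMr// => h _.
  by exists q; split => //; [exact: (conf w).1|move: h; lra].
by apply: filterS => m H p /inS; exact: H.
Qed.

(** For a fixed configuration the grid count is exact once the mesh is fine: cubes hold at most one
    point of D, a point in its own cell leaves the gap empty thanks to the margin, and any other
    point has a competitor in the gap by [foreign]. *)
Let count_eventually w : \forall m \near \oo, own_count w = (count m w)%:E.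
Proof.
apply: filterS2 (separate w) (foreign w) => m sep far.
rewrite own_countE sumEFin; congr _%:E; rewrite /count /grid_count.
set s := finmap.enum_fset _.
have us : uniq s by exact: finmap.fset_uniq.
have inS p : p \in s <-> (eta w `&` D) p.
  by rewrite /s in_fset_set; [rewrite inE|exact: finD].
transitivity (\sum_(p <- s) \sum_(i : I m)
    \1_(cube (@cI m) (@aI m) (step m) i) p * \1_(own (eta w)) p : R).
  rewrite big_seq [RHS]big_seq; apply: eq_bigr => p /inS[_ Dp].
  have [i ip] := cover m Dp; rewrite (bigD1 i)//= big1 => [|j ji].
    by rewrite [X in X * _]indicE mem_set// mul1r addr0.
  rewrite [X in X * _]indicE memNset ?mul0r// => jp.
  by move: ji; rewrite (disjoint jp ip) eqxx.
rewrite exchange_big/=; apply: eq_bigr => i _.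
have [[p [ps ip op]]|no] := pselect (exists p, [/\ p \in s, cube (@cI m) (@aI m) (step m) i p & own (eta w) p]).
  have [ep Dp] := (inS p).1 ps.
  rewrite (bigD1_seq p)//= big_seq_cond big1 => [|q /andP[qs qp]]; last first.
    rewrite [X in X * _]indicE memNset ?mul0r// => iq.
    apply: (sep q p); [exact/inS|exact/inS|by apply/eqP|by exists i].
  rewrite !indicE !mem_set// ?mul1r ?addr0//.
  split; first by exists p.
  move=> [q eq [q0 cq]]; have [n1 n2 ap _] := cube_near ip.
  have pz : p.2 <= z by move: Dp => [_ /=]; rewrite in_itv/= => /andP[].
  have opq := (ownP _ _).1 op q eq.
  have mg : 0 < step m * (4 * z + 7) by rewrite mulr_gt0//; move: z0; lra.
  have cz : cost (@cI m i) q <= z.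
    by apply: (le_trans cq); move: mg ap pz; rewrite /margin; lra.
  have := cost_move (step1 m) z0 (ltW q0) cz n1 n2.
  move: cq ap opq mg (step0 m); rewrite /margin !mulrDr.
  by move: (cost _ q) (cost _ q) (step m * (4 * z)) (aI i) (p.2 : R) => *; lra.
rewrite big_seq big1 => [|q qs]; last first.
  rewrite !indicE; case: (boolP (q \in cube _ _ _ _)) => [|_]; last by rewrite mul0r.
  rewrite inE => iq; case: (boolP (q \in own _)) => [|_]; last by rewrite mulr0.
  by rewrite inE => oq; case: no; exists q.
rewrite indicE memNset// => -[[p ep [Dp ip]] ng].
have ps : p \in s by exact/inS.
have op : ~ own (eta w) p by move=> op; apply: no; exists p.
have [q [eq q0 cq]] := far p (conj ep Dp) op.
have [n1 n2 _ pa] := cube_near ip.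
have pz : p.2 <= z by move: Dp => [_ /=]; rewrite in_itv/= => /andP[].
case: ng; exists q => //; split => //.
have mg : 0 < step m * (8 * z + 14) by rewrite mulr_gt0//; move: z0; lra.
have cz : cost p.1 q <= z by apply: le_trans pz; move: cq mg; lra.
have := cost_move (step1 m) z0 (ltW q0) cz (_ : `|p.1.1 - (@cI m i).1| <= _)
  (_ : `|p.1.2 - (@cI m i).2| <= _).
rewrite distrC => /(_ n1); rewrite distrC => /(_ n2).
move: cq pa (step0 m); rewrite /margin !mulrDr !mulrA.
have -> : step m * 8 * z = 2 * (step m * 4 * z) by ring.
by move: (cost _ q) (cost _ q) (step m * 4 * z) (aI i) (p.2 : R) => *; lra.
Qed.

Lemma own_count_fin w : own_count w \is a fin_num.
Proof. by have [m _ /(_ m (leqnn m)) ->] := count_eventually w. Qed.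

Let intens := stieltjes FF (exprim F) z.
Let intens_ge0 : 0 <= intens.
Proof.
by rewrite /intens stieltjes.unlock; apply: Rintegral_ge0 => h _; exact: exprim_ge0.
Qed.

Let err m := grid_error FF z (step m).

Let err_cvg0 : err m @[m --> \oo] --> (0 : R).
Proof.
rewrite (_ : err = fun m => (pi * F (z + 1) * (1 + (4 * z + 7)) + 4 * F z) * step m); last first.
  by apply/funext => m; rewrite /err /grid_error /margin; ring.
rewrite -[X in _ --> X](mulr0 (pi * F (z + 1) * (1 + (4 * z + 7)) + 4 * F z)).
by apply: cvgMr; exact: cvg_harmonic.
Qed.

Let err_le m : err m <= err 0%N.
Proof.
rewrite /err /grid_error /margin.
have -> : step 0 = 1 by rewrite /step invr1.
have h1 : 0 <= pi * F (z + 1) * (4 * z + 8).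
  by rewrite !mulr_ge0 ?pi_ge0//; move: z0; lra.
have h2 : 0 <= 4 * F z by rewrite mulr_ge0.
have s1 := step1 m.
have := ler_wpM2l h1 s1; have := ler_wpM2l h2 s1.
by lra.
Qed.

Let mean_bounds m : expR (- err m) * (intens * V) <= mean m /\
  mean m <= expR (err m) * (intens * V).
Proof. exact: (grid_mean_bounds lfF hP mW z0 WV (step0 m) (step1 m) (@aI0 m) (@cover m) (@disjoint m)). Qed.

Let mean_cvg : mean m / V @[m --> \oo] --> intens.
Proof.
have H (s : R -> R) : (s x @[x --> 0] --> s 0) -> s 0 = 0 ->
    expR (s (err m)) * intens @[m --> \oo] --> intens.
  move=> cs s0; rewrite -[X in _ --> X]mul1r; apply: cvgMl.
  rewrite -expR0 -s0; apply: continuous_cvg; first exact: continuous_expR.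
  by apply: (cvg_comp _ _ err_cvg0); exact: cs.
apply: (squeeze_cvgr (f := fun m => expR (- err m) * intens)
  (h := fun m => expR (err m) * intens)).
- apply: nearW => m; have [h1 h2] := mean_bounds m.
  by rewrite ler_pdivlMr// ler_pdivrMr// -!mulrA h1 h2.
- by apply: (H (fun x => - x)); [apply: cvgN; exact: cvg_id|rewrite oppr0].
- by apply: (H idfun) => //; exact: cvg_id.
Qed.

Let mcount m : measurable_fun setT (count m).
Proof. exact: (@measurable_grid_count _ _ _ _ _ _ hP W z mW (I m) (@cI m) (@aI m) (step m)). Qed.

Lemma measurable_own_count : measurable_fun setT own_count.
Proof.
apply: (emeasurable_fun_cvg (fun m w => (count m w)%:E)).
  by move=> m; exact/measurable_EFinP.
move=> w _; apply: cvg_near_cst; have := count_eventually w.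
by apply: filterS => m ->.
Qed.

(** Free of the mesh and of the window, as the strong law requires; [err 0%N], for mesh 1, dominates
    all the errors. *)
Definition own_variance : R := expR (err 0%N) * intens +
  (2 * (2 * (z + 1) + 1)) ^+ 2 * F z * F z.

Let grid_sqdist m : (\int[P]_w sqdist ((count m w)%:E * V^-1%:E) (mean m / V) <=
  (own_variance / V)%:E)%E.
Proof.
have c0 : 0 <= mean m / V.
  apply: divr_ge0; [apply: le_trans (mean_bounds m).1|exact: ltW].
  by apply: mulr_ge0; [exact: expR_ge0|apply: mulr_ge0 => //; exact: ltW].
have mV : mean m / V * V = mean m by rewrite divfK// gt_eqF.
apply: sqdist_second_moment => //.
- exact/measurable_EFinP.
- by move=> w; rewrite lee_fin; exact: grid_count_ge0.
- rewrite mV; exact: (@grid_expectation _ _ _ _ _ _ hP W z mW (I m) (@cI m) (@aI m) (step m)).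
rewrite mV; apply: (le_trans (grid_second_moment lfF hP mW z0 WV (step0 m) (step1 m) (@cover m) (@disjoint m))).
rewrite lee_fin lerD2l /own_variance [leRHS]mulrDl; apply: lerD.
  apply: (le_trans (mean_bounds m).2); rewrite mulrA; apply: ler_wpM2r; first exact: ltW.
  by apply: ler_wpM2r => //; rewrite ler_expR err_le.
by rewrite le_eqVlt; apply/orP; left; apply/eqP; ring.
Qed.

(** Fatou's lemma carries the bounds for the grids, uniform in m, over to the limit: at each w the
    grid count is eventually constant, and the normalised grid means converge to the intensity. *)
Lemma own_count_sqdist :
  (\int[P]_w sqdist (own_count w * V^-1%:E) intens <= (own_variance / V)%:E)%E.
Proof.
pose f m w := sqdist ((count m w)%:E * V^-1%:E) (mean m / V).
have mf m : measurable_fun setT (f m).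
  apply: measurable_sqdist; under eq_fun do rewrite -EFinM.
  by apply/measurable_EFinP; apply: measurable_funM.
have lim w : limn_einf (f^~ w) = sqdist (own_count w * V^-1%:E) intens.
  apply: (cvg_limn_einf_sup _).1.
  have [m0 _ H] := count_eventually w.
  have E : own_count w = (count m0 w)%:E by apply: H => /=.
  have -> : sqdist (own_count w * V^-1%:E)%E intens =
    ((count m0 w / V - intens) * (count m0 w / V - intens))%:E by rewrite E.
  have : (count m0 w / V - mean m / V) * (count m0 w / V - mean m / V) @[m --> \oo] -->
      (count m0 w / V - intens) * (count m0 w / V - intens).
    by apply: cvgM; apply: cvgB mean_cvg; exact: cvg_cst.
  move=> c; have : ((count m0 w / V - mean m / V) * (count m0 w / V - mean m / V))%:E @[m --> \oo] -->
      ((count m0 w / V - intens) * (count m0 w / V - intens))%:E.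
    by apply: cvg_EFin => //; exact: nearW.
  apply: cvg_trans; apply: near_eq_cvg; exists m0 => // m mm0.
  have Em : own_count w = (count m w)%:E by exact: H.
  have e : count m w = count m0 w by apply: EFin_inj; rewrite -Em.
  by rewrite /f /= e.
under eq_integral do rewrite -lim.
apply: (le_trans (fatou P measurableT mf _)); first by move=> m w _; exact: sqdist_ge0.
by apply: limn_einf_ub => m; exact: grid_sqdist.
Qed.

End own_count.

(** * Almost sure convergence *)

Section windows.
Variable R : realType.
Notation mR := (measurableTypeR R).
Variable W : nat -> set (R * R).
Hypothesis cW : convex_averaging W.

Let V n : R := fine (nu2 (W n)).

Lemma window_mono n m : (n <= m)%N -> W n `<=` W m.
Proof.
case: cW => Wn _ _ _ /subnK <-; elim: (m - n)%N => [//|k IH] x /IH; rewrite addSn; exact: Wn.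
Qed.

Lemma measurable_window n : measurable (W n : set (mR * mR)).
Proof. by case: cW => _ Wc _ _; exact: measurable_compact2. Qed.

Lemma window_bounded n : exists b : R, forall x, W n x -> `|x.1| <= b /\ `|x.2| <= b.
Proof.
case: cW => _ Wc _ _; have [M [_ HM]] := compact_bounded (Wc n).
exists (`|M| + 1) => x Wx; have Mb : M < `|M| + 1 by have := ler_norm M; lra.
by have /= := HM _ Mb x Wx; rewrite prod_normE ge_max => /andP[].
Qed.

Let square (c : R * R) (r : R) : set (mR * mR) :=
  `[c.1 - r, c.1 + r]%classic `*` `[c.2 - r, c.2 + r]%classic.

Let msquare c r : measurable (square c r).
Proof. by apply: measurableX; exact: measurable_itv. Qed.

Let nu2_square c r : 0 < r -> nu2 (square c r) = ((2 * r) ^+ 2)%:E.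
Proof.
move=> r0; have lI (x : R) : lebesgue_measure (`[x - r, x + r]%classic : set mR) = (2 * r)%:E.
  rewrite lebesgue_measure_itv/= lte_fin ifT; last by lra.
  by rewrite -EFinB; congr _%:E; ring.
by rewrite /square nu2_setX// (lI c.1) (lI c.2) -EFinM expr2.
Qed.

Lemma window_area n : nu2 (W n) = (V n)%:E.
Proof.
have [b Hb] := window_bounded n.
rewrite /V fineK// ge0_fin_numE//; apply: (@le_lt_trans _ _ (nu2 (square (0, 0) (`|b| + 1)))).
  apply: le_measure; rewrite ?inE//; first exact: measurable_window.
  move=> x /Hb[h1 h2]; have bb := ler_norm b.
  by split; rewrite /= in_itv/= sub0r add0r -ler_norml; [apply: (le_trans h1)|apply: (le_trans h2)]; lra.
by rewrite nu2_square ?ltry// ltr_wpDl.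
Qed.

Lemma window_area_nd n m : (n <= m)%N -> V n <= V m.
Proof.
move=> nm; rewrite -lee_fin -!window_area; apply: le_measure; rewrite ?inE;
  [exact: measurable_window..|exact: window_mono].
Qed.

(** A ball of radius larger than r contains the concentric square of side r. *)
Lemma window_area_ge n r : 0 < r -> r < inradius (W n) -> r ^+ 2 <= V n.
Proof.
move=> r0 rW; rewrite -lee_fin -window_area.
have [s [_ [x _ xs]] rs] : exists2 s, (0 <= s /\ exists2 x, W n x & eball x s `<=` W n) & r < s.
  apply: (sup_gt _ rW); apply/set0P/negP => /eqP e.
  by move: rW; rewrite /inradius e sup0 ltNge (ltW r0).
have r20 : 0 < r / 2 by rewrite divr_gt0.
rewrite (_ : r ^+ 2 = (2 * (r / 2)) ^+ 2); last by congr (_ ^+ 2); field.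
rewrite -(nu2_square x r20); apply: le_measure; rewrite ?inE//; first exact: measurable_window.
move=> y [/=]; rewrite !in_itv/= -!ler_distl => y1 y2; apply: xs.
rewrite /eball/= -(ltr_pXn2r (n := 2)) ?nnegrE ?sqrtr_ge0//; last exact/ltW/(lt_trans r0).
rewrite enorm_sqr/=; apply: (@lt_trans _ _ (r ^+ 2)); last first.
  by rewrite ltr_pXn2r ?nnegrE// ltW// (lt_trans r0).
have H (t u : R) : `|t - u| <= r / 2 -> (t - u) ^+ 2 <= r ^+ 2 / 4.
  move=> tu; rewrite -real_normK ?num_real//; apply: (@le_trans _ _ ((r / 2) ^+ 2)).
    by rewrite ler_pXn2r ?nnegrE// ltW.
  by rewrite le_eqVlt; apply/orP; left; apply/eqP; field.
have := H _ _ y1; have := H _ _ y2; have : 0 < r ^+ 2 by rewrite exprn_gt0.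
by move: (_ ^+ 2) (_ ^+ 2) (_ ^+ 2) => *; lra.
Qed.

Lemma window_area_cvg : V n @[n --> \oo] --> +oo.
Proof.
case: cW => _ _ _ inr; apply/cvgryPge => A.
have := inr; move/cvgryPgt/(_ (`|A| + 1)); apply: filterS => n An.
have A1 : 1 <= `|A| + 1 by rewrite lerDr.
have := window_area_ge (lt_le_trans ltr01 A1) An; apply: le_trans.
rewrite expr2; apply: (@le_trans _ _ (`|A| + 1)); first by have := ler_norm A; lra.
by rewrite ler_peMl// (le_trans ler01).
Qed.

End windows.

(** Continuity at z for a monotone F, stated with rational brackets because convergence is first
    obtained at rational points. *)
Definition narrow (R : realType) (F : R -> R) (z : R) := forall e, 0 < e ->
  exists x y : rat, [/\ 0 <= ratr x :> R, ratr x < z, z < ratr y & F (ratr y) - F (ratr x) <= e].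

Lemma discontinuity_or_narrow (R : realType) (F : R -> R) (z : R) :
  {homo F : x y / x <= y} -> 0 < z -> ~ discontinuity F z -> narrow F z.
Proof.
move=> Fnd z0 nd e e0.
have cl : cvg (F x @[x --> z^'-]).
  apply: nondecreasing_at_left_is_cvgr.
    by apply: nearW => x y w _ _; exact: Fnd.
  by apply: nearW => x; exists (F z) => _ [y /= + <-]; rewrite in_itv/= => /andP[_ /ltW]; exact: Fnd.
have cr : cvg (F x @[x --> z^'+]).
  apply: nondecreasing_at_right_is_cvgr.
    by apply: nearW => x y w _ _; exact: Fnd.
  by apply: nearW => x; exists (F z) => _ [y /= + <-]; rewrite in_itv/= => /andP[/ltW zy _]; exact: Fnd.
have LE : lim (F x @[x --> z^'-]) = lim (F x @[x --> z^'+]).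
  by apply/eqP; apply: contrapT => /negP h; apply: nd; split.
have e20 : 0 < e / 2 by rewrite divr_gt0.
have /cvgrPdist_le/(_ _ e20)[dl /= dl0 Hl] := cl.
have /cvgrPdist_le/(_ _ e20)[dr /= dr0 Hr] := cr.
have [|x] := @rat_in_itvoo R (Num.max 0 (z - dl)) z; first by rewrite gt_max z0/=; lra.
rewrite in_itv/= gt_max => /andP[/andP[x0 xd] xz].
have [|y] := @rat_in_itvoo R z (z + dr); first by lra.
rewrite in_itv/= => /andP[zy yd].
exists x, y; split=> //; first exact: ltW.
have bl : `|z - ratr x| < dl by rewrite ger0_norm; lra.
have br : `|z - ratr y| < dr by rewrite ler0_norm; lra.
have := Hl _ bl xz; have := Hr _ br zy; rewrite LE !ler_norml => /andP[a1 a2] /andP[b1 b2].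
by lra.
Qed.

(** The values at z are caught between those at two rationals, where convergence is known; the limit
    c varies between these by at most M times the variation of F, which is small by [narrow]. *)
Lemma monotone_cvg_dense (R : realType) (u : nat -> R -> R) (c F : R -> R) (M z : R) :
  0 <= M -> (\forall n \near \oo, forall x y, 0 <= x -> x <= y -> u n x <= u n y) ->
  (forall q : rat, 0 <= ratr q :> R -> u n (ratr q) @[n --> \oo] --> c (ratr q)) ->
  (forall x y, 0 <= x -> x <= y -> 0 <= c y - c x <= M * (F y - F x)) ->
  narrow F z -> u n z @[n --> \oo] --> c z.
Proof.
move=> M0 umono uq cF Fz; apply/cvgrPdist_le => e e0.
have e20 : 0 < e / 2 by rewrite divr_gt0.
have d0 : 0 < e / 2 / (M + 1) by rewrite divr_gt0// ltr_wpDl.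
have [x [y [x0 xz zy Fxy]]] := Fz _ d0.
have MF : M * (F (ratr y) - F (ratr x)) <= e / 2.
  apply: (@le_trans _ _ (M * (e / 2 / (M + 1)))); first by rewrite ler_wpM2l.
  rewrite mulrCA -[leRHS]mulr1; apply: ler_wpM2l; first exact: ltW.
  by rewrite ler_pdivrMr ?ltr_wpDl// mul1r lerDl.
have xy : ratr x <= ratr y :> R by exact/ltW/(lt_trans xz).
have z0 : 0 <= z by exact/(le_trans x0)/ltW.
have y0 : 0 <= ratr y :> R by exact: le_trans xy.
have /andP[cx0 _] := cF _ _ x0 (ltW xz).
have /andP[cy0 _] := cF _ _ z0 (ltW zy).
have /andP[_ cxy] := cF _ _ x0 xy.
have {}cxy := le_trans cxy MF.
have /cvgrPdist_le/(_ _ e20) ux := uq x x0.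
have /cvgrPdist_le/(_ _ e20) uy := uq y y0.
near=> n.
have um : forall x y, 0 <= x -> x <= y -> u n x <= u n y by near: n.
have := um _ _ x0 (ltW xz); have := um _ _ z0 (ltW zy).
have : `|c (ratr x) - u n (ratr x)| <= e / 2 by near: n.
have : `|c (ratr y) - u n (ratr y)| <= e / 2 by near: n.
rewrite !ler_norml => /andP[a1 a2] /andP[b1 b2] h1 h2; apply/andP; split; lra.
Unshelve. all: by end_near. Qed.

Lemma ae_countable (R : realType) d (Omega : measurableType d) (P : probability Omega R)
    (T : Type) (Z : set T) (Q : T -> Omega -> Prop) : countable Z ->
  (forall z, Z z -> {ae P, forall w, Q z w}) -> {ae P, forall w, forall z, Z z -> Q z w}.
Proof.
move=> /pfcard_geP[->|[f]] H; first by apply: aeW => w z.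
have : {ae P, forall w, forall k, Z (f k) -> Q (f k) w}.
  apply: ae_foralln => k; have [Zk|Zk] := pselect (Z (f k)).
    by apply: filterS (H _ Zk) => w Qw _.
  by apply: aeW => w /Zk.
by apply: filterS => w Hw z Zz; have [k _ <-] := 'surj_f Zz; apply: Hw; exact: funS.
Qed.

Lemma fine_scale (R : realType) (x : \bar R) (r : R) : fine (x * r%:E)%E = fine x * r.
Proof.
case: x => [s|//|//] //=; rewrite mul0r.
  by have [r0|r0|<-] := ltgtP 0 r; rewrite ?mule0//; [rewrite gt0_mulye|rewrite lt0_mulye].
by have [r0|r0|<-] := ltgtP 0 r; rewrite ?mule0//; [rewrite gt0_mulNye|rewrite lt0_mulNye].
Qed.

Section almost_sure.
Context (R : realType) d (Omega : measurableType d).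
Notation mR := (measurableTypeR R).
Variables (P : probability Omega R) (FF : {sigma_finite_measure set mR -> \bar R}).
Variables (eta : Omega -> set (R * R * R)) (W : nat -> set (R * R)).
Hypothesis lfF : locally_finite_pos FF.
Hypothesis FF_neq0 : FF setT <> 0%E.
Hypothesis conf : forall w, configuration (eta w).
Hypothesis hP : poisson_process P (intensity FF) eta.
Hypothesis cW : convex_averaging W.
Notation F := (distr_fun FF).
Let F_nd : {homo F : x y / x <= y} := distr_fun_nd lfF.
Let F_ge0 : forall x, 0 <= F x := distr_fun_ge0 FF.
Let rF : regular F := regular_nondecreasing F_nd.
Let V n : R := fine (nu2 (W n)).
Let rE : regular (exprim F). Proof. exact: regular_exprim. Qed.
Let e_ge0 := exprim_ge0 F.
Notation m := (exprim_total F).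
Let g h := pi * (m - prim (exprim F) h).
Let rg : regular g.
Proof.
apply: (regularM (regular_cst pi)); apply: (regularB (regular_cst _)).
by apply: regular_nondecreasing => x y xy; exact: le_prim rE (fun u _ => e_ge0 u) xy.
Qed.

Lemma cell_volume_slln (J : set mR) (c : R) : measurable J -> (forall h : R, J h -> 0 < h) ->
  0 <= c -> (\int[FF]_(h in J) (g h)%:E)%E = c%:E ->
  {ae P, forall w, (cell_volume eta (W n) J w * (V n)^-1%:E)%E @[n --> \oo] --> c%:E}.
Proof.
move=> mJ J0 c0 Jc; have [t0 [t00 Ft0]] := distr_fun_gt0 lfF FF_neq0.
apply: (@slln_monotone _ _ _ P _ V c (4 * interaction FF)).
- by rewrite mulr_ge0//; exact: (interaction_ge0 lfF t00 Ft0).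
- by move=> n; apply: (measurable_cell_volume conf hP) => //; exact: (measurable_window cW).
- by move=> n w; exact: measure_ge0.
- move=> n k w nk; rewrite /cell_volume; apply: le_measure; rewrite ?inE.
  + apply: measurable_xsection; apply: measurable_nearest_set => //.
      by move=> B; exact: (measurable_hit hP).
    by apply: measurableX => //; exact: (measurable_window cW).
  + apply: measurable_xsection; apply: measurable_nearest_set => //.
      by move=> B; exact: (measurable_hit hP).
    by apply: measurableX => //; exact: (measurable_window cW).
  + move=> y /xsectionP[p [ep [Wp Jp] h]]; apply/xsectionP; exists p; split => //.
    by split => //; exact: (window_mono cW nk).
- exact: (window_area_nd cW).
- exact: (window_area_cvg cW).
- move=> n V0; apply: (cell_volume_sqdist lfF conf hP t00 Ft0) => //.
    exact: (measurable_window cW).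
  exact: (window_area cW).
Qed.

Lemma own_count_slln (z : R) : 0 <= z ->
  {ae P, forall w, (own_count eta (W n) z w * (V n)^-1%:E)%E @[n --> \oo] -->
    (stieltjes FF (exprim F) z)%:E}.
Proof.
move=> z0; apply: (@slln_monotone _ _ _ P _ V _ `|own_variance FF z|) => //.
- move=> n; have [b Wb] := window_bounded cW n.
  by apply: (measurable_own_count conf hP _ z0 Wb); exact: (measurable_window cW).
- by move=> n w; apply: esum_ge0 => p _; rewrite lee_fin !mulr_ge0.
- move=> n k w nk; apply: le_esum => p _; rewrite lee_fin !ler_wpM2r//.
  rewrite !indicE; case: (boolP (p.1 \in W n)) => // /set_mem Wn.
  by rewrite mem_set//; exact: (window_mono cW nk).
- exact: (window_area_nd cW).
- exact: (window_area_cvg cW).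
- move=> n V0; have [b Wb] := window_bounded cW n.
  apply: le_trans (own_count_sqdist lfF conf hP (measurable_window cW n) z0 (window_area cW n) V0 Wb) _.
  by rewrite lee_fin ler_wpM2r ?ler_norm// invr_ge0 ltW.
Qed.

Let cellvol_section n J w : measurable J ->
  (\esum_(p in eta w) ((\1_(W n `*` J) p)%:E * nu2 (laguerre_cell p (eta w))) =
   cell_volume eta (W n) J w)%E.
Proof.
move=> mJ; rewrite esum_cell//; last by apply: measurableX => //; exact: (measurable_window cW).
rewrite /cell_volume; congr nu2.
by apply/seteqP; split => y; [move=> h; apply/xsectionP|move=> /xsectionP].
Qed.

Let total n w := cell_volume eta (W n) `]0%R, +oo[%classic w.
Let part n z w := cell_volume eta (W n) `]0%R, z]%classic w.

Let FhatVE n w z : FhatV (W n) (eta w) z = fine (part n z w) / fine (total n w).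
Proof.
rewrite /FhatV /part /total -!cellvol_section//; congr (fine _ / fine _); apply: eq_esum => p ep.
  by congr ((_)%:E * _)%E; rewrite !indicE in_setX/= -natrM mulnb.
congr ((_)%:E * _)%E; rewrite !indicE in_setX/=.
by rewrite [X in _ && X]mem_set ?andbT//= in_itv/= andbT; exact: (conf w).1.
Qed.

Let part_le n w x y : x <= y -> (part n x w <= part n y w)%E.
Proof.
move=> xy; rewrite /part -!cellvol_section//; apply: le_esum => p _.
apply: lee_wpmul2r => //; rewrite lee_fin !indicE !in_setX/=.
case: (boolP (p.2 \in `]0%R, x]%classic)) => [|_]; last by rewrite andbF.
rewrite inE/= in_itv/= => /andP[p0 px].
have py : p.2 \in (`]0%R, y]%classic : set mR) by rewrite inE/= in_itv/= p0 (le_trans px).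
by rewrite py.
Qed.

Let part_total n w x : (part n x w <= total n w)%E.
Proof.
rewrite /part /total -!cellvol_section//; apply: le_esum => p _.
apply: lee_wpmul2r => //; rewrite lee_fin !indicE !in_setX/=.
case: (boolP (p.2 \in `]0%R, x]%classic)) => [|_]; last by rewrite andbF.
rewrite inE/= in_itv/= => /andP[p0 px].
have py : p.2 \in (`]0%R, +oo[%classic : set mR) by rewrite inE/= in_itv/= p0.
by rewrite py.
Qed.

Let total_ge0 n w : (0 <= total n w)%E. Proof. exact: measure_ge0. Qed.

Let V_gt0 : \forall n \near \oo, 0 < V n.
Proof. by have /cvgryPgt/(_ 0) := window_area_cvg cW. Qed.

Let total_fin w : (total n w * (V n)^-1%:E)%E @[n --> \oo] --> 1%:E ->
  \forall n \near \oo, total n w \is a fin_num.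
Proof.
move=> /fine_cvgP[fin _]; apply: filterS2 fin V_gt0 => n; move: (total_ge0 n w).
case: (total n w) => [r||]//= _ + V0.
by rewrite gt0_mulye// lte_fin invr_gt0.
Qed.

Let FhatV_cvg w z (c : R) : (total n w * (V n)^-1%:E)%E @[n --> \oo] --> 1%:E ->
  (part n z w * (V n)^-1%:E)%E @[n --> \oo] --> c%:E ->
  FhatV (W n) (eta w) z @[n --> \oo] --> c.
Proof.
move=> /fine_cvg ct /fine_cvg cp.
have : (fine (part n z w * (V n)^-1%:E)%E / fine (total n w * (V n)^-1%:E)%E) @[n --> \oo] --> c / 1.
  apply: cvgM; first exact: cp.
  by apply: cvgV => //; exact: oner_neq0.
rewrite divr1; apply: cvg_trans; apply: near_eq_cvg.
apply: filterS V_gt0 => n V0.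
rewrite FhatVE; move: (part n z w) (total n w) => a b; rewrite !fine_scale.
by rewrite invfM invrK mulrACA mulVf ?mulr1// gt_eqF.
Qed.

Let stieltjes_incr f (M : R) : regular f -> (forall h, 0 < h -> 0 <= f h <= M) ->
  forall x y, 0 <= x -> x <= y ->
  0 <= stieltjes FF f y - stieltjes FF f x <= M * (F y - F x).
Proof.
move=> rf f0 x y x0 xy; apply/andP; split.
  rewrite -[leLHS](mul0r (F y - F x)); apply: stieltjes_lb => // h xh _.
  by have /andP[] := f0 h (le_lt_trans x0 xh).
by apply: stieltjes_ub => // h xh _; have /andP[] := f0 h (le_lt_trans x0 xh).
Qed.

(** A single null set has to serve all z. The strong laws are applied on a countable set; elsewhere
    F is continuous and monotonicity in z finishes. *)
Lemma estimators_cvg : {ae P, forall w, forall z, 0 <= z ->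
  FhatV (W n) (eta w) z @[n --> \oo] --> stieltjes FF g z /\
  Ghat (W n) (eta w) z @[n --> \oo] --> stieltjes FF (exprim F) z}.
Proof.
have [t0 [t00 Ft0]] := distr_fun_gt0 lfF FF_neq0.
have iE := integrable_exprim F_nd F_ge0 t00 Ft0.
have g_bound h : 0 < h -> 0 <= g h <= pi * m.
  move=> h0; apply/andP; split.
    by rewrite mulr_ge0 ?pi_ge0// ltW//; exact: exprim_tail_gt0 rF F_ge0 iE (ltW h0).
  rewrite ler_wpM2l ?pi_ge0// gerBl; exact: prim_ge0.
have m0 : 0 <= pi * m by have /andP[h1 h2] := g_bound 1 ltr01; exact: le_trans h2.
have e_bound h : 0 < h -> 0 <= exprim F h <= 1.
  by move=> h0; rewrite e_ge0/=; apply: exprim_le1 => //; exact: ltW.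
(* Interpolation between rationals fails at a jump of F, so the jumps, countably many, are added to
   the set on which the strong law is applied directly. *)
pose jumps := \bigcup_n [set x : R | (x \in `]0%R, n%:R[) /\ discontinuity F x].
pose Z := range (@ratr R) `|` jumps.
have cZ : countable Z.
  rewrite (_ : Z = \bigcup_(b in [set: bool]) (if b then range (@ratr R) else jumps)); last first.
    apply/seteqP; split => x; first by move=> [h|h]; [exists true|exists false].
    by move=> [[] _ h]; [left|right].
  apply: bigcup_countable => // -[] _.
    exact: card_le_trans (card_image_le _ _) (countableP _).
  apply: bigcup_countable => // n _; apply: discontinuity_countable.
  by move=> x y _ _; exact: F_nd.
have Hpart : {ae P, forall w, forall z, Z z -> 0 <= z ->
    (part n z w * (V n)^-1%:E)%E @[n --> \oo] --> (stieltjes FF g z)%:E}.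
  apply: ae_countable => // z _; have [z0|z0] := leP 0 z; last by apply: aeW.
  have mJ : measurable (`]0%R, z]%classic : set mR) by exact: measurable_itv.
  have J0 (h : R) : (`]0%R, z]%classic : set mR) h -> 0 < h.
    by rewrite /= in_itv/= => /andP[].
  have c0 : 0 <= stieltjes FF g z.
    by have /andP[+ _] := stieltjes_incr rg g_bound (lexx 0) z0; rewrite stieltjes0 subr0.
  have Jc : (\int[FF]_(h in `]0%R, z]) (g h)%:E)%E = (stieltjes FF g z)%:E.
    rewrite stieltjes.unlock /Rintegral fineK//.
    by apply: integrable_fin_num => //; exact: stieltjes_integrable.
  by apply: filterS (cell_volume_slln mJ J0 c0 Jc) => w h _.
have Hown : {ae P, forall w, forall z, Z z -> 0 <= z ->
    (own_count eta (W n) z w * (V n)^-1%:E)%E @[n --> \oo] --> (stieltjes FF (exprim F) z)%:E}.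
  apply: ae_countable => // z _; have [z0|z0] := leP 0 z; last by apply: aeW.
  by apply: filterS (own_count_slln z0) => w h _.
have Htot : {ae P, forall w, (total n w * (V n)^-1%:E)%E @[n --> \oo] --> 1%:E}.
  apply: cell_volume_slln => //; first by move=> h; rewrite /= in_itv/= andbT.
  exact: (stieltjes_tail_total lfF erefl t00 Ft0).
apply: filterS3 Hpart Hown Htot => w hpart hown htot z z0.
have GZ x : Z x -> 0 <= x -> Ghat (W n) (eta w) x @[n --> \oo] --> stieltjes FF (exprim F) x.
  move=> Zx x0; have /fine_cvg := hown x Zx x0; apply: cvg_trans.
  by apply: near_eq_cvg; apply: nearW => n; rewrite /= fine_scale mulrC.
have VZ x : Z x -> 0 <= x -> FhatV (W n) (eta w) x @[n --> \oo] --> stieltjes FF g x.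
  by move=> Zx x0; exact: FhatV_cvg htot (hpart x Zx x0).
have [zZ|zZ] := pselect (Z z); first by split; [exact: VZ|exact: GZ].
have Zrat (q : rat) : Z (ratr q) by left; exists q.
have z0' : 0 < z.
  rewrite lt_neqAle z0 andbT; apply/eqP => z00; apply: zZ; left; exists 0 => //.
  by rewrite rmorph0.
have nz : narrow F z.
  apply: discontinuity_or_narrow => // dz; apply: zZ; right.
  by exists (Num.truncn z).+1 => //; split => //; rewrite in_itv/= z0' truncnS_gt.
split.
- have mono : \forall n \near \oo, forall x y, 0 <= x -> x <= y ->
      FhatV (W n) (eta w) x <= FhatV (W n) (eta w) y.
    apply: filterS (total_fin htot) => n tf x y _ xy; rewrite !FhatVE.
    apply: ler_wpM2r; first by rewrite invr_ge0; exact: fine_ge0 (total_ge0 n w).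
    have pf u : part n u w \is a fin_num.
      by rewrite ge0_fin_numE// (le_lt_trans (part_total n w u))// -ge0_fin_numE.
    exact: (fine_le (pf x) (pf y) (part_le n w xy)).
  exact: (@monotone_cvg_dense _ (fun n z => FhatV (W n) (eta w) z) (stieltjes FF g) F (pi * m) z
    m0 mono (fun q q0 => VZ _ (Zrat q) q0) (stieltjes_incr rg g_bound) nz).
- have mono : \forall n \near \oo, forall x y, 0 <= x -> x <= y ->
      Ghat (W n) (eta w) x <= Ghat (W n) (eta w) y.
    apply: nearW => n x y x0 xy; rewrite /Ghat ler_wpM2l ?invr_ge0 ?fine_ge0//.
    have [b Wb] := window_bounded cW n.
    apply: fine_le; [exact: (own_count_fin conf x0 Wb)|exact: (own_count_fin conf (le_trans x0 xy) Wb)|].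
    apply: le_esum => p _; rewrite lee_fin ler_wpM2r// ler_wpM2l// !indicE.
    case: (boolP (p.2 \in `]0%R, x]%classic)) => [|_]; last by rewrite ler0n.
    rewrite inE/= in_itv/= => /andP[p0 px].
    have py : p.2 \in (`]0%R, y]%classic : set mR) by rewrite inE/= in_itv/= p0 (le_trans px).
    by rewrite py.
  exact: (@monotone_cvg_dense _ (fun n z => Ghat (W n) (eta w) z) (stieltjes FF (exprim F)) F 1 z
    ler01 mono (fun q q0 => GZ _ (Zrat q) q0) (stieltjes_incr rE e_bound) nz).
Qed.

Lemma Fhat_cvg_ae : {ae P, forall w, forall z, 0 <= z ->
    Fhat (W n) (eta w) z
      @[n --> within [set n | Fhat_defined (W n) (eta w)] \oo]
      --> distr_fun FF z}.
Proof.
apply: filterS estimators_cvg => w H.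
by apply: (Fhat_cvg lfF FF_neq0) => z z0; have [] := H z z0.
Qed.

End almost_sure.

Section sigma_finite_copy.
Variables (R : realType) (FF : {measure set (measurableTypeR R) -> \bar R}).
Hypothesis lfF : locally_finite_pos FF.

(** The proof of local finiteness is made part of the term, so that the sigma-finite structure
    required by Fubini can be inferred from it. The copy is convertible with [FF], hence results
    about it apply to [FF] unchanged. *)
Definition sigma_copy of locally_finite_pos FF : set (measurableTypeR R) -> \bar R := FF.

HB.instance Definition _ := Measure.copy (sigma_copy lfF) FF.

Let sigma_copy_finite : sigma_finite setT (sigma_copy lfF).
Proof.
exists (fun n : nat => `](- n%:R : R), n%:R]%classic).
  apply/seteqP; split => // x _; exists (Num.truncn `|x|).+1 => //=; rewrite in_itv/=.
  have := truncnS_gt `|x|; move: (_.+1%:R) => N xN.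
  have := ler_norm x; have := ler_norm (- x); rewrite normrN => h1 h2.
  by apply/andP; split; lra.
move=> n; split; first exact: measurable_itv.
exact: (locally_finite_itv lfF).
Qed.

HB.instance Definition _ :=
  @Measure_isSigmaFinite.Build _ _ _ (sigma_copy lfF) sigma_copy_finite.

End sigma_finite_copy.

Theorem theorem13 (R : realType) (d : measure_display)
    (Omega : measurableType d) (P : probability Omega R)
    (FF : {measure set (measurableTypeR R) -> \bar R})
    (eta : Omega -> set (R * R * R)) (W : nat -> set (R * R)) :
  locally_finite_pos FF ->
  FF setT <> 0%E ->
  (forall w, configuration (eta w)) ->
  poisson_process P (@nu2 R \x FF)%E eta ->
  convex_averaging W ->
  {ae P, forall w, forall z, 0 <= z ->
    Fhat (W n) (eta w) z
      @[n --> within [set n | Fhat_defined (W n) (eta w)] \oo]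
      --> distr_fun FF z}.
Proof.
move=> lfF FF0 conf hP cW.
exact: (@Fhat_cvg_ae R d Omega P (sigma_copy lfF) eta W lfF FF0 conf hP cW).
Qed.
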